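(* Let $\alpha\ge0$, $\gamma>0$, $0\le\xi\le1$, let $\mu\ge1$ and $\nu>0$ satisfy $\mu+\nu=\alpha-\gamma$ and $\mu\nu=\gamma$. Let $a>-1$, $b>-1$ and $$\lambda(t)=\begin{cases}(a+1)(b+1)\dfrac{t^a(1-t^{b-a})}{b-a}, & b\ne a,\\[2mm] (a+1)^2t^a\log(1/t), & b=a.\end{cases}$$ Let $\beta<1$ satisfy $$\frac{\beta-1/2}{1-\beta}=-\int_0^1\lambda(t)q(t)\,dt .$$ Suppose that $a$, $b$ and $\mu$ satisfy one of the following conditions: (i) $b>a$, $-1<a<0$ and $b+a-1<\frac1\mu<b-1$; (ii) $b<a$, $-1<b<0$ and $b+a-1<\frac1\mu<a-1$; (iii) $b=a<0$ and $\frac1\mu>b-1$. If $f\in W_\beta(\alpha,\gamma)$, then the function $V_\lambda(f)(z)=\int_0^1\lambda(t)\frac{f(tz)}{t}\,dt$ belongs to $M(\xi)$.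
   Context: $\mathbb{D}=\{z\in\mathbb{C}:|z|<1\}$. $\mathcal{A}$ is the class of analytic functions $f$ in $\mathbb{D}$ with $f(0)=f'(0)-1=0$. For $0\le\xi\le1$, the Pascu class $M(\xi)$ consists of the $f\in\mathcal{A}$ with $\mathrm{Re}\,\dfrac{\xi z(zf'(z))'+(1-\xi)zf'(z)}{\xi zf'(z)+(1-\xi)f(z)}>0$ in $\mathbb{D}$, i.e. $\xi zf'+(1-\xi)f$ is starlike with respect to the origin. For $\alpha\ge0,\gamma\ge0,\beta<1$, $W_\beta(\alpha,\gamma)$ is the class of $f\in\mathcal{A}$ for which there is $\phi\in\mathbb{R}$ with $\mathrm{Re}\left(e^{i\phi}\left((1-\alpha+2\gamma)\frac{f(z)}{z}+(\alpha-2\gamma)f'(z)+\gamma zf''(z)-\beta\right)\right)>0$ for all $z\in\mathbb{D}$. $q$ is the solution of $\frac{d}{dt}\left[t^{1/\nu}q(t)\right]=\frac{1}{\mu\nu}t^{1/\nu-1}\int_0^1 s^{1/\mu-1}\frac{1-st}{(1+st)^3}\,ds$ with $q(0)=1$, with series $q(t)=\sum_{n=0}^\infty\frac{(n+1)^2(-1)^nt^n}{(1+\mu n)(1+\nu n)}$. *)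

(* Defs.v *)
From Stdlib Require Import Reals.
From Coquelicot Require Import Coquelicot.
Open Scope R_scope.

Definition unit_disc (z : C) : Prop := Cmod z < 1.

(* Functions on the disc are total functions [C -> C]; their values outside
   the disc are never used. [C_derive] is a total operator, meaningful where
   [ex_derive] holds. *)
Definition analytic_in_disc (f : C -> C) : Prop :=
  forall z : C, unit_disc z ->
    ex_derive (K := C_AbsRing) (V := C_NormedModule) f z.

Definition class_A (f : C -> C) : Prop :=
  analytic_in_disc f /\ f 0%C = 0%C /\ C_derive f 0%C = 1%C.

Definition pascu_num (xi : R) (f : C -> C) (z : C) : C :=
  (xi * (z * C_derive (fun w => w * C_derive f w) z)
   + (1 - xi) * (z * C_derive f z))%C.

Definition pascu_den (xi : R) (f : C -> C) (z : C) : C :=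
  (xi * (z * C_derive f z) + (1 - xi) * f z)%C.

(* At [z = 0] the quotient has a removable singularity, with value 1 for every
   [f] in [class_A]; hence only [z <> 0] is constrained. *)
Definition class_M (xi : R) (f : C -> C) : Prop :=
  class_A f /\
  forall z : C, unit_disc z -> z <> 0%C ->
    pascu_den xi f z <> 0%C /\
    0 < Re (pascu_num xi f z / pascu_den xi f z)%C.

(* [f z / z], extended at the removable singularity [z = 0] (where [f 0 = 0])
   by its limit. *)
Definition div_id (f : C -> C) (z : C) : C :=
  if Ceq_dec z 0%C then C_derive f 0%C else (f z / z)%C.

Definition cis (phi : R) : C := (cos phi, sin phi).

Definition class_W (beta alpha gamma : R) (f : C -> C) : Prop :=
  class_A f /\
  exists phi : R, forall z : C, unit_disc z ->
    0 < Re (cis phi *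
            ((1 - alpha + 2 * gamma) * div_id f z
             + (alpha - 2 * gamma) * C_derive f z
             + gamma * (z * C_derive (C_derive f) z) - beta))%C.

(* The initial condition includes right-continuity at 0: the equation alone
   determines [q] on (0,1) only up to a multiple of t^(-1/nu). *)
Definition is_q (mu nu : R) (q : R -> R) : Prop :=
  q 0 = 1 /\ filterlim q (at_right 0) (locally (q 0)) /\
  forall t : R, 0 < t < 1 ->
    is_derive (fun u => Rpower u (1 / nu) * q u) t
      (1 / (mu * nu) * Rpower t (1 / nu - 1) *
       RInt_gen (fun s => Rpower s (1 / mu - 1) * ((1 - s * t) / (1 + s * t) ^ 3))
         (at_right 0) (at_left 1)).

Definition lambda (a b t : R) : R :=
  if Req_EM_T b a
  then (a + 1) ^ 2 * Rpower t a * ln (1 / t)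
  else (a + 1) * (b + 1) * (Rpower t a * (1 - Rpower t (b - a)) / (b - a)).

Definition V_op (lam : R -> R) (f : C -> C) (z : C) : C :=
  RInt_gen (V := C_R_CompleteNormedModule)
    (fun t : R => (lam t * (f (t * z) / t))%C) (at_right 0) (at_left 1).

(* Main.v *)
Require Import Defs.
From Stdlib Require Import Reals Lra Lia Psatz.
From Coquelicot Require Import Coquelicot.
Open Scope R_scope.

(** Write f(z) = z + sum a_(n+1) z^(n+1). Since mu + nu = alpha - gamma and
mu nu = gamma, the expression defining the class W has the Taylor coefficients
g_n = (1 + mu n)(1 + nu n) a_(n+1), while V_lambda multiplies a_(n+1) by the
n-th moment tau_n = (a+1)(b+1) / ((n+a+1)(n+b+1)) of lambda.

Let F = V_lambda(f) and K = xi z F' + (1 - xi) F. The value p = z K'/K has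
positive real part, and K does not vanish, as soon as
((1 + x) z K' + (1 - x) K) / 2 has no zero for any |x| <= 1: a p with
Re p <= 0 produces a zero at x = (1 + p) / (1 - p), and x = -1 gives K itself.
Divided by z, this combination is the series of A_n g_n z^n, where
A_n = (1 + n (1+x)/2) (1 + xi n) tau_n / ((1 + mu n)(1 + nu n)).

Duality ([duality]). The real part u of e^(i phi) (g - beta) is positive on every
circle. Integrated against Re A - m on a circle, with
m = 1 - 1 / (2 (1 - beta)), it gives, by orthogonality of the exponentials
([fourier_pairing]), pi times the real part of e^(i phi) sum A_n g_n z^n. So it
is enough that Re A > m on the unit disc. The differential equation and the
initial condition force q(t) = sum (n+1)^2 (-t)^n / ((1 + mu n)(1 + nu n))
([q_series]), hence the equation for beta says that m is the integral of
lambda q, that is sum tau_n (n+1)^2 (-1)^n / ((1 + mu n)(1 + nu n))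
([lambda_q_integral]).

The remaining inequality ([coefficient_inequality]) compares, for suitable
positive sequences c, the real part of sum c_n (1 + n (1+x)/2) w^n with the value
sum c_n (n+1) (-s)^n that it takes at x = 1, w = -s, for |w| <= s. The sequences
for which it holds form a cone, and this cone is stable under
c_n -> c_n / (n + k) with k > 0, since this division is an average over the
concentric discs of radius u with density u^(k-1) ([admissible_div]). The sequence
1 / ((n+1)(n+3)) belongs to the cone: its inequality is the integral over t in
(0,1) of a pointwise inequality ([kernel_ineq]), in which the term containing x
is bounded by its modulus and what remains is increasing in Re w
([kernel_real]). Dividing partial fractions, (n+1)(n+3) / ((n+a+1)(n+b+1)) has
nonnegative coefficients when a <= 0 and a + b <= 2, and so has
(n+1) / (n + 1/mu) since mu >= 1. Each of the three cases implies, up to an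
exchange of a and b, that a <= 0 and a + b <= 2, because 1/mu <= 1. Finally
(1 + xi n) / (n+1) = xi + (1 - xi) / (n+1) accounts for xi by one more average.

The Taylor expansion of f comes from Cauchy's formula. For the latter, the circle
is contracted to z along the rays ending at z, and Goursat's bisection is carried
out in the coordinates (fraction of the ray, angle) of this contraction
([goursat_loop], [cauchy_formula], [taylor_expansion]). *)

(** * Bisection of rectangles *)

(** The last quarter is the default: by subadditivity it carries a fourth of the mass when the other three do not. *)
Definition heavy_quarter (Q : R -> R -> nat -> R) (h k : R) (n : nat) (p : R * R) : R * R :=
  let x := fst p in let y := snd p in
  let q := Q x y n / 4 in
  let x' := x + h / 2 ^ S n in let y' := y + k / 2 ^ S n in
  if Rle_lt_dec q (Q x y (S n)) then (x, y) else
  if Rle_lt_dec q (Q x' y (S n)) then (x', y) else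
  if Rle_lt_dec q (Q x y' (S n)) then (x, y') else (x', y').

Fixpoint heavy_quarters Q h k (p : R * R) (n : nat) : R * R :=
  match n with
  | O => p
  | S m => heavy_quarter Q h k m (heavy_quarters Q h k p m)
  end.

Lemma half_pow_pos h n : 0 < h -> 0 < h / 2 ^ n.
Proof. intros H. apply Rdiv_lt_0_compat; auto. apply pow_lt; lra. Qed.

Lemma half_pow_S h n : h / 2 ^ S n = h / 2 ^ n / 2.
Proof. simpl. field. apply pow_nonzero; lra. Qed.

Lemma halving_limit (h : R) (x : nat -> R) : 0 < h ->
  (forall n, x n <= x (S n) <= x n + h / 2 ^ S n) ->
  exists l, forall n, x n <= l <= x n + h / 2 ^ n.
Proof.
intros Hh Hs.
assert (Hup : forall n m, x (n + m)%nat + h / 2 ^ (n + m) <= x n + h / 2 ^ n).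
{ intros n m; induction m as [|m IH].
  - rewrite Nat.add_0_r; lra.
  - rewrite Nat.add_succ_r. specialize (Hs (n + m)%nat).
    rewrite half_pow_S in *. lra. }
assert (Hinc : forall n m, x n <= x (n + m)%nat).
{ intros n m; induction m as [|m IH].
  - rewrite Nat.add_0_r; lra.
  - rewrite Nat.add_succ_r. specialize (Hs (n + m)%nat). lra. }
destruct (ex_finite_lim_seq_incr x (x 0%nat + h / 2 ^ 0)) as [l Hl].
- intro n; apply Hs.
- intro n. specialize (Hup 0%nat n). pose proof (half_pow_pos h n Hh). simpl (0 + n)%nat in Hup. lra.
- exists l; intro n; split.
  + apply (is_lim_seq_le_loc (fun _ => x n) x (x n) l); auto using is_lim_seq_const.
    exists n; intros m Hm. replace m with (n + (m - n))%nat by lia. apply Hinc.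
  + apply (is_lim_seq_le_loc x (fun _ => x n + h / 2 ^ n) l (x n + h / 2 ^ n)); auto using is_lim_seq_const.
    exists n; intros m Hm. replace m with (n + (m - n))%nat by lia.
    specialize (Hup n (m - n)%nat). pose proof (half_pow_pos h (n + (m - n)) Hh). lra.
Qed.

(** Goursat's argument for a subadditive function of rectangles, the rectangle of
corner (x, y) and generation n having sides h / 2^n and k / 2^n. If it were positive on the
whole rectangle, some nested sequence of quarters would keep a share 1 / 4^n of it, against
smallness at the common point of the sequence. *)
Lemma quadrisection (Q : R -> R -> nat -> R) (x0 y0 h k : R) : 0 < h -> 0 < k ->
  (forall x y n, x0 <= x -> x + h / 2 ^ n <= x0 + h -> y0 <= y -> y + k / 2 ^ n <= y0 + k ->
     Q x y n <= Q x y (S n) + Q (x + h / 2 ^ S n) y (S n)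
              + Q x (y + k / 2 ^ S n) (S n) + Q (x + h / 2 ^ S n) (y + k / 2 ^ S n) (S n)) ->
  (forall x y, x0 <= x <= x0 + h -> y0 <= y <= y0 + k -> forall eps, 0 < eps ->
     exists n0, forall n x' y', (n0 <= n)%nat ->
       x0 <= x' -> x' + h / 2 ^ n <= x0 + h -> y0 <= y' -> y' + k / 2 ^ n <= y0 + k ->
       x' <= x <= x' + h / 2 ^ n -> y' <= y <= y' + k / 2 ^ n ->
       Q x' y' n <= eps / 4 ^ n) ->
  Q x0 y0 0%nat <= 0.
Proof.
intros Hh Hk Hsub Hloc.
set (s := heavy_quarters Q h k (x0, y0)).
assert (Hstep : forall n, let x := fst (s n) in let y := snd (s n) in
   x0 <= x -> x + h / 2 ^ n <= x0 + h -> y0 <= y -> y + k / 2 ^ n <= y0 + k ->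
   (x <= fst (s (S n)) <= x + h / 2 ^ S n) /\ (y <= snd (s (S n)) <= y + k / 2 ^ S n) /\
   Q x y n / 4 <= Q (fst (s (S n))) (snd (s (S n))) (S n)).
{ intros n x y A1 A2 A3 A4. specialize (Hsub x y n A1 A2 A3 A4).
  pose proof (half_pow_pos h (S n) Hh). pose proof (half_pow_pos k (S n) Hk).
  change (s (S n)) with (heavy_quarter Q h k n (s n)).
  unfold heavy_quarter; fold x; fold y.
  destruct (Rle_lt_dec _ (Q x y (S n))); [cbn [fst snd]; repeat split; lra|].
  destruct (Rle_lt_dec _ (Q (x + h / 2 ^ S n) y (S n))); [cbn [fst snd]; repeat split; lra|].
  destruct (Rle_lt_dec _ (Q x (y + k / 2 ^ S n) (S n))); cbn [fst snd]; repeat split; lra. }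
assert (Hbox : forall n, let x := fst (s n) in let y := snd (s n) in
   x0 <= x /\ x + h / 2 ^ n <= x0 + h /\ y0 <= y /\ y + k / 2 ^ n <= y0 + k /\
   Q x0 y0 0%nat / 4 ^ n <= Q x y n).
{ induction n as [|n IH]; intros x y.
  - unfold x, y; simpl. repeat split; lra.
  - destruct IH as (B1 & B2 & B3 & B4 & B5).
    destruct (Hstep n B1 B2 B3 B4) as (C1 & C2 & C3). fold x in C1, C3. fold y in C2, C3.
    rewrite half_pow_S in C1, C2. rewrite !half_pow_S.
    repeat split; try lra.
    replace (Q x0 y0 0%nat / 4 ^ S n) with (Q x0 y0 0%nat / 4 ^ n / 4).
    lra. simpl; field; apply pow_nonzero; lra. }
destruct (halving_limit h (fun n => fst (s n)) Hh) as [x Hx].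
{ intro n. destruct (Hbox n) as (B1 & B2 & B3 & B4 & B5). apply (Hstep n); auto. }
destruct (halving_limit k (fun n => snd (s n)) Hk) as [y Hy].
{ intro n. destruct (Hbox n) as (B1 & B2 & B3 & B4 & B5). apply (Hstep n); auto. }
apply Rnot_lt_le; intro Hpos.
destruct (Hloc x y) with (eps := Q x0 y0 0%nat / 2) as [n Hn].
- specialize (Hx 0%nat). unfold s in Hx; simpl in Hx. lra.
- specialize (Hy 0%nat). unfold s in Hy; simpl in Hy. lra.
- lra.
- destruct (Hbox n) as (B1 & B2 & B3 & B4 & B5).
  specialize (Hn n _ _ (Nat.le_refl n) B1 B2 B3 B4 (Hx n) (Hy n)).
  assert (0 < 4 ^ n) by (apply pow_lt; lra).
  assert (Q x0 y0 0%nat / 4 ^ n <= Q x0 y0 0%nat / 2 / 4 ^ n) by lra.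
  apply Rmult_le_compat_r with (r := 4 ^ n) in H0; [|lra].
  unfold Rdiv in H0. rewrite !Rmult_assoc, Rinv_l in H0 by lra. lra.
Qed.

(** * Derivatives, continuity and integrals of complex functions *)

Lemma ball_Rabs (x y e : R) : ball (M := R_UniformSpace) x e y -> Rabs (y - x) < e.
Proof. auto. Qed.

Lemma Rabs_ball (x y e : R) : Rabs (y - x) < e -> ball (M := R_UniformSpace) x e y.
Proof. auto. Qed.

(** Complex differentiability in epsilon-delta form; [Cdiff_is_derive] relates it to the
derivative over the normed field of complex numbers. *)
Definition Cdiff (f : C -> C) (z l : C) : Prop :=
  forall eps, 0 < eps -> exists d, 0 < d /\ forall w, Cmod (w - z) < d ->
    Cmod (f w - f z - l * (w - z)) <= eps * Cmod (w - z).

Lemma Cdiff_is_derive f z l :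
  Cdiff f z l <-> is_derive (K := C_AbsRing) (V := C_NormedModule) f z l.
Proof.
split.
- intros H; split; [apply is_linear_scal_l|].
  intros x Hx. apply (is_filter_lim_locally_unique (K := C_AbsRing) (V := AbsRing_NormedModule C_AbsRing)) in Hx. subst x.
  intros eps. destruct (H eps (cond_pos eps)) as (d & Hd & Hw).
  exists (mkposreal d Hd). intros w Hball.
  specialize (Hw w Hball).
  rewrite (Cmult_comm l) in Hw. exact Hw.
- intros [_ H] eps Heps.
  specialize (H z (fun P HP => HP) (mkposreal eps Heps)).
  destruct H as [d Hd]. exists d; split; [apply cond_pos|].
  intros w Hw. specialize (Hd w Hw).
  rewrite (Cmult_comm l). exact Hd.
Qed.

Lemma Cdiff_C_derive f z l : Cdiff f z l -> C_derive f z = l.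
Proof. intros H. apply is_C_derive_unique, Cdiff_is_derive, H. Qed.

Lemma ex_derive_Cdiff f z :
  ex_derive (K := C_AbsRing) (V := C_NormedModule) f z -> Cdiff f z (C_derive f z).
Proof.
intros [l Hl]. rewrite (is_C_derive_unique f z l Hl). apply Cdiff_is_derive, Hl.
Qed.

Lemma Cdiff_ex_derive f z l :
  Cdiff f z l -> ex_derive (K := C_AbsRing) (V := C_NormedModule) f z.
Proof. intros H. exists l. apply Cdiff_is_derive, H. Qed.

Lemma Cdiff_ext_loc f g z l d : 0 < d ->
  (forall w, Cmod (w - z) < d -> f w = g w) -> Cdiff f z l -> Cdiff g z l.
Proof.
intros Hd Hfg H eps Heps. destruct (H eps Heps) as (d' & Hd' & H').
exists (Rmin d d'); split; [apply Rmin_glb_lt; auto|].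
intros w Hw. rewrite <- !Hfg; [apply H'| |].
- eapply Rlt_le_trans; [apply Hw|apply Rmin_r].
- replace (z - z)%C with (RtoC 0) by ring. rewrite Cmod_0; auto.
- eapply Rlt_le_trans; [apply Hw|apply Rmin_l].
Qed.

Lemma Cdiff_cont f z l : Cdiff f z l ->
  forall eps, 0 < eps -> exists d, 0 < d /\ forall w, Cmod (w - z) < d -> Cmod (f w - f z) < eps.
Proof.
intros H eps Heps. destruct (H 1 Rlt_0_1) as (d & Hd & Hw).
pose proof (Cmod_ge_0 l).
exists (Rmin d (eps / (2 + Cmod l))). split.
{ apply Rmin_glb_lt; auto. apply Rdiv_lt_0_compat; lra. }
intros w Hw'. assert (H1 : Cmod (w - z) < d) by (eapply Rlt_le_trans; [apply Hw'|apply Rmin_l]).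
assert (H2 : Cmod (w - z) < eps / (2 + Cmod l)) by (eapply Rlt_le_trans; [apply Hw'|apply Rmin_r]).
specialize (Hw w H1).
replace (f w - f z)%C with ((f w - f z - l * (w - z)) + l * (w - z))%C by ring.
eapply Rle_lt_trans; [apply Cmod_triangle|]. rewrite Cmod_mult.
apply Rmult_lt_compat_r with (r := 2 + Cmod l) in H2; [|lra].
unfold Rdiv in H2; rewrite Rmult_assoc, Rinv_l in H2 by lra.
pose proof (Cmod_ge_0 (w - z)). nra.
Qed.

Definition Ccont (g : R -> C) (t : R) : Prop :=
  continuous (fun s => fst (g s)) t /\ continuous (fun s => snd (g s)) t.

Lemma Ccont_const c t : Ccont (fun _ => c) t.
Proof. split; apply continuous_const. Qed.

Lemma Ccont_RtoC g t : continuous g t -> Ccont (fun s => RtoC (g s)) t.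
Proof. intros H; split; simpl; auto. apply continuous_const. Qed.

Lemma Ccont_plus g h t : Ccont g t -> Ccont h t -> Ccont (fun s => g s + h s)%C t.
Proof.
intros [A1 A2] [B1 B2]; split; simpl.
- apply (continuous_plus (fun s => fst (g s)) (fun s => fst (h s))); auto.
- apply (continuous_plus (fun s => snd (g s)) (fun s => snd (h s))); auto.
Qed.

Lemma Ccont_opp g t : Ccont g t -> Ccont (fun s => - g s)%C t.
Proof.
intros [A1 A2]; split; simpl.
- apply (continuous_opp (fun s => fst (g s))); auto.
- apply (continuous_opp (fun s => snd (g s))); auto.
Qed.

Lemma Ccont_mult g h t : Ccont g t -> Ccont h t -> Ccont (fun s => g s * h s)%C t.
Proof.
intros [A1 A2] [B1 B2]; split; simpl.
- apply (continuous_minus (fun s => fst (g s) * fst (h s)) (fun s => snd (g s) * snd (h s)));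
  apply (continuous_mult (K := R_AbsRing)); auto.
- apply (continuous_plus (fun s => fst (g s) * snd (h s)) (fun s => snd (g s) * fst (h s)));
  apply (continuous_mult (K := R_AbsRing)); auto.
Qed.

(** Bridge between the componentwise definition, which serves integration, and the
modulus, which serves composition with differentiable functions. *)
Lemma Ccont_eps g t : Ccont g t <->
  forall eps, 0 < eps -> exists d, 0 < d /\ forall s, Rabs (s - t) < d -> Cmod (g s - g t) < eps.
Proof.
split.
- intros [A B] eps Heps.
  assert (He : 0 < eps / 2) by lra.
  apply filterlim_locally with (eps := mkposreal _ He) in A.
  apply filterlim_locally with (eps := mkposreal _ He) in B.
  destruct A as [d1 A]. destruct B as [d2 B].
  exists (Rmin d1 d2). split; [apply Rmin_glb_lt; apply cond_pos|].
  intros s Hs.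
  assert (A' := A s (Rlt_le_trans _ _ _ Hs (Rmin_l _ _))).
  assert (B' := B s (Rlt_le_trans _ _ _ Hs (Rmin_r _ _))).
  unfold ball in A', B'; simpl in A', B'; unfold AbsRing_ball, abs, minus, plus, opp in A', B'; simpl in A', B'.
  replace (g s - g t)%C with (RtoC (fst (g s) - fst (g t)) + Ci * RtoC (snd (g s) - snd (g t)))%C.
  + eapply Rle_lt_trans; [apply Cmod_triangle|]. rewrite Cmod_mult, Cmod_Ci, !Cmod_R.
    unfold Rminus; lra.
  + apply injective_projections; simpl; ring.
- intros H; split; apply filterlim_locally; intros eps;
  destruct (H eps (cond_pos eps)) as (d & Hd & H'); exists (mkposreal d Hd); intros s Hs;
  specialize (H' s Hs); pose proof (Rmax_Cmod (g s - g t)%C) as M;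
  [pose proof (Rmax_l (Rabs (fst (g s - g t)%C)) (Rabs (snd (g s - g t)%C)))
  |pose proof (Rmax_r (Rabs (fst (g s - g t)%C)) (Rabs (snd (g s - g t)%C)))];
  (eapply Rle_lt_trans; [|exact H']); (eapply Rle_trans; [|exact M]);
  (eapply Rle_trans; [|eassumption]); apply Rle_refl.
Qed.

Lemma Ccont_comp f l g t : Ccont g t -> Cdiff f (g t) l -> Ccont (fun s => f (g s)) t.
Proof.
intros Hg Hf. apply Ccont_eps; intros eps Heps.
destruct (Cdiff_cont _ _ _ Hf eps Heps) as (d & Hd & H).
destruct (proj1 (Ccont_eps g t) Hg d Hd) as (d' & Hd' & H').
exists d'; split; auto.
Qed.

Lemma Cinv_Cdiff (z : C) : z <> RtoC 0 -> exists l, Cdiff Cinv z l.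
Proof.
intros Hz. exists (- / (z * z))%C. intros eps Heps.
assert (Hm := proj1 (Cmod_gt_0 z) Hz).
exists (Rmin (Cmod z / 2) (eps * (Cmod z ^ 3) / 2)). split.
{ apply Rmin_glb_lt. lra. apply Rdiv_lt_0_compat; [|lra]. apply Rmult_lt_0_compat; auto. apply pow_lt; auto. }
intros w Hw.
assert (H1 : Cmod (w - z) < Cmod z / 2) by (eapply Rlt_le_trans; [apply Hw|apply Rmin_l]).
assert (H2 : Cmod (w - z) < eps * Cmod z ^ 3 / 2) by (eapply Rlt_le_trans; [apply Hw|apply Rmin_r]).
assert (Hwz : Cmod z / 2 < Cmod w).
{ pose proof (Cmod_triangle w (z - w)). replace (w + (z - w))%C with z in H by ring.
  replace (z - w)%C with (- (w - z))%C in H by ring. rewrite Cmod_opp in H. lra. }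
assert (Hw0 : w <> RtoC 0) by (intros ->; rewrite Cmod_0 in Hwz; lra).
replace (/ w - / z - - / (z * z) * (w - z))%C with ((w - z) * ((w - z) / (w * (z * z))))%C by (field; auto).
rewrite Cmod_mult, Rmult_comm. apply Rmult_le_compat_r; [apply Cmod_ge_0|].
assert (Hd : (w * (z * z))%C <> RtoC 0) by (repeat apply Cmult_neq_0; auto).
rewrite Cmod_div, !Cmod_mult by auto.
apply Rmult_le_reg_r with (Cmod w * (Cmod z * Cmod z)).
{ apply Rmult_lt_0_compat; nra. }
unfold Rdiv. rewrite Rmult_assoc, Rinv_l, Rmult_1_r by (apply Rgt_not_eq, Rmult_lt_0_compat; nra).
apply Rle_trans with (eps * Cmod z ^ 3 / 2); [lra|].
simpl. assert (0 < Cmod z * Cmod z) by nra.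
assert (0 < eps * (Cmod z * Cmod z)) by nra. nra.
Qed.

Lemma Ccont_div g h t : Ccont g t -> Ccont h t -> h t <> RtoC 0 -> Ccont (fun s => g s / h s)%C t.
Proof.
intros Hg Hh Hz. apply Ccont_mult; auto.
destruct (Cinv_Cdiff (h t) Hz) as [l Hl]. apply (Ccont_comp Cinv l); auto.
Qed.

Definition CInt (g : R -> C) (a b : R) : C :=
  (RInt (fun t => fst (g t)) a b, RInt (fun t => snd (g t)) a b).

Definition is_CInt (g : R -> C) (a b : R) (l : C) : Prop :=
  is_RInt (fun t => fst (g t)) a b (fst l) /\ is_RInt (fun t => snd (g t)) a b (snd l).

Lemma is_CInt_unique g a b l : is_CInt g a b l -> CInt g a b = l.
Proof.
intros [A B]. unfold CInt. rewrite (is_RInt_unique _ _ _ _ A), (is_RInt_unique _ _ _ _ B).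
destruct l; reflexivity.
Qed.

Lemma is_CInt_cont g a b : (forall t, Rmin a b <= t <= Rmax a b -> Ccont g t) ->
  is_CInt g a b (CInt g a b).
Proof.
intros H; split; apply (RInt_correct (V := R_CompleteNormedModule)), ex_RInt_continuous; intros t Ht; apply H; auto.
Qed.

Lemma is_CInt_ext g h a b l : (forall t, Rmin a b < t < Rmax a b -> g t = h t) ->
  is_CInt g a b l -> is_CInt h a b l.
Proof.
intros H [A B]; split.
- eapply is_RInt_ext; [|exact A]. intros t Ht; simpl; rewrite (H t Ht); auto.
- eapply is_RInt_ext; [|exact B]. intros t Ht; simpl; rewrite (H t Ht); auto.
Qed.

Lemma is_CInt_plus g h a b l m : is_CInt g a b l -> is_CInt h a b m ->
  is_CInt (fun t => g t + h t)%C a b (l + m)%C.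
Proof. intros [A B] [A' B']; split; apply @is_RInt_plus; auto. Qed.

Lemma is_CInt_mult c g a b l : is_CInt g a b l -> is_CInt (fun t => c * g t)%C a b (c * l)%C.
Proof.
intros [A B]; split; simpl.
- apply @is_RInt_minus; apply @is_RInt_scal; auto.
- apply @is_RInt_plus; apply @is_RInt_scal; auto.
Qed.

Lemma is_CInt_Chasles g a b c l m : is_CInt g a b l -> is_CInt g b c m -> is_CInt g a c (l + m)%C.
Proof. intros [A B] [A' B']; split; eapply @is_RInt_Chasles; eauto. Qed.

Lemma is_CInt_const c a b : is_CInt (fun _ => c) a b (RtoC (b - a) * c)%C.
Proof.
split; simpl.
- replace ((b - a) * fst c - 0 * snd c) with (scal (b - a) (fst c)) by (unfold scal; simpl; unfold mult; simpl; ring).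
  apply @is_RInt_const.
- replace ((b - a) * snd c + 0 * fst c) with (scal (b - a) (snd c)) by (unfold scal; simpl; unfold mult; simpl; ring).
  apply @is_RInt_const.
Qed.

Lemma is_CInt_bound g a b l M : a <= b -> (forall t, a <= t <= b -> Cmod (g t) <= M) ->
  is_CInt g a b l -> Cmod l <= (b - a) * M.
Proof.
intros Hab HM [A B]. rewrite Cmod_norm.
apply (norm_RInt_le_const (V := C_R_NormedModule) g a b l M); auto.
- intros t Ht. rewrite <- Cmod_norm. auto.
- destruct l as [lu lv]. apply (is_RInt_fct_extend_pair (U := R_NormedModule) (V := R_NormedModule)); auto.
Qed.

(** * Contraction of a circle to an interior point *)

Lemma Cmod_cis t : Cmod (cis t) = 1.
Proof.
unfold Cmod, cis; cbn [fst snd]. pose proof (sin2_cos2 t) as H. unfold Rsqr in H.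
replace (cos t ^ 2 + sin t ^ 2) with 1 by (simpl; lra). apply sqrt_1.
Qed.

Lemma cis_neq_0 t : cis t <> RtoC 0.
Proof. intros H. pose proof (Cmod_cis t). rewrite H, Cmod_0 in H0. lra. Qed.

Lemma cis_lipschitz s t : Cmod (cis s - cis t) <= 2 * Rabs (s - t).
Proof.
assert (Hc : Rabs (cos s - cos t) <= Rabs (s - t)).
{ destruct (MVT_gen cos t s (fun x => - sin x)) as (c & _ & Hc).
  - intros x _. auto_derive; auto; ring.
  - intros x _. apply continuity_cos.
  - rewrite Hc, Rabs_mult, Rabs_Ropp. pose proof (SIN_bound c).
    assert (Rabs (sin c) <= 1) by (apply Rabs_le; lra). pose proof (Rabs_pos (s - t)). nra. }
assert (Hs : Rabs (sin s - sin t) <= Rabs (s - t)).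
{ destruct (MVT_gen sin t s cos) as (c & _ & Hs).
  - intros x _. auto_derive; auto; ring.
  - intros x _. apply continuity_sin.
  - rewrite Hs, Rabs_mult. pose proof (COS_bound c).
    assert (Rabs (cos c) <= 1) by (apply Rabs_le; lra). pose proof (Rabs_pos (s - t)). nra. }
replace (cis s - cis t)%C with (RtoC (cos s - cos t) + Ci * RtoC (sin s - sin t))%C
  by (unfold cis; apply injective_projections; simpl; ring).
eapply Rle_trans; [apply Cmod_triangle|]. rewrite Cmod_mult, Cmod_Ci, !Cmod_R. lra.
Qed.

Lemma Ccont_cis t : Ccont cis t.
Proof.
split; simpl; apply continuity_pt_filterlim; [apply continuity_cos|apply continuity_sin].
Qed.

Definition circ (r t : R) : C := (RtoC r * cis t)%C.

Lemma Cmod_circ r t : 0 <= r -> Cmod (circ r t) = r.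
Proof. intros H. unfold circ. rewrite Cmod_mult, Cmod_cis, Cmod_R, Rabs_pos_eq; lra. Qed.

Lemma Ccont_circ r t : Ccont (circ r) t.
Proof. apply Ccont_mult; [apply Ccont_const|apply Ccont_cis]. Qed.

Lemma circ_FTC r a b : is_CInt (fun t => Ci * circ r t)%C a b (circ r b - circ r a)%C.
Proof.
split.
- apply is_RInt_ext with (fun t => - (r * sin t)).
  { intros t _. simpl. ring. }
  replace (fst (circ r b - circ r a)%C) with (minus (r * cos b) (r * cos a))
    by (unfold minus, plus, opp; simpl; ring).
  apply (is_RInt_derive (V := R_CompleteNormedModule) (fun t => r * cos t)).
  + intros t _. auto_derive; auto; ring.
  + intros t _. apply continuity_pt_filterlim. apply continuity_pt_opp, continuity_pt_scal, continuity_sin.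
- apply is_RInt_ext with (fun t => r * cos t).
  { intros t _. simpl. ring. }
  replace (snd (circ r b - circ r a)%C) with (minus (r * sin b) (r * sin a))
    by (unfold minus, plus, opp; simpl; ring).
  apply (is_RInt_derive (V := R_CompleteNormedModule) (fun t => r * sin t)).
  + intros t _. auto_derive; auto; ring.
  + intros t _. apply continuity_pt_filterlim. apply continuity_pt_scal, continuity_cos.
Qed.

(** As l decreases from 1 to 0, this contracts the circle to z along the segments ending at z. *)
Definition ray (z : C) (r l t : R) : C := (z + RtoC l * (circ r t - z))%C.

(** Angular part of dw / (w - z) along w = ray z r l t; it is the same for every l. *)
Definition cauchy_ker (z : C) (r t : R) : C := (Ci * circ r t / (circ r t - z))%C.

Lemma circ_minus_neq_0 z r t : Cmod z < r -> (circ r t - z)%C <> RtoC 0.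
Proof.
intros H E. pose proof (Cmod_ge_0 z). assert (circ r t = z) as E'.
{ replace (circ r t) with ((circ r t - z) + z)%C by ring. rewrite E. ring. }
pose proof (Cmod_circ r t ltac:(lra)). rewrite E' in H1. lra.
Qed.

Lemma Ccont_cauchy_ker z r t : Cmod z < r -> Ccont (cauchy_ker z r) t.
Proof.
intros H. apply Ccont_div.
- apply Ccont_mult; [apply Ccont_const|apply Ccont_circ].
- apply (Ccont_plus (circ r) (fun _ => - z)%C); [apply Ccont_circ|apply Ccont_const].
- apply circ_minus_neq_0; auto.
Qed.

Lemma Cmod_cauchy_ker z r t : Cmod z < r -> Cmod (cauchy_ker z r t) <= r / (r - Cmod z).
Proof.
intros H. pose proof (Cmod_ge_0 z). unfold cauchy_ker.
rewrite Cmod_div by (apply circ_minus_neq_0; auto).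
rewrite Cmod_mult, Cmod_Ci, Cmod_circ, Rmult_1_l by lra.
apply Rmult_le_compat_l; [lra|]. apply Rinv_le_contravar; [lra|].
pose proof (Cmod_triangle (circ r t - z) z) as T. replace (circ r t - z + z)%C with (circ r t) in T by ring.
rewrite Cmod_circ in T; lra.
Qed.

Lemma Cmod_ray z r l t : Cmod z < r -> 0 <= l <= 1 -> Cmod (ray z r l t) <= r.
Proof.
intros H Hl. pose proof (Cmod_ge_0 z). unfold ray.
replace (z + RtoC l * (circ r t - z))%C with (RtoC (1 - l) * z + RtoC l * circ r t)%C
  by (rewrite RtoC_minus; ring).
eapply Rle_trans; [apply Cmod_triangle|].
rewrite !Cmod_mult, !Cmod_R, !Rabs_pos_eq, Cmod_circ by lra. nra.
Qed.

(** The contraction is Lipschitz, so that in coordinates (l, t) a remainder that is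
small compared with the distance of points is small compared with the size of a rectangle. *)
Lemma Cmod_ray_diff z r l t l' t' : Cmod z < r -> 0 <= l' <= 1 ->
  Cmod (ray z r l t - ray z r l' t') <= 2 * r * (Rabs (l - l') + Rabs (t - t')).
Proof.
intros H Hl. pose proof (Cmod_ge_0 z). unfold ray.
replace (z + RtoC l * (circ r t - z) - (z + RtoC l' * (circ r t' - z)))%C
  with (RtoC (l - l') * (circ r t - z) + RtoC l' * (RtoC r * (cis t - cis t')))%C
  by (rewrite RtoC_minus; unfold circ; ring).
eapply Rle_trans; [apply Cmod_triangle|].
rewrite !Cmod_mult, !Cmod_R, (Rabs_pos_eq l'), (Rabs_pos_eq r) by lra.
pose proof (cis_lipschitz t t').
assert (Cmod (circ r t - z) <= 2 * r).
{ unfold Cminus. eapply Rle_trans; [apply Cmod_triangle|]. rewrite Cmod_opp, Cmod_circ; lra. }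
pose proof (Rabs_pos (l - l')). pose proof (Cmod_ge_0 (cis t - cis t')).
assert (r * Cmod (cis t - cis t') <= r * (2 * Rabs (t - t'))) by (apply Rmult_le_compat_l; lra).
assert (Rabs (l - l') * Cmod (circ r t - z) <= Rabs (l - l') * (2 * r)) by (apply Rmult_le_compat_l; lra).
assert (0 <= r * Cmod (cis t - cis t')) by (apply Rmult_le_pos; lra).
assert (l' * (r * Cmod (cis t - cis t')) <= 1 * (r * Cmod (cis t - cis t'))) by (apply Rmult_le_compat_r; lra).
lra.
Qed.

(** Radial part of the integral of f(w) dw / (w - z), where P l t stands for
f (ray z r l t): on a ray, dw / (w - z) is dl / l. *)
Definition rad_int (P : R -> R -> C) (t a b : R) : C := CInt (fun l => P l t / RtoC l)%C a b.
Definition ang_int (z : C) (r : R) (P : R -> R -> C) (l a b : R) : C :=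
  CInt (fun t => P l t * cauchy_ker z r t)%C a b.

(** Integral of f(w) dw / (w - z) along the image under ray of the boundary of the rectangle
[l1, l2] x [t1, t2]. *)
Definition loop_int z r (P : R -> R -> C) (l1 l2 t1 t2 : R) : C :=
  (rad_int P t1 l1 l2 - rad_int P t2 l1 l2 + ang_int z r P l2 t1 t2 - ang_int z r P l1 t1 t2)%C.

Definition sep_cont (P : R -> R -> C) : Prop :=
  forall l t, 0 <= l <= 1 -> Ccont (fun s => P s t) l /\ Ccont (fun s => P l s) t.

(** * Goursat's theorem for the contraction *)

Lemma Ccont_id_RtoC t : Ccont RtoC t.
Proof. apply (Ccont_RtoC (fun s => s)), continuous_id. Qed.

Lemma RtoC_neq_0 x : x <> 0 -> RtoC x <> RtoC 0.
Proof. intros H E. apply H, RtoC_inj, E. Qed.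

Lemma rad_int_correct P t a b : sep_cont P -> 0 < a -> a <= b -> b <= 1 ->
  is_CInt (fun l => P l t / RtoC l)%C a b (rad_int P t a b).
Proof.
intros HP Ha Hab Hb. apply is_CInt_cont. intros l Hl.
rewrite Rmin_left, Rmax_right in Hl by lra.
apply Ccont_div; [apply HP; lra|apply Ccont_id_RtoC|apply RtoC_neq_0; lra].
Qed.

Lemma ang_int_correct z r P l a b : sep_cont P -> Cmod z < r -> 0 <= l <= 1 ->
  is_CInt (fun t => P l t * cauchy_ker z r t)%C a b (ang_int z r P l a b).
Proof.
intros HP Hz Hl. apply is_CInt_cont. intros t _.
apply Ccont_mult; [apply HP; auto|apply Ccont_cauchy_ker; auto].
Qed.

Lemma loop_int_quad z r P l1 l2 l3 t1 t2 t3 : sep_cont P -> Cmod z < r ->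
  0 < l1 -> l1 <= l2 -> l2 <= l3 -> l3 <= 1 ->
  loop_int z r P l1 l3 t1 t3 =
  (loop_int z r P l1 l2 t1 t2 + loop_int z r P l2 l3 t1 t2 +
   loop_int z r P l1 l2 t2 t3 + loop_int z r P l2 l3 t2 t3)%C.
Proof.
intros HP Hz H1 H2 H3 H4.
assert (HR : forall t, rad_int P t l1 l3 = (rad_int P t l1 l2 + rad_int P t l2 l3)%C).
{ intros t. apply is_CInt_unique. eapply is_CInt_Chasles; apply rad_int_correct; auto; lra. }
assert (HA : forall l, 0 <= l <= 1 -> ang_int z r P l t1 t3 = (ang_int z r P l t1 t2 + ang_int z r P l t2 t3)%C).
{ intros l Hl. apply is_CInt_unique. eapply is_CInt_Chasles; apply ang_int_correct; auto. }
unfold loop_int. rewrite !HR, !HA by lra. ring.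
Qed.

Lemma sep_cont_affine z r (al c : C) :
  sep_cont (fun l t => al + c * (RtoC l * (circ r t - z)))%C.
Proof.
intros l t _; split.
- apply Ccont_plus; [apply Ccont_const|]. apply Ccont_mult; [apply Ccont_const|].
  apply Ccont_mult; [apply Ccont_id_RtoC|apply Ccont_const].
- apply Ccont_plus; [apply Ccont_const|]. apply Ccont_mult; [apply Ccont_const|].
  apply Ccont_mult; [apply Ccont_const|].
  apply (Ccont_plus (circ r) (fun _ => - z)%C); [apply Ccont_circ|apply Ccont_const].
Qed.

Lemma sep_cont_minus P Q : sep_cont P -> sep_cont Q -> sep_cont (fun l t => P l t - Q l t)%C.
Proof.
intros HP HQ l t Hl; destruct (HP l t Hl), (HQ l t Hl); split.
- apply (Ccont_plus (fun s => P s t) (fun s => - Q s t)%C); auto. apply Ccont_opp; auto.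
- apply (Ccont_plus (fun s => P l s) (fun s => - Q l s)%C); auto. apply Ccont_opp; auto.
Qed.

(** Primitives are explicit here: the constant contributes equal integrals on opposite
sides, and the linear part l (circ r t - z), which is w - z, contributes the integral of dw. *)
Lemma loop_int_affine z r al c l1 l2 t1 t2 : Cmod z < r -> 0 < l1 -> l1 <= l2 -> l2 <= 1 ->
  loop_int z r (fun l t => al + c * (RtoC l * (circ r t - z)))%C l1 l2 t1 t2 = RtoC 0.
Proof.
intros Hz H1 H2 H3.
set (L := CInt (fun l => / RtoC l)%C l1 l2).
set (K := CInt (cauchy_ker z r) t1 t2).
assert (HL : is_CInt (fun l => / RtoC l)%C l1 l2 L).
{ apply is_CInt_cont. intros l Hl. rewrite Rmin_left, Rmax_right in Hl by lra.
  destruct (Cinv_Cdiff (RtoC l)) as [d Hd]; [apply RtoC_neq_0; lra|].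
  apply (Ccont_comp Cinv d); auto. apply Ccont_id_RtoC. }
assert (HK : is_CInt (cauchy_ker z r) t1 t2 K).
{ apply is_CInt_cont. intros t _. apply Ccont_cauchy_ker; auto. }
assert (HR : forall t, rad_int (fun l t => al + c * (RtoC l * (circ r t - z)))%C t l1 l2
   = (al * L + c * (circ r t - z) * (RtoC (l2 - l1) * 1))%C).
{ intros t. apply is_CInt_unique.
  apply is_CInt_ext with (fun l => al * / RtoC l + c * (circ r t - z) * 1)%C.
  - intros l Hl. rewrite Rmin_left, Rmax_right in Hl by lra. field. apply RtoC_neq_0; lra.
  - apply is_CInt_plus; apply is_CInt_mult; auto. apply is_CInt_const. }
assert (HA : forall l, ang_int z r (fun l t => al + c * (RtoC l * (circ r t - z)))%C l t1 t2
   = (al * K + c * RtoC l * (circ r t2 - circ r t1))%C).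
{ intros l. apply is_CInt_unique.
  apply is_CInt_ext with (fun t => al * cauchy_ker z r t + c * RtoC l * (Ci * circ r t))%C.
  - intros t _. unfold cauchy_ker. field. apply circ_minus_neq_0; auto.
  - apply is_CInt_plus; apply is_CInt_mult; auto. apply circ_FTC. }
unfold loop_int. rewrite !HR, !HA, RtoC_minus. ring.
Qed.

Lemma loop_int_plus z r P Q l1 l2 t1 t2 : sep_cont P -> sep_cont Q -> Cmod z < r ->
  0 < l1 -> l1 <= l2 -> l2 <= 1 ->
  loop_int z r (fun l t => P l t + Q l t)%C l1 l2 t1 t2 =
  (loop_int z r P l1 l2 t1 t2 + loop_int z r Q l1 l2 t1 t2)%C.
Proof.
intros HP HQ Hz H1 H2 H3.
assert (HR : forall t, rad_int (fun l t => P l t + Q l t)%C t l1 l2 = (rad_int P t l1 l2 + rad_int Q t l1 l2)%C).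
{ intros t. apply is_CInt_unique.
  apply is_CInt_ext with (fun l => P l t / RtoC l + Q l t / RtoC l)%C.
  - intros l Hl. rewrite Rmin_left, Rmax_right in Hl by lra. field. apply RtoC_neq_0; lra.
  - apply is_CInt_plus; apply rad_int_correct; auto. }
assert (HA : forall l, 0 <= l <= 1 -> ang_int z r (fun l t => P l t + Q l t)%C l t1 t2 = (ang_int z r P l t1 t2 + ang_int z r Q l t1 t2)%C).
{ intros l Hl. apply is_CInt_unique.
  apply is_CInt_ext with (fun t => P l t * cauchy_ker z r t + Q l t * cauchy_ker z r t)%C.
  - intros t _. ring.
  - apply is_CInt_plus; apply ang_int_correct; auto. }
unfold loop_int. rewrite !HR, !HA by lra. ring.
Qed.

Lemma loop_int_bound z r P l1 l2 t1 t2 d M : sep_cont P -> Cmod z < r -> 0 <= M ->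
  0 < d -> d <= l1 -> l1 <= l2 -> l2 <= 1 -> t1 <= t2 ->
  (forall l t, l1 <= l <= l2 -> t1 <= t <= t2 -> Cmod (P l t) <= M) ->
  Cmod (loop_int z r P l1 l2 t1 t2) <=
    2 * M * ((l2 - l1) / d + (t2 - t1) * (r / (r - Cmod z))).
Proof.
intros HP Hz HM Hd H1 H2 H3 H4 Hb. pose proof (Cmod_ge_0 z) as Hz0.
assert (HR : forall t, t1 <= t <= t2 -> Cmod (rad_int P t l1 l2) <= (l2 - l1) * (M / d)).
{ intros t Ht. apply is_CInt_bound with (fun l => P l t / RtoC l)%C; auto.
  2:{ apply rad_int_correct; auto; lra. }
  intros l Hl. rewrite Cmod_div by (apply RtoC_neq_0; lra). rewrite Cmod_R, Rabs_pos_eq by lra.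
  apply Rmult_le_compat; [apply Cmod_ge_0| |apply Hb; auto|apply Rinv_le_contravar; lra].
  left; apply Rinv_0_lt_compat; lra. }
assert (HA : forall l, l1 <= l <= l2 -> Cmod (ang_int z r P l t1 t2) <= (t2 - t1) * (M * (r / (r - Cmod z)))).
{ intros l Hl. apply is_CInt_bound with (fun t => P l t * cauchy_ker z r t)%C; auto.
  2:{ apply ang_int_correct; auto; lra. }
  intros t Ht. rewrite Cmod_mult.
  apply Rmult_le_compat; try apply Cmod_ge_0; [apply Hb; auto|apply Cmod_cauchy_ker; auto]. }
unfold loop_int, Cminus.
eapply Rle_trans; [apply Cmod_triangle|]. rewrite Cmod_opp.
eapply Rle_trans; [apply Rplus_le_compat_r, Cmod_triangle|].
eapply Rle_trans; [apply Rplus_le_compat_r, Rplus_le_compat_r, Cmod_triangle|]. rewrite Cmod_opp.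
pose proof (HR t1 ltac:(lra)). pose proof (HR t2 ltac:(lra)).
pose proof (HA l1 ltac:(lra)). pose proof (HA l2 ltac:(lra)).
replace (2 * M * ((l2 - l1) / d + (t2 - t1) * (r / (r - Cmod z))))
 with (2 * ((l2 - l1) * (M / d)) + 2 * ((t2 - t1) * (M * (r / (r - Cmod z))))) by (field; lra).
lra.
Qed.

Lemma sep_cont_ray z r f : Cmod z < r ->
  (forall w, Cmod w <= r -> exists l, Cdiff f w l) -> sep_cont (fun l t => f (ray z r l t)).
Proof.
intros Hz Hf l t Hl. destruct (Hf (ray z r l t)) as [d Hd]; [apply Cmod_ray; auto|]. split.
- apply (Ccont_comp f d (fun s => ray z r s t)); auto.
  apply Ccont_plus; [apply Ccont_const|]. apply Ccont_mult; [apply Ccont_id_RtoC|apply Ccont_const].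
- apply (Ccont_comp f d (fun s => ray z r l s)); auto.
  apply Ccont_plus; [apply Ccont_const|]. apply Ccont_mult; [apply Ccont_const|].
  apply (Ccont_plus (circ r) (fun _ => - z)%C); [apply Ccont_circ|apply Ccont_const].
Qed.

(** Near (x, y) the function is affine up to a remainder which is small with respect to the
distance, and only the remainder contributes to the integral. The bound d on l from below
controls the factor 1 / l of the radial sides. *)
Lemma goursat_local z r f d x y : Cmod z < r ->
  (forall w, Cmod w <= r -> exists l, Cdiff f w l) -> 0 < d -> d <= x <= 1 ->
  forall eps, 0 < eps -> exists eta, 0 < eta /\ forall l1 l2 t1 t2,
    d <= l1 -> l1 <= x <= l2 -> l2 <= 1 -> t1 <= y <= t2 -> l2 - l1 < eta -> t2 - t1 < eta ->
    Cmod (loop_int z r (fun l t => f (ray z r l t)) l1 l2 t1 t2)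
      <= eps * ((l2 - l1) + (t2 - t1)) ^ 2.
Proof.
intros Hz Hf Hd Hx eps Heps. pose proof (Cmod_ge_0 z) as Hz0.
set (p := ray z r x y).
destruct (Hf p) as [c Hc]; [apply Cmod_ray; auto; lra|].
set (K := / d + r / (r - Cmod z)).
assert (HK1 : 0 < / d) by (apply Rinv_0_lt_compat; lra).
assert (HK2 : 0 < r / (r - Cmod z)) by (apply Rdiv_lt_0_compat; lra).
assert (HK : 0 < K) by (unfold K; lra).
assert (Hr : 0 < r) by lra.
(* This e turns the final bound into eps times the square of the half-perimeter. *)
set (e := eps / (4 * r * K)).
assert (He : 0 < e) by (apply Rdiv_lt_0_compat; auto; repeat apply Rmult_lt_0_compat; lra).
destruct (Hc e He) as (d' & Hd' & H).
exists (d' / (4 * r)). split; [apply Rdiv_lt_0_compat; lra|].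
intros l1 l2 t1 t2 A1 A2 A3 A4 A5 A6.
set (s := (l2 - l1) + (t2 - t1)).
assert (Hs : 2 * r * s < d').
{ replace d' with (2 * r * (d' / (4 * r) + d' / (4 * r))) by (field; lra).
  apply Rmult_lt_compat_l; unfold s; lra. }
(* First-order expansion of f at p, in the coordinates (l, t). *)
set (Aff := fun l t => ((f p + c * (z - p)) + c * (RtoC l * (circ r t - z)))%C).
set (E := fun l t => (f (ray z r l t) - Aff l t)%C).
assert (SA : sep_cont Aff) by apply sep_cont_affine.
assert (SE : sep_cont E) by (apply sep_cont_minus; [apply sep_cont_ray; auto|apply SA]).
assert (HE : forall l t, l1 <= l <= l2 -> t1 <= t <= t2 -> Cmod (E l t) <= e * (2 * r * s)).
{ intros l t Hl Ht.
  assert (Hdist : Cmod (ray z r l t - p) <= 2 * r * s).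
  { eapply Rle_trans; [apply Cmod_ray_diff; auto; lra|].
    apply Rmult_le_compat_l; [lra|]. unfold s. apply Rplus_le_compat; apply Rabs_le; lra. }
  replace (E l t) with (f (ray z r l t) - f p - c * (ray z r l t - p))%C
    by (unfold E, Aff, ray; ring).
  eapply Rle_trans; [apply H; lra|]. apply Rmult_le_compat_l; lra. }
assert (Hloop : loop_int z r (fun l t => f (ray z r l t)) l1 l2 t1 t2 = loop_int z r E l1 l2 t1 t2).
{ transitivity (loop_int z r (fun l t => Aff l t + E l t)%C l1 l2 t1 t2).
  - unfold loop_int, rad_int, ang_int.
    assert (HH : forall l t, (Aff l t + E l t)%C = f (ray z r l t)) by (intros; unfold E; ring).
    assert (HR : forall t, CInt (fun l => f (ray z r l t) / RtoC l)%C l1 l2 = CInt (fun l => (Aff l t + E l t) / RtoC l)%C l1 l2).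
    { intros t. unfold CInt. f_equal; apply RInt_ext; intros l _; rewrite HH; auto. }
    assert (HA : forall l, CInt (fun t => f (ray z r l t) * cauchy_ker z r t)%C t1 t2 = CInt (fun t => (Aff l t + E l t) * cauchy_ker z r t)%C t1 t2).
    { intros l. unfold CInt. f_equal; apply RInt_ext; intros t _; rewrite HH; auto. }
    rewrite !HR, !HA. reflexivity.
  - rewrite loop_int_plus by (auto; lra). unfold Aff. rewrite loop_int_affine by (auto; lra). ring. }
rewrite Hloop.
eapply Rle_trans.
{ apply (loop_int_bound z r E l1 l2 t1 t2 d (e * (2 * r * s))); auto; try lra.
  apply Rmult_le_pos; [lra|]. apply Rmult_le_pos; [lra|]. unfold s; lra. }
assert (Hs0 : 0 <= s) by (unfold s; lra).
assert (Hsum : (l2 - l1) / d + (t2 - t1) * (r / (r - Cmod z)) <= s * K).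
{ unfold s, K, Rdiv at 1.
  assert (0 <= (l2 - l1) * (r / (r - Cmod z))) by (apply Rmult_le_pos; lra).
  assert (0 <= (t2 - t1) * / d) by (apply Rmult_le_pos; lra). lra. }
apply Rle_trans with (2 * (e * (2 * r * s)) * (s * K)).
- apply Rmult_le_compat_l; auto. assert (0 <= r * s) by (apply Rmult_le_pos; lra). assert (0 <= e * (r * s)) by (apply Rmult_le_pos; lra). lra.
- right. unfold e. fold s. field. repeat split; lra.
Qed.

(** The radial sides at angles 0 and 2 PI coincide, so this says that the angular integrals at
l = d and at l = 1 are equal. *)
Theorem goursat_loop z r f d : Cmod z < r ->
  (forall w, Cmod w <= r -> exists l, Cdiff f w l) -> 0 < d < 1 ->
  loop_int z r (fun l t => f (ray z r l t)) d 1 0 (2 * PI) = RtoC 0.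
Proof.
intros Hz Hf Hd. set (P := fun l t => f (ray z r l t)).
assert (SP : sep_cont P) by (apply sep_cont_ray; auto).
pose proof PI_RGT_0 as HPI.
set (h := 1 - d). set (k := 2 * PI).
assert (Hh : 0 < h) by (unfold h; lra). assert (Hk : 0 < k) by (unfold k; lra).
apply Cmod_eq_0, Rle_antisym; [|apply Cmod_ge_0].
pose proof (quadrisection (fun x y n => Cmod (loop_int z r P x (x + h / 2 ^ n) y (y + k / 2 ^ n))) d 0 h k Hh Hk) as Q.
cbn beta in Q. replace (d + h / 2 ^ 0) with 1 in Q by (unfold h; simpl; field).
replace (0 + k / 2 ^ 0) with (2 * PI) in Q by (unfold k; simpl; field).
assert (Hdh : d + h = 1) by (unfold h; ring). assert (Hk2 : 0 + k = 2 * PI) by (unfold k; ring).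
clearbody h k. replace (2 * PI) with k in Q by lra.
apply Q; clear Q.
- intros x y n A1 A2 A3 A4. pose proof (half_pow_pos h (S n) Hh). pose proof (half_pow_pos k (S n) Hk).
  rewrite (half_pow_S h n) in *. rewrite (half_pow_S k n) in *.
  replace (x + h / 2 ^ n / 2 + h / 2 ^ n / 2) with (x + h / 2 ^ n) by lra.
  replace (y + k / 2 ^ n / 2 + k / 2 ^ n / 2) with (y + k / 2 ^ n) by lra.
  rewrite (loop_int_quad z r P x (x + h / 2 ^ n / 2) (x + h / 2 ^ n) y (y + k / 2 ^ n / 2) (y + k / 2 ^ n)); auto; try lra.
  eapply Rle_trans; [apply Cmod_triangle|]. apply Rplus_le_compat_r.
  eapply Rle_trans; [apply Cmod_triangle|]. apply Rplus_le_compat_r.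
  apply Cmod_triangle.
- intros x y Hx Hy eps Heps.
  set (e := eps / (h + k) ^ 2).
  assert (He : 0 < e) by (apply Rdiv_lt_0_compat; auto; apply pow_lt; lra).
  destruct (goursat_local z r f d x y Hz Hf ltac:(lra) ltac:(lra) e He) as (eta & Heta & H).
  assert (Hlim : is_lim_seq (fun n => (h + k) * (/ 2) ^ n) 0).
  { replace (Finite 0) with (Rbar_mult (h + k) 0) by (simpl; f_equal; ring).
    apply is_lim_seq_scal_l. apply is_lim_seq_geom. rewrite Rabs_pos_eq; lra. }
  apply is_lim_seq_spec in Hlim. destruct (Hlim (mkposreal eta Heta)) as [n0 Hn0]. simpl in Hn0.
  exists n0. intros n x' y' Hn A1 A2 A3 A4 A5 A6.
  specialize (Hn0 n Hn). rewrite Rminus_0_r in Hn0.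
  apply Rle_lt_trans with (r1 := (h + k) * (/ 2) ^ n) in Hn0; [|apply Rle_abs].
  rewrite pow_inv in Hn0.
  assert (H2 : 0 < 2 ^ n) by (apply pow_lt; lra).
  pose proof (half_pow_pos h n Hh) as Hhn. pose proof (half_pow_pos k n Hk) as Hkn. unfold Rdiv in Hhn, Hkn.
  eapply Rle_trans.
  { apply H; unfold Rdiv in *; try lra. }
  replace (x' + h / 2 ^ n - x' + (y' + k / 2 ^ n - y')) with ((h + k) / 2 ^ n) by (field; lra).
  right. unfold e. replace 4 with (2 * 2) by ring. rewrite Rpow_mult_distr.
  field. split; lra.
Qed.

(** * Cauchy's formula and Taylor expansion *)

Lemma circ_2PI r : circ r (2 * PI) = circ r 0.
Proof. unfold circ, cis. rewrite cos_2PI, sin_2PI, cos_0, sin_0. reflexivity. Qed.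

Lemma ray_one z r t : ray z r 1 t = circ r t.
Proof. unfold ray. ring. Qed.

(** The angular integral does not depend on l and tends to f(z) times the integral of the
kernel as l tends to 0. The latter integral is evaluated in [cauchy_ker_total], by the power
series expansion of the formula for f = 1. *)
Theorem cauchy_formula z r f : Cmod z < r ->
  (forall w, Cmod w <= r -> exists l, Cdiff f w l) ->
  CInt (fun t => f (circ r t) * cauchy_ker z r t)%C 0 (2 * PI)
  = (f z * CInt (cauchy_ker z r) 0 (2 * PI))%C.
Proof.
intros Hz Hf. pose proof (Cmod_ge_0 z) as Hz0. pose proof PI_RGT_0 as HPI.
set (P := fun l t => f (ray z r l t)).
assert (SP : sep_cont P) by (apply sep_cont_ray; auto).
assert (Hang : forall d, 0 < d < 1 -> ang_int z r P 1 0 (2 * PI) = ang_int z r P d 0 (2 * PI)).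
{ intros d Hd. pose proof (goursat_loop z r f d Hz Hf Hd) as G. fold P in G. unfold loop_int in G.
  assert (E : rad_int P (2 * PI) d 1 = rad_int P 0 d 1).
  { unfold rad_int, P, ray. rewrite circ_2PI. reflexivity. }
  rewrite E in G. apply Ceq_minus. rewrite <- G. ring. }
assert (H1 : ang_int z r P 1 0 (2 * PI) = CInt (fun t => f (circ r t) * cauchy_ker z r t)%C 0 (2 * PI)).
{ unfold ang_int, P. unfold CInt; f_equal; apply RInt_ext; intros t _; rewrite ray_one; reflexivity. }
rewrite <- H1. set (K := CInt (cauchy_ker z r) 0 (2 * PI)).
apply Ceq_minus, Cmod_eq_0, Rle_antisym; [|apply Cmod_ge_0].
apply le_epsilon. intros eps Heps. rewrite Rplus_0_l.
set (k := r / (r - Cmod z)).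
assert (Hk : 0 < k) by (apply Rdiv_lt_0_compat; lra).
set (e := eps / (2 * PI * k)).
assert (He : 0 < e) by (apply Rdiv_lt_0_compat; auto; apply Rmult_lt_0_compat; lra).
destruct (Hf z) as [l Hl]; [lra|].
destruct (Cdiff_cont _ _ _ Hl e He) as (dl & Hdl & H).
(* At fraction d of the rays, f differs from f z by less than e. *)
set (d := Rmin (1 / 2) (dl / (4 * r))).
assert (Hd0 : 0 < d) by (apply Rmin_glb_lt; [lra|apply Rdiv_lt_0_compat; lra]).
assert (Hd1 : d <= 1 / 2) by apply Rmin_l.
assert (Hd2 : d <= dl / (4 * r)) by apply Rmin_r.
rewrite (Hang d) by lra.
assert (HI : is_CInt (fun t => P d t * cauchy_ker z r t + (- f z) * cauchy_ker z r t)%C 0 (2 * PI)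
   (ang_int z r P d 0 (2 * PI) - f z * K)%C).
{ replace (ang_int z r P d 0 (2 * PI) - f z * K)%C with (ang_int z r P d 0 (2 * PI) + (- f z) * K)%C by ring.
  apply is_CInt_plus; [apply ang_int_correct; auto; lra|].
  apply is_CInt_mult. apply is_CInt_cont. intros t _. apply Ccont_cauchy_ker; auto. }
apply (is_CInt_bound _ _ _ _ (e * k)) in HI; [|lra|].
- eapply Rle_trans; [exact HI|]. right. unfold e. field. split; lra.
- intros t _. replace (P d t * cauchy_ker z r t + - f z * cauchy_ker z r t)%C with ((P d t - f z) * cauchy_ker z r t)%C by ring.
  rewrite Cmod_mult. apply Rmult_le_compat; try apply Cmod_ge_0; [|apply Cmod_cauchy_ker; auto].
  left. apply H. unfold ray. replace (z + RtoC d * (circ r t - z) - z)%C with (RtoC d * (circ r t - z))%C by ring.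
  rewrite Cmod_mult, Cmod_R, Rabs_pos_eq by lra.
  assert (Cmod (circ r t - z) <= 2 * r).
  { unfold Cminus. eapply Rle_trans; [apply Cmod_triangle|]. rewrite Cmod_opp, Cmod_circ; lra. }
  apply Rle_lt_trans with (dl / (4 * r) * (2 * r)).
  + apply Rmult_le_compat; try lra. apply Cmod_ge_0.
  + replace (dl / (4 * r) * (2 * r)) with (dl / 2) by (field; lra). lra.
Qed.

(** Componentwise convergence, so that the theory of real series applies. *)
Definition is_Cseries (a : nat -> C) (l : C) : Prop :=
  is_series (fun n => fst (a n)) (fst l) /\ is_series (fun n => snd (a n)) (snd l).

Lemma fst_sum_n (a : nat -> C) N : fst (sum_n a N) = sum_n (fun n => fst (a n)) N.
Proof. induction N as [|N IH]; [rewrite !sum_O; auto|]. rewrite !sum_Sn. rewrite <- IH. reflexivity. Qed.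

Lemma snd_sum_n (a : nat -> C) N : snd (sum_n a N) = sum_n (fun n => snd (a n)) N.
Proof. induction N as [|N IH]; [rewrite !sum_O; auto|]. rewrite !sum_Sn. rewrite <- IH. reflexivity. Qed.

Lemma Rabs_fst_Cmod (z : C) : Rabs (fst z) <= Cmod z.
Proof. eapply Rle_trans; [|apply Rmax_Cmod]. apply Rmax_l. Qed.

Lemma Rabs_snd_Cmod (z : C) : Rabs (snd z) <= Cmod z.
Proof. eapply Rle_trans; [|apply Rmax_Cmod]. apply Rmax_r. Qed.

Lemma is_lim_seq_squeeze (u e : nat -> R) (l : R) :
  (forall n, Rabs (l - u n) <= e n) -> is_lim_seq e 0 -> is_lim_seq u l.
Proof.
intros H He. apply is_lim_seq_le_le with (fun n => l - e n) (fun n => l + e n).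
- intros n. specialize (H n). apply Rabs_le_between in H. lra.
- replace (Finite l) with (Finite (l - 0)) by (f_equal; ring).
  apply is_lim_seq_minus'; auto. apply is_lim_seq_const.
- replace (Finite l) with (Finite (l + 0)) by (f_equal; ring).
  apply is_lim_seq_plus'; auto. apply is_lim_seq_const.
Qed.

Lemma is_Cseries_bound a l e : (forall N, Cmod (l - sum_n a N) <= e N) -> is_lim_seq e 0 -> is_Cseries a l.
Proof.
intros H He; split.
- apply (is_lim_seq_squeeze (sum_n (fun n => fst (a n))) e); auto.
  intros n. rewrite <- fst_sum_n. eapply Rle_trans; [|apply H].
  apply (Rabs_fst_Cmod (l - sum_n a n)%C).
- apply (is_lim_seq_squeeze (sum_n (fun n => snd (a n))) e); auto.
  intros n. rewrite <- snd_sum_n. eapply Rle_trans; [|apply H].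
  apply (Rabs_snd_Cmod (l - sum_n a n)%C).
Qed.

Definition circ_moment (F : R -> C) (r : R) (n : nat) : C :=
  CInt (fun t => F t * (/ circ r t) ^ n)%C 0 (2 * PI).

Lemma circ_neq_0 r t : 0 < r -> circ r t <> RtoC 0.
Proof.
intros Hr E. pose proof (Cmod_circ r t ltac:(lra)). rewrite E, Cmod_0 in H. lra.
Qed.

Lemma Ccont_pow g t n : Ccont g t -> Ccont (fun s => g s ^ n)%C t.
Proof. intros H; induction n; [apply Ccont_const|]. apply (Ccont_mult g (fun s => g s ^ n)%C); auto. Qed.

Lemma Ccont_inv_circ r t : 0 < r -> Ccont (fun s => / circ r s)%C t.
Proof.
intros Hr. destruct (Cinv_Cdiff (circ r t)) as [l Hl]; [apply circ_neq_0; auto|].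
apply (Ccont_comp Cinv l); auto. apply Ccont_circ.
Qed.

Lemma circ_moment_correct F r n : 0 < r -> (forall t, Ccont F t) ->
  is_CInt (fun t => F t * (/ circ r t) ^ n)%C 0 (2 * PI) (circ_moment F r n).
Proof.
intros Hr HF. apply is_CInt_cont. intros t _. apply Ccont_mult; auto.
apply Ccont_pow, Ccont_inv_circ; auto.
Qed.

(** The kernel is Ci times the geometric series of z / circ r t; this is its partial sum with
remainder. *)
Lemma cauchy_ker_geometric z r F N : Cmod z < r -> (forall t, Ccont F t) ->
  CInt (fun t => F t * cauchy_ker z r t)%C 0 (2 * PI) =
  (Ci * sum_n (fun n => circ_moment F r n * z ^ n) N +
   CInt (fun t => F t * cauchy_ker z r t * (z * / circ r t) ^ S N) 0 (2 * PI))%C.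
Proof.
intros Hz HF. pose proof (Cmod_ge_0 z) as Hz0. assert (Hr : 0 < r) by lra.
assert (Hrem : forall N, is_CInt (fun t => F t * cauchy_ker z r t * (z * / circ r t) ^ N)%C 0 (2 * PI)
   (CInt (fun t => F t * cauchy_ker z r t * (z * / circ r t) ^ N)%C 0 (2 * PI))).
{ intros M. apply is_CInt_cont. intros t _. apply Ccont_mult.
  - apply Ccont_mult; auto. apply Ccont_cauchy_ker; auto.
  - apply Ccont_pow. apply Ccont_mult; [apply Ccont_const|apply Ccont_inv_circ; auto]. }
assert (Hstep : forall M, CInt (fun t => F t * cauchy_ker z r t * (z * / circ r t) ^ M)%C 0 (2 * PI) =
  (Ci * (circ_moment F r M * z ^ M) + CInt (fun t => F t * cauchy_ker z r t * (z * / circ r t) ^ S M)%C 0 (2 * PI))%C).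
{ intros M. apply is_CInt_unique.
  apply is_CInt_ext with (fun t => (Ci * z ^ M) * (F t * (/ circ r t) ^ M) + F t * cauchy_ker z r t * (z * / circ r t) ^ S M)%C.
  - intros t _. rewrite Cpow_S, Cpow_mult_l. unfold cauchy_ker.
    field. split; [apply circ_minus_neq_0; auto|apply circ_neq_0; auto].
  - replace (Ci * (circ_moment F r M * z ^ M))%C with (Ci * z ^ M * circ_moment F r M)%C by ring.
    apply is_CInt_plus; auto. apply is_CInt_mult. apply circ_moment_correct; auto. }
induction N as [|N IH].
- rewrite sum_O. rewrite <- Hstep. unfold CInt; f_equal; apply RInt_ext; intros t _;
  replace ((z * / circ r t) ^ 0)%C with (RtoC 1) by reflexivity; rewrite Cmult_1_r; reflexivity.
- rewrite IH, Hstep, sum_Sn. unfold plus; simpl. ring.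
Qed.

Lemma cauchy_ker_series z r F M : Cmod z < r -> (forall t, Ccont F t) ->
  (forall t, 0 <= t <= 2 * PI -> Cmod (F t) <= M) ->
  is_Cseries (fun n => circ_moment F r n * z ^ n)%C
    (CInt (fun t => F t * cauchy_ker z r t)%C 0 (2 * PI) / Ci)%C.
Proof.
intros Hz HF HM. pose proof (Cmod_ge_0 z) as Hz0. assert (Hr : 0 < r) by lra.
pose proof PI_RGT_0 as HPI.
assert (HM0 : 0 <= M) by (eapply Rle_trans; [apply Cmod_ge_0|apply (HM 0); lra]).
apply is_Cseries_bound with (fun N => (2 * PI * (M * (r / (r - Cmod z))) * (Cmod z / r)) * (Cmod z / r) ^ N).
- intros N. rewrite (cauchy_ker_geometric z r F N Hz HF).
  set (S1 := sum_n _ N). set (I := CInt _ _ _).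
  replace ((Ci * S1 + I) / Ci - S1)%C with (I / Ci)%C by (field; apply Ci_nz).
  rewrite Cmod_div, Cmod_Ci, Rdiv_1_r by apply Ci_nz.
  eapply Rle_trans.
  { apply (is_CInt_bound (fun t => F t * cauchy_ker z r t * (z * / circ r t) ^ S N)%C 0 (2 * PI) I
      (M * (r / (r - Cmod z)) * (Cmod z / r) ^ S N)).
    - lra.
    - intros t Ht. rewrite !Cmod_mult, Cmod_pow, Cmod_mult, Cmod_inv, Cmod_circ by (try lra; apply circ_neq_0; auto).
      apply Rmult_le_compat_r; [apply pow_le; apply Rdiv_le_0_compat; lra|].
      apply Rmult_le_compat; try apply Cmod_ge_0; auto. apply Cmod_cauchy_ker; auto.
    - apply is_CInt_cont. intros t _. apply Ccont_mult.
      + apply Ccont_mult; auto. apply Ccont_cauchy_ker; auto.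
      + apply Ccont_pow. apply Ccont_mult; [apply Ccont_const|apply Ccont_inv_circ; auto]. }
  right. simpl. ring.
- set (c := 2 * PI * _ * _). replace (Finite 0) with (Rbar_mult c 0) by (simpl; f_equal; ring).
  apply is_lim_seq_scal_l. apply is_lim_seq_geom.
  rewrite Rabs_pos_eq by (apply Rdiv_le_0_compat; lra).
  apply Rmult_lt_reg_r with r; auto. unfold Rdiv. rewrite Rmult_assoc, Rinv_l; lra.
Qed.

Lemma is_Cseries_unique a l m : is_Cseries a l -> is_Cseries a m -> l = m.
Proof.
intros [A B] [A' B']. apply injective_projections.
- rewrite <- (is_series_unique _ _ A). apply is_series_unique; auto.
- rewrite <- (is_series_unique _ _ B). apply is_series_unique; auto.
Qed.

Lemma is_Cseries_ext a b l : (forall n, a n = b n) -> is_Cseries a l -> is_Cseries b l.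
Proof.
intros H [A B]; split.
- apply is_series_ext with (fun n => fst (a n)); auto. intros n; rewrite H; auto.
- apply is_series_ext with (fun n => snd (a n)); auto. intros n; rewrite H; auto.
Qed.

Lemma cis_add s t : cis (s + t) = (cis s * cis t)%C.
Proof. unfold cis. rewrite cos_plus, sin_plus. apply injective_projections; simpl; ring. Qed.

Lemma cis_opp t : cis (- t) = (/ cis t)%C.
Proof.
assert (H : (cis (- t) * cis t)%C = 1).
{ rewrite <- cis_add. replace (- t + t) with 0 by ring. unfold cis. rewrite cos_0, sin_0. reflexivity. }
replace (cis (- t)) with (cis (- t) * cis t * / cis t)%C by (field; apply cis_neq_0).
rewrite H. ring.
Qed.

Lemma cis_pow t n : (cis t ^ n)%C = cis (INR n * t).
Proof.
induction n as [|n IH].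
- simpl. rewrite Rmult_0_l. unfold cis. rewrite cos_0, sin_0. reflexivity.
- rewrite Cpow_S, IH, <- cis_add. f_equal. rewrite S_INR. ring.
Qed.

Lemma circ_one_orthogonal k : k <> 0%nat -> CInt (fun t => (/ circ 1 t) ^ k)%C 0 (2 * PI) = RtoC 0.
Proof.
intros Hk. assert (HkR : INR k <> 0) by (apply not_0_INR; auto).
assert (E : forall t, ((/ circ 1 t) ^ k)%C = (cos (INR k * t), - sin (INR k * t))).
{ intros t. unfold circ. rewrite Cmult_1_l, <- cis_opp, cis_pow.
  unfold cis. replace (INR k * - t) with (- (INR k * t)) by ring. rewrite cos_neg, sin_neg. reflexivity. }
assert (HP : INR k * (2 * PI) = 0 + 2 * INR k * PI) by ring.
apply is_CInt_unique; split.
- apply is_RInt_ext with (fun t => cos (INR k * t)); [intros t _; simpl; rewrite E; auto|].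
  replace (fst (RtoC 0)) with (minus (sin (INR k * (2 * PI)) / INR k) (sin (INR k * 0) / INR k)).
  2:{ rewrite HP, sin_period, Rmult_0_r, sin_0. unfold minus, plus, opp; simpl; field; auto. }
  apply (is_RInt_derive (V := R_CompleteNormedModule) (fun t => sin (INR k * t) / INR k)).
  + intros t _. auto_derive; auto; field; auto.
  + intros t _. apply (ex_derive_continuous (fun t => cos (INR k * t))). auto_derive; auto.
- apply is_RInt_ext with (fun t => - sin (INR k * t)); [intros t _; simpl; rewrite E; auto|].
  replace (snd (RtoC 0)) with (minus (cos (INR k * (2 * PI)) / INR k) (cos (INR k * 0) / INR k)).
  2:{ rewrite HP, cos_period, Rmult_0_r, cos_0. unfold minus, plus, opp; simpl; field; auto. }
  apply (is_RInt_derive (V := R_CompleteNormedModule) (fun t => cos (INR k * t) / INR k)).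
  + intros t _. auto_derive; auto; field; auto.
  + intros t _. apply (ex_derive_continuous (fun t => - sin (INR k * t))). auto_derive; auto.
Qed.

Lemma cauchy_ker_total z r : Cmod z < r -> CInt (cauchy_ker z r) 0 (2 * PI) = (Ci * RtoC (2 * PI))%C.
Proof.
intros Hz. pose proof (Cmod_ge_0 z) as Hz0. assert (Hr : 0 < r) by lra.
assert (E : CInt (cauchy_ker z r) 0 (2 * PI) = CInt (fun t => 1 * cauchy_ker z r t)%C 0 (2 * PI)).
{ unfold CInt; f_equal; apply RInt_ext; intros t _; rewrite Cmult_1_l; reflexivity. }
pose proof (cauchy_ker_series z r (fun _ => RtoC 1) 1 Hz (Ccont_const 1)
  ltac:(intros; cbv beta; rewrite Cmod_1; lra)) as H.
cbv beta in H. rewrite <- E in H.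
assert (H' : is_Cseries (fun n => circ_moment (fun _ => RtoC 1) r n * z ^ n)%C (RtoC (2 * PI))).
{ assert (H0 : circ_moment (fun _ => RtoC 1) r 0 = RtoC (2 * PI)).
  { unfold circ_moment. replace (RtoC (2 * PI)) with (RtoC (2 * PI - 0) * 1)%C by (rewrite Rminus_0_r; ring).
    apply is_CInt_unique. apply is_CInt_ext with (fun _ => RtoC 1); [|apply is_CInt_const].
    intros t _. simpl. ring. }
  assert (HS : forall n, circ_moment (fun _ => RtoC 1) r (S n) = RtoC 0).
  { intros n. unfold circ_moment. apply is_CInt_unique.
    apply is_CInt_ext with (fun t => (/ RtoC r) ^ S n * (/ circ 1 t) ^ S n)%C.
    - intros t _. rewrite <- Cpow_mult_l, Cmult_1_l. f_equal. unfold circ. field.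
      split; [apply cis_neq_0|apply RtoC_neq_0; lra].
    - replace (RtoC 0) with ((/ RtoC r) ^ S n * RtoC 0)%C by ring.
      apply is_CInt_mult. rewrite <- (circ_one_orthogonal (S n)) by auto.
      apply is_CInt_cont. intros t _. apply Ccont_pow, Ccont_inv_circ; lra. }
  apply is_Cseries_bound with (fun _ => 0); [|apply is_lim_seq_const].
  intros N. right. replace (sum_n _ N) with (RtoC (2 * PI)).
  - replace (RtoC (2 * PI) - RtoC (2 * PI))%C with (RtoC 0) by ring. apply Cmod_0.
  - induction N as [|N IH].
    + rewrite sum_O, H0. simpl. ring.
    + rewrite sum_Sn, <- IH, HS. unfold plus; simpl. ring. }
pose proof (is_Cseries_unique _ _ _ H H') as U.
rewrite <- U. field. apply Ci_nz.
Qed.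

Lemma is_Cseries_scal c a l : is_Cseries a l -> is_Cseries (fun n => c * a n)%C (c * l)%C.
Proof.
intros [A B]; split; simpl.
- apply (is_series_minus (fun n => fst c * fst (a n)) (fun n => snd c * snd (a n)));
  apply @is_series_scal_l; auto.
- apply (is_series_plus (fun n => fst c * snd (a n)) (fun n => snd c * fst (a n)));
  apply @is_series_scal_l; auto.
Qed.

Lemma circle_bounded f r : 0 <= r -> (forall w, Cmod w <= r -> exists l, Cdiff f w l) ->
  exists M, forall t, 0 <= t <= 2 * PI -> Cmod (f (circ r t)) <= M.
Proof.
intros Hr Hf.
assert (Hc : forall t, 0 <= t <= 2 * PI -> continuity_pt (fun t => Cmod (f (circ r t))) t).
{ intros t _. destruct (Hf (circ r t)) as [l Hl]; [rewrite Cmod_circ; lra|].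
  pose proof (Ccont_comp f l _ _ (Ccont_circ r t) Hl) as H.
  intros eps Heps. destruct (proj1 (Ccont_eps _ _) H eps Heps) as (d & Hd & H').
  exists d; split; auto. intros s [_ Hs]. simpl in *. unfold R_dist in *. specialize (H' s Hs).
  set (u := f (circ r s)) in *. set (v := f (circ r t)) in *.
  pose proof (Cmod_triangle (u - v) v). replace (u - v + v)%C with u in H0 by ring.
  pose proof (Cmod_triangle (v - u) u). replace (v - u + u)%C with v in H1 by ring.
  replace (v - u)%C with (- (u - v))%C in H1 by ring. rewrite Cmod_opp in H1.
  apply Rabs_def1; lra. }
destruct (continuity_ab_maj _ 0 (2 * PI) ltac:(pose proof PI_RGT_0; lra) Hc) as (m & Hm & _).
exists (Cmod (f (circ r m))). exact Hm.
Qed.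

Theorem taylor_expansion f r : 0 < r -> (forall w, Cmod w <= r -> exists l, Cdiff f w l) ->
  exists (a : nat -> C) (M : R), (forall n, Cmod (a n) * r ^ n <= M) /\
    forall z, Cmod z < r -> is_Cseries (fun n => a n * z ^ n)%C (f z).
Proof.
intros Hr Hf. pose proof PI_RGT_0 as HPI.
destruct (circle_bounded f r ltac:(lra) Hf) as [M HM].
assert (HF : forall t, Ccont (fun t => f (circ r t)) t).
{ intros t. destruct (Hf (circ r t)) as [l Hl]; [rewrite Cmod_circ; lra|].
  apply (Ccont_comp f l); auto. apply Ccont_circ. }
exists (fun n => / RtoC (2 * PI) * circ_moment (fun t => f (circ r t)) r n)%C, M. split.
- intros n. rewrite Cmod_mult, Cmod_inv, Cmod_R, Rabs_pos_eq by (try lra; apply RtoC_neq_0; lra).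
  assert (Hrn : 0 < r ^ n) by (apply pow_lt; auto).
  assert (HB : Cmod (circ_moment (fun t => f (circ r t)) r n) <= (2 * PI - 0) * (M * / r ^ n)).
  { apply (is_CInt_bound (fun t => f (circ r t) * (/ circ r t) ^ n)%C); [lra| |apply circ_moment_correct; auto].
    intros t Ht. rewrite Cmod_mult, Cmod_pow, Cmod_inv, Cmod_circ, pow_inv by (try lra; apply circ_neq_0; auto).
    apply Rmult_le_compat_r; auto. left; apply Rinv_0_lt_compat; auto. }
  apply Rle_trans with (/ (2 * PI) * ((2 * PI - 0) * (M * / r ^ n)) * r ^ n).
  + apply Rmult_le_compat_r; [lra|]. apply Rmult_le_compat_l; auto. left; apply Rinv_0_lt_compat; lra.
  + right. field. lra.
- intros z Hz.
  pose proof (cauchy_ker_series z r _ M Hz HF HM) as H.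
  cbv beta in H. rewrite (cauchy_formula z r f Hz Hf), (cauchy_ker_total z r Hz) in H.
  apply (is_Cseries_scal (/ RtoC (2 * PI))) in H.
  replace (/ RtoC (2 * PI) * (f z * (Ci * RtoC (2 * PI)) / Ci))%C with (f z) in H
    by (field; split; [apply Ci_nz|apply RtoC_neq_0; lra]).
  eapply is_Cseries_ext; [|exact H]. intros n; cbv beta. ring.
Qed.

(** * Complex power series *)

Ltac real_goal := match goal with |- ?A = ?B => change (@eq R A B) end.

Lemma ex_series_mult_l (c : R) (a : nat -> R) : ex_series a -> ex_series (fun n => c * a n).
Proof. intros [l Hl]. exists (c * l). apply @is_series_scal_l, Hl. Qed.

Lemma pow_unit y n : 0 <= y <= 1 -> 0 <= y ^ n <= 1.
Proof. intros Hy. split; [apply pow_le; lra|rewrite <- (pow1 n); apply pow_incr; lra]. Qed.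

Lemma is_Cseries_plus a b l m : is_Cseries a l -> is_Cseries b m -> is_Cseries (fun n => a n + b n)%C (l + m)%C.
Proof.
intros [A B] [A' B']; split; simpl.
- apply (is_series_plus (fun n => fst (a n)) (fun n => fst (b n))); auto.
- apply (is_series_plus (fun n => snd (a n)) (fun n => snd (b n))); auto.
Qed.

Lemma is_Cseries_minus a b l m : is_Cseries a l -> is_Cseries b m -> is_Cseries (fun n => a n - b n)%C (l - m)%C.
Proof.
intros H H'. replace (l - m)%C with (l + (- (1)) * m)%C by ring.
apply is_Cseries_ext with (fun n => a n + (- (1)) * b n)%C; [intros n; ring|].
apply is_Cseries_plus; auto. apply is_Cseries_scal; auto.
Qed.

Definition CSeries (u : nat -> C) : C := (Series (fun n => fst (u n)), Series (fun n => snd (u n))).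

Lemma is_Cseries_abs u v : (forall n, Cmod (u n) <= v n) -> ex_series v -> is_Cseries u (CSeries u).
Proof.
intros H Hv; split; apply Series_correct.
- apply (@ex_series_le R_AbsRing R_CompleteNormedModule _ v); auto.
  intros n. eapply Rle_trans; [apply Rabs_fst_Cmod|apply H].
- apply (@ex_series_le R_AbsRing R_CompleteNormedModule _ v); auto.
  intros n. eapply Rle_trans; [apply Rabs_snd_Cmod|apply H].
Qed.

Lemma is_Cseries_CSeries u l : is_Cseries u l -> CSeries u = l.
Proof.
intros [A B]. unfold CSeries. rewrite (is_series_unique _ _ A), (is_series_unique _ _ B).
destruct l; reflexivity.
Qed.

Lemma is_Cseries_norm u l v S : is_Cseries u l -> (forall n, Cmod (u n) <= v n) -> is_series v S -> Cmod l <= S.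
Proof.
intros H Hv HS.
assert (HS0 : 0 <= S).
{ replace 0 with (Series (fun _ : nat => 0)).
  - rewrite <- (is_series_unique _ _ HS). apply Series_le; [|exists S; auto].
    intros n; split; [lra|]. eapply Rle_trans; [apply Cmod_ge_0|apply Hv].
  - rewrite (Series_ext _ (fun n => 0 * 0)) by (intros; ring). rewrite Series_scal_l. ring. }
destruct (Req_dec (Cmod l) 0) as [E|E]; [lra|].
pose proof (Cmod_ge_0 l).
(* Multiplication by the conjugate of l makes the sum real and reduces the claim to real series. *)
apply (is_Cseries_scal (Cconj l)) in H. destruct H as [A _].
assert (E2 : fst (Cconj l * l)%C = Cmod l * Cmod l).
{ rewrite <- (Cmod_conj l) at 1. pose proof (Cmod2_conj l) as E2. apply (f_equal fst) in E2.
  simpl in E2. simpl. rewrite Cmod_conj. lra. }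
rewrite E2 in A.
apply Rmult_le_reg_l with (Cmod l); [lra|].
rewrite <- (is_series_unique _ _ A), <- (is_series_unique _ _ HS), <- Series_scal_l.
assert (HSl : ex_series (fun n => Cmod l * v n)) by (exists (Cmod l * S); apply @is_series_scal_l; auto).
eapply Rle_trans; [apply Rle_abs|].
assert (Hb : forall n, Rabs (fst (Cconj l * u n)%C) <= Cmod l * v n).
{ intros n. eapply Rle_trans; [apply Rabs_fst_Cmod|]. rewrite Cmod_mult, Cmod_conj.
  apply Rmult_le_compat_l; auto. }
eapply Rle_trans; [apply Series_Rabs|].
- apply (@ex_series_le R_AbsRing R_CompleteNormedModule _ (fun n => Cmod l * v n)); auto.
  intros n. unfold norm; simpl. unfold abs; simpl. rewrite Rabs_Rabsolu. apply Hb.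
- apply Series_le; auto. intros n; split; [apply Rabs_pos|apply Hb].
Qed.

(** The radius of convergence is at least r: the terms are bounded on every smaller circle.
Stated with bounds and not with convergence, this is stable under shifts and polynomial
factors. *)
Definition radius_ge (a : nat -> C) (r : R) : Prop :=
  forall s, 0 < s < r -> exists M, forall n, Cmod (a n) * s ^ n <= M.

Lemma quadratic_lt_geometric s s' : 0 < s < s' -> exists K, 0 < K /\ forall n, (INR n + 1) ^ 2 * s ^ n <= K * s' ^ n.
Proof.
intros [Hs Hss].
set (q := s' / s). assert (Hq : 1 < q).
{ apply Rmult_lt_reg_r with s; auto. unfold q, Rdiv. rewrite Rmult_assoc, Rinv_l; lra. }
(* Then (1 + h)^2 <= q, and h (n + 1) <= (1 + h)^n by Bernoulli. *)
set (h := Rmin 1 ((q - 1) / 3)).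
assert (Hh0 : 0 < h) by (apply Rmin_glb_lt; lra).
assert (Hh1 : h <= 1) by apply Rmin_l.
assert (Hh2 : h <= (q - 1) / 3) by apply Rmin_r.
assert (Hhq : (1 + h) ^ 2 <= q) by nra.
exists (/ h ^ 2). split; [apply Rinv_0_lt_compat, pow_lt; auto|].
intros n.
assert (HB : h * (INR n + 1) <= (1 + h) ^ n).
{ induction n as [|n IH]; [simpl; lra|]. rewrite S_INR. simpl pow. pose proof (pos_INR n).
  pose proof (pow_R1_Rle (1 + h) n ltac:(lra)). nra. }
assert (Hqn : (1 + h) ^ n * (1 + h) ^ n <= q ^ n).
{ rewrite <- Rpow_mult_distr. apply pow_incr. nra. }
assert (Hs'n : s' ^ n = q ^ n * s ^ n).
{ rewrite <- Rpow_mult_distr. f_equal. unfold q. field. lra. }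
rewrite Hs'n, <- Rmult_assoc. apply Rmult_le_compat_r; [apply pow_le; lra|].
apply Rmult_le_reg_l with (h ^ 2); [apply pow_lt; auto|].
rewrite <- Rmult_assoc, Rinv_r, Rmult_1_l by (apply pow_nonzero; lra).
pose proof (pos_INR n).
assert (0 <= h * (INR n + 1)) by (apply Rmult_le_pos; lra).
apply Rle_trans with ((h * (INR n + 1)) * (h * (INR n + 1))); [right; ring|].
eapply Rle_trans; [|exact Hqn]. apply Rmult_le_compat; auto.
Qed.

Lemma radius_ge_poly a b r K : radius_ge a r -> (forall n, Cmod (b n) <= K * (INR n + 1) ^ 2 * Cmod (a n)) -> radius_ge b r.
Proof.
intros Ha Hb s Hs. set (s' := (s + r) / 2).
destruct (quadratic_lt_geometric s s') as (L & HL & HLn); [unfold s'; lra|].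
destruct (Ha s') as [M HM]; [unfold s'; lra|].
exists (Rabs K * L * M). intros n.
assert (0 < s ^ n) by (apply pow_lt; lra). pose proof (Cmod_ge_0 (a n)). pose proof (Rabs_pos K).
assert (H2 : 0 <= (INR n + 1) ^ 2) by apply pow2_ge_0.
apply Rle_trans with (Rabs K * ((INR n + 1) ^ 2 * s ^ n) * Cmod (a n)).
- apply Rle_trans with (K * (INR n + 1) ^ 2 * Cmod (a n) * s ^ n); [apply Rmult_le_compat_r; auto; lra|].
  replace (K * (INR n + 1) ^ 2 * Cmod (a n) * s ^ n) with (K * ((INR n + 1) ^ 2 * s ^ n * Cmod (a n))) by ring.
  rewrite (Rmult_assoc (Rabs K)). apply Rmult_le_compat_r; [|apply Rle_abs].
  apply Rmult_le_pos; auto. apply Rmult_le_pos; lra.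
- apply Rle_trans with (Rabs K * (L * s' ^ n) * Cmod (a n)).
  + apply Rmult_le_compat_r; auto. apply Rmult_le_compat_l; auto.
  + replace (Rabs K * (L * s' ^ n) * Cmod (a n)) with (Rabs K * L * (Cmod (a n) * s' ^ n)) by ring.
    apply Rmult_le_compat_l; auto. apply Rmult_le_pos; lra.
Qed.

Lemma radius_ge_shift a r : radius_ge a r -> radius_ge (fun n => a (S n)) r.
Proof.
intros Ha s Hs. destruct (Ha s Hs) as [M HM]. exists (M / s). intros n.
specialize (HM (S n)). simpl in HM.
apply Rmult_le_reg_r with s; [lra|].
replace (M / s * s) with M by (field; lra). lra.
Qed.

Lemma radius_ge_ex_series a r s : radius_ge a r -> 0 <= s < r -> ex_series (fun n => Cmod (a n) * s ^ n).
Proof.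
intros Ha Hs. set (s' := (s + r) / 2).
destruct (Ha s') as [M HM]; [unfold s'; lra|].
apply (@ex_series_le R_AbsRing R_CompleteNormedModule _ (fun n => M * (s / s') ^ n)).
- intros n. unfold norm; simpl; unfold abs; simpl.
  rewrite Rabs_pos_eq by (apply Rmult_le_pos; [apply Cmod_ge_0|apply pow_le; lra]).
  assert (0 < s' ^ n) by (apply pow_lt; unfold s'; lra).
  unfold Rdiv. rewrite Rpow_mult_distr, pow_inv.
  apply Rmult_le_reg_r with (s' ^ n); auto.
  replace (M * (s ^ n * / s' ^ n) * s' ^ n) with (M * s ^ n) by (field; lra).
  replace (Cmod (a n) * s ^ n * s' ^ n) with (Cmod (a n) * s' ^ n * s ^ n) by ring.
  apply Rmult_le_compat_r; auto. apply pow_le; lra.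
- exists (M * / (1 - s / s')). apply @is_series_scal_l. apply is_series_geom.
  assert (Hs' : 0 < s') by (unfold s'; lra).
  rewrite Rabs_pos_eq by (apply Rdiv_le_0_compat; lra).
  apply Rmult_lt_reg_r with s'; auto. unfold Rdiv. rewrite Rmult_assoc, Rinv_l, Rmult_1_r by lra. unfold s'; lra.
Qed.

Definition CPSeries (a : nat -> C) (z : C) : C := CSeries (fun n => a n * z ^ n)%C.

Lemma is_Cseries_CPSeries a r z : radius_ge a r -> Cmod z < r -> is_Cseries (fun n => a n * z ^ n)%C (CPSeries a z).
Proof.
intros Ha Hz. apply is_Cseries_abs with (fun n => Cmod (a n) * Cmod z ^ n).
- intros n. rewrite Cmod_mult, Cmod_pow. lra.
- apply radius_ge_ex_series with r; auto. split; auto. apply Cmod_ge_0.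
Qed.

Definition deriv_coef (a : nat -> C) (n : nat) : C := (RtoC (INR n + 1) * a (S n))%C.

Lemma radius_ge_deriv a r : radius_ge a r -> radius_ge (deriv_coef a) r.
Proof.
intros Ha. apply radius_ge_poly with (fun n => a (S n)) 1; [apply radius_ge_shift; auto|].
intros n. unfold deriv_coef. rewrite Cmod_mult, Cmod_R. pose proof (pos_INR n).
rewrite Rabs_pos_eq by lra. apply Rmult_le_compat_r; [apply Cmod_ge_0|]. nra.
Qed.

Definition mono_rem (z w : C) (n : nat) : C :=
  (w ^ n - z ^ n - RtoC (INR n) * z ^ (pred n) * (w - z))%C.

(** Induction on n, from
w^(n+1) - z^(n+1) - (n+1) z^n (w - z) = w (w^n - z^n - n z^(n-1) (w - z)) + n z^(n-1) (w - z)^2.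
The factor s^2 avoids the exponent n - 2. *)
Lemma mono_rem_bound z w s n : 0 < s -> Cmod z <= s -> Cmod w <= s ->
  s ^ 2 * Cmod (mono_rem z w n) <= INR n ^ 2 * s ^ n * Cmod (w - z) ^ 2.
Proof.
intros Hs Hz Hw. induction n as [|n IH].
- unfold mono_rem. simpl. replace (1 - 1 - 0 * 1 * (w - z))%C with (RtoC 0) by ring.
  rewrite Cmod_0. lra.
- assert (E : mono_rem z w (S n) = (w * mono_rem z w n + RtoC (INR n) * z ^ (pred n) * (w - z) * (w - z))%C).
  { unfold mono_rem. rewrite S_INR, RtoC_plus. destruct n as [|n]; simpl; ring. }
  rewrite E. pose proof (pos_INR n) as Hn. pose proof (Cmod_ge_0 (w - z)) as HD.
  assert (Hsn : 0 < s ^ n) by (apply pow_lt; auto).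
  apply Rle_trans with (s ^ 2 * (Cmod w * Cmod (mono_rem z w n) + INR n * Cmod z ^ pred n * Cmod (w - z) * Cmod (w - z))).
  { apply Rmult_le_compat_l; [apply pow_le; lra|]. eapply Rle_trans; [apply Cmod_triangle|].
    rewrite !Cmod_mult, Cmod_pow, Cmod_R, (Rabs_pos_eq (INR n)) by auto. lra. }
  assert (H1 : s ^ 2 * (Cmod w * Cmod (mono_rem z w n)) <= s * (INR n ^ 2 * s ^ n * Cmod (w - z) ^ 2)).
  { replace (s ^ 2 * (Cmod w * Cmod (mono_rem z w n))) with (Cmod w * (s ^ 2 * Cmod (mono_rem z w n))) by ring.
    apply Rmult_le_compat; auto; [apply Cmod_ge_0|]. apply Rmult_le_pos; [apply pow_le; lra|apply Cmod_ge_0]. }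
  assert (H2 : s ^ 2 * (INR n * Cmod z ^ pred n) <= INR n * s ^ S n).
  { destruct n as [|n]; [simpl; lra|]. simpl pred. rewrite <- !tech_pow_Rmult.
    assert (Cmod z ^ n <= s ^ n) by (apply pow_incr; split; [apply Cmod_ge_0|auto]).
    replace (s * (s * s ^ 0) * (INR (S n) * Cmod z ^ n)) with (INR (S n) * (s * s) * Cmod z ^ n) by (simpl pow; ring).
    replace (INR (S n) * (s * (s * s ^ n))) with (INR (S n) * (s * s) * s ^ n) by ring.
    apply Rmult_le_compat_l; auto. apply Rmult_le_pos; nra. }
  apply Rle_trans with (s * (INR n ^ 2 * s ^ n * Cmod (w - z) ^ 2) + INR n * s ^ S n * Cmod (w - z) ^ 2).
  { rewrite Rmult_plus_distr_l. apply Rplus_le_compat; auto.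
    replace (s ^ 2 * (INR n * Cmod z ^ pred n * Cmod (w - z) * Cmod (w - z)))
      with (s ^ 2 * (INR n * Cmod z ^ pred n) * Cmod (w - z) ^ 2) by ring.
    apply Rmult_le_compat_r; auto. apply pow2_ge_0. }
  rewrite S_INR. simpl.
  replace (s * (INR n * (INR n * 1) * s ^ n * (Cmod (w - z) * (Cmod (w - z) * 1))) + INR n * (s * s ^ n) * (Cmod (w - z) * (Cmod (w - z) * 1)))
    with ((INR n * INR n + INR n) * (s * s ^ n * (Cmod (w - z) * Cmod (w - z)))) by ring.
  replace ((INR n + 1) * ((INR n + 1) * 1) * (s * s ^ n) * (Cmod (w - z) * (Cmod (w - z) * 1)))
    with ((INR n + 1) * (INR n + 1) * (s * s ^ n * (Cmod (w - z) * Cmod (w - z)))) by ring.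
  apply Rmult_le_compat_r; [|lra]. apply Rmult_le_pos; nra.
Qed.

Lemma is_Cseries_incr a l : is_Cseries (fun n => a (S n)) l -> is_Cseries a (a O + l)%C.
Proof.
intros [A B]; split; simpl.
- apply (is_series_decr_1 (fun n => fst (a n))).
  match goal with |- is_series _ ?x => replace x with (fst l) end; auto.
  unfold plus, opp; simpl; ring.
- apply (is_series_decr_1 (fun n => snd (a n))).
  match goal with |- is_series _ ?x => replace x with (snd l) end; auto.
  unfold plus, opp; simpl; ring.
Qed.

(** The remainders of the monomials add up to a multiple of |w - z|^2, with a constant given by
the series of n^2 |a_n| s^n. *)
Theorem CPSeries_Cdiff a r z : radius_ge a r -> Cmod z < r -> Cdiff (CPSeries a) z (CPSeries (deriv_coef a) z).
Proof.
intros Ha Hz. pose proof (Cmod_ge_0 z) as Hz0.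
set (s := (Cmod z + r) / 2). assert (Hs : 0 < s) by (unfold s; lra).
assert (Hzs : Cmod z < s) by (unfold s; lra). assert (Hsr : s < r) by (unfold s; lra).
assert (Hn2 : ex_series (fun n => Cmod (RtoC (INR n ^ 2) * a n) * s ^ n)).
{ apply radius_ge_ex_series with r; [|lra]. apply radius_ge_poly with a 1; auto.
  intros n. rewrite Cmod_mult, Cmod_R, Rabs_pos_eq by apply pow2_ge_0.
  apply Rmult_le_compat_r; [apply Cmod_ge_0|]. pose proof (pos_INR n). nra. }
destruct Hn2 as [T HT].
assert (HT0 : 0 <= T).
{ apply Rle_trans with (Cmod (CSeries (fun n => RtoC 0))); [apply Cmod_ge_0|].
  apply (is_Cseries_norm (fun _ => RtoC 0) _ (fun n => Cmod (RtoC (INR n ^ 2) * a n) * s ^ n) T); [|intros n; rewrite Cmod_0|exact HT].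
  - apply is_Cseries_abs with (fun n => Cmod (RtoC (INR n ^ 2) * a n) * s ^ n); [|exists T; exact HT].
    intros n; rewrite Cmod_0. apply Rmult_le_pos; [apply Cmod_ge_0|apply pow_le; lra].
  - apply Rmult_le_pos; [apply Cmod_ge_0|apply pow_le; lra]. }
intros eps Heps.
set (d := Rmin (s - Cmod z) (eps * s ^ 2 / (T + 1))).
assert (Hs2 : 0 < s ^ 2) by (apply pow_lt; auto).
exists d. split.
{ apply Rmin_glb_lt; [lra|]. apply Rdiv_lt_0_compat; [|lra]. apply Rmult_lt_0_compat; lra. }
intros w Hw.
assert (Hw1 : Cmod (w - z) < s - Cmod z) by (eapply Rlt_le_trans; [exact Hw|apply Rmin_l]).
assert (Hw2 : Cmod (w - z) < eps * s ^ 2 / (T + 1)) by (eapply Rlt_le_trans; [exact Hw|apply Rmin_r]).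
assert (Hws : Cmod w <= s).
{ pose proof (Cmod_triangle (w - z) z). replace (w - z + z)%C with w in H by ring. lra. }
assert (HS : is_Cseries (fun n => a n * mono_rem z w n)%C (CPSeries a w - CPSeries a z - CPSeries (deriv_coef a) z * (w - z))%C).
{ assert (HD : is_Cseries (fun n => a n * (RtoC (INR n) * z ^ pred n))%C (CPSeries (deriv_coef a) z)).
  { replace (CPSeries (deriv_coef a) z) with (a O * (RtoC (INR 0) * z ^ pred 0) + CPSeries (deriv_coef a) z)%C by (simpl; ring).
    apply (is_Cseries_incr (fun n => a n * (RtoC (INR n) * z ^ pred n))%C).
    apply is_Cseries_ext with (fun n => deriv_coef a n * z ^ n)%C.
    - intros n. unfold deriv_coef. rewrite S_INR. simpl pred. ring.
    - apply is_Cseries_CPSeries with r; auto. apply radius_ge_deriv; auto. }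
  apply is_Cseries_ext with (fun n => a n * w ^ n - a n * z ^ n - (w - z) * (a n * (RtoC (INR n) * z ^ pred n)))%C.
  - intros n. unfold mono_rem. ring.
  - rewrite (Cmult_comm (CPSeries (deriv_coef a) z)).
    apply is_Cseries_minus; [apply is_Cseries_minus|apply is_Cseries_scal; auto];
    apply is_Cseries_CPSeries with r; auto; lra. }
assert (HB : Cmod (CPSeries a w - CPSeries a z - CPSeries (deriv_coef a) z * (w - z)) <= (Cmod (w - z) ^ 2 / s ^ 2) * T).
{ apply (is_Cseries_norm _ _ (fun n => Cmod (w - z) ^ 2 / s ^ 2 * (Cmod (RtoC (INR n ^ 2) * a n) * s ^ n)) _ HS).
  - intros n. rewrite !Cmod_mult, Cmod_R, Rabs_pos_eq by apply pow2_ge_0.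
    apply Rmult_le_reg_l with (s ^ 2); auto.
    replace (s ^ 2 * (Cmod (w - z) ^ 2 / s ^ 2 * (INR n ^ 2 * Cmod (a n) * s ^ n)))
      with (Cmod (a n) * (INR n ^ 2 * s ^ n * Cmod (w - z) ^ 2)) by (field; lra).
    replace (s ^ 2 * (Cmod (a n) * Cmod (mono_rem z w n))) with (Cmod (a n) * (s ^ 2 * Cmod (mono_rem z w n))) by ring.
    apply Rmult_le_compat_l; [apply Cmod_ge_0|]. apply mono_rem_bound; auto; lra.
  - apply (is_series_scal_l (Cmod (w - z) ^ 2 / s ^ 2) _ _ HT). }
eapply Rle_trans; [exact HB|].
pose proof (Cmod_ge_0 (w - z)) as HD.
replace (Cmod (w - z) ^ 2 / s ^ 2 * T) with (Cmod (w - z) * T / s ^ 2 * Cmod (w - z)) by (field; lra).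
apply Rmult_le_compat_r; auto.
apply Rmult_le_reg_r with (s ^ 2); auto.
replace (Cmod (w - z) * T / s ^ 2 * s ^ 2) with (Cmod (w - z) * T) by (field; lra).
apply Rle_trans with (eps * s ^ 2 / (T + 1) * (T + 1)).
- apply Rmult_le_compat; lra.
- right; field; lra.
Qed.

(** * Termwise integration on (0,1) *)

Lemma is_RInt_cont (f : R -> R) a b : a <= b -> (forall t, a <= t <= b -> continuous f t) -> is_RInt f a b (RInt f a b).
Proof.
intros Hab H. apply (RInt_correct (V := R_CompleteNormedModule)), (ex_RInt_continuous (V := R_CompleteNormedModule)).
intros t Ht. rewrite Rmin_left, Rmax_right in Ht by auto. auto.
Qed.

Lemma series_tail_bound (u M : nat -> R) s S N :
  is_series u s -> (forall n, Rabs (u n) <= M n) -> is_series M S ->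
  Rabs (s - sum_n u N) <= S - sum_n M N.
Proof.
intros Hu Hb HM.
assert (Hd : forall k, Rabs (sum_n u (N + k) - sum_n u N) <= sum_n M (N + k) - sum_n M N).
{ induction k as [|k IH].
  - rewrite Nat.add_0_r, !Rminus_diag, Rabs_R0. lra.
  - rewrite Nat.add_succ_r, !sum_Sn. unfold plus; simpl.
    replace (sum_n u (N + k) + u (Datatypes.S (N + k)) - sum_n u N)
      with ((sum_n u (N + k) - sum_n u N) + u (Datatypes.S (N + k))) by ring.
    eapply Rle_trans; [apply Rabs_triang|]. specialize (Hb (Datatypes.S (N + k))). lra. }
apply (is_lim_seq_le_loc (fun m => Rabs (sum_n u m - sum_n u N)) (fun m => sum_n M m - sum_n M N)
   (Rabs (s - sum_n u N)) (S - sum_n M N)).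
- exists N. intros m Hm. replace m with (N + (m - N))%nat by lia. apply Hd.
- apply (is_lim_seq_abs (fun m => sum_n u m - sum_n u N) (s - sum_n u N)).
  apply is_lim_seq_minus'; [apply Hu|apply is_lim_seq_const].
- apply is_lim_seq_minus'; [apply HM|apply is_lim_seq_const].
Qed.

Lemma ex_series_Rabs_le (u M : nat -> R) : (forall n, Rabs (u n) <= M n) -> ex_series M -> ex_series u.
Proof. intros H HM. apply (@ex_series_le R_AbsRing R_CompleteNormedModule _ M); auto. Qed.

Lemma ex_series_damp (e m : nat -> R) K : (forall n, 0 <= m n <= K) -> ex_series (fun n => Rabs (e n)) ->
  ex_series (fun n => Rabs (e n) * m n).
Proof.
intros Hm He. apply ex_series_Rabs_le with (fun n => K * Rabs (e n)); [|apply ex_series_mult_l; auto].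
intros n. specialize (Hm n). pose proof (Rabs_pos (e n)).
rewrite Rabs_pos_eq, Rmult_comm by (apply Rmult_le_pos; lra). apply Rmult_le_compat_r; lra.
Qed.

Lemma series_uniform_tail (M : nat -> R) S : is_series M S -> forall eps, 0 < eps ->
  exists N, forall n, (N <= n)%nat -> S - sum_n M n < eps.
Proof.
intros H eps Heps.
assert (H' : is_lim_seq (sum_n M) S) by exact H. apply is_lim_seq_spec in H'.
destruct (H' (mkposreal eps Heps)) as [N HN]. exists N. intros n Hn. specialize (HN n Hn). simpl in HN.
apply Rabs_def2 in HN. lra.
Qed.

Lemma is_RInt_series (u : nat -> R -> R) (M : nat -> R) a b : a <= b ->
  (forall n t, a <= t <= b -> continuous (u n) t) ->
  (forall n t, a <= t <= b -> Rabs (u n t) <= M n) -> ex_series M ->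
  is_RInt (fun t => Series (fun n => u n t)) a b (Series (fun n => RInt (u n) a b)) /\
  is_series (fun n => RInt (u n) a b) (Series (fun n => RInt (u n) a b)).
Proof.
intros Hab Hc Hb [S HS].
(* Uniform convergence is required on the whole line: the terms are composed with the projection onto [a, b]. *)
set (cl := fun t => Rmax a (Rmin b t)).
assert (Hcl : forall t, a <= cl t <= b).
{ intros t. unfold cl. split; [apply Rmax_l|]. apply Rmax_lub; auto. apply Rmin_l. }
assert (Hcl' : forall t, a <= t <= b -> cl t = t).
{ intros t Ht. unfold cl. rewrite Rmin_right, Rmax_right; lra. }
assert (Hint : forall n, is_RInt (u n) a b (RInt (u n) a b)).
{ intros n. apply is_RInt_cont; auto. }
assert (HintS : forall N, is_RInt (fun t => sum_n (fun n => u n (cl t)) N) a b (sum_n (fun n => RInt (u n) a b) N)).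
{ intros N. apply is_RInt_ext with (fun t => sum_n (fun n => u n t) N).
  - intros t Ht. rewrite Rmin_left, Rmax_right in Ht by auto. rewrite Hcl' by lra. reflexivity.
  - induction N as [|N IH].
    + rewrite sum_O. apply is_RInt_ext with (u O); auto. intros t _. rewrite sum_O; auto.
    + rewrite sum_Sn. apply is_RInt_ext with (fun t => plus (sum_n (fun n => u n t) N) (u (Datatypes.S N) t)).
      * intros t _. rewrite sum_Sn; auto.
      * apply @is_RInt_plus; auto. }
destruct (filterlim_RInt (U := nat) (V := R_CompleteNormedModule) (fun N t => sum_n (fun n => u n (cl t)) N) a b
   eventually _ (fun t => Series (fun n => u n (cl t))) (sum_n (fun n => RInt (u n) a b)) HintS) as (If & HIf & HR).
- apply filterlim_locally. intros eps.
  destruct (series_uniform_tail M S HS eps (cond_pos eps)) as [N HN].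
  exists N. intros n Hn t. apply Rabs_ball.
  eapply Rle_lt_trans; [|apply (HN n Hn)].
  rewrite Rabs_minus_sym.
  change (Rabs (Series (fun k => u k (cl t)) - sum_n (fun k => u k (cl t)) n) <= S - sum_n M n).
  apply series_tail_bound; auto. apply Series_correct. apply ex_series_Rabs_le with M; auto. exists S; auto.
- assert (E : Series (fun n => RInt (u n) a b) = If) by (apply is_series_unique; exact HIf).
  rewrite E. split; [|exact HIf].
  eapply is_RInt_ext; [|exact HR]. intros t Ht. rewrite Rmin_left, Rmax_right in Ht by auto.
  apply Series_ext. intros n. rewrite Hcl' by lra. auto.
Qed.

(** Improper integral on (0,1), allowing singularities at both ends. *)
Definition int01 (f : R -> R) (l : R) : Prop := is_RInt_gen f (at_right 0) (at_left 1) l.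

Lemma int01_intro f l : (forall x y, 0 < x -> x <= y -> y < 1 -> ex_RInt f x y) ->
  (forall eps, 0 < eps -> exists d, 0 < d /\ forall x y, 0 < x < d -> 1 - d < y < 1 -> x <= y -> Rabs (RInt f x y - l) <= eps) ->
  int01 f l.
Proof.
intros Hex H P [eps HP].
destruct (H (eps / 2)) as (d & Hd & H'); [destruct eps; simpl; lra|].
set (d' := Rmin d (1 / 2)). assert (Hd' : 0 < d') by (apply Rmin_glb_lt; lra).
assert (Hd1 : d' <= d) by apply Rmin_l. assert (Hd2 : d' <= 1 / 2) by apply Rmin_r.
apply Filter_prod with (fun x => 0 < x < d') (fun y => 1 - d' < y < 1).
- exists (mkposreal d' Hd'). intros x Hx Hx0. apply ball_Rabs in Hx; simpl in Hx.
  apply Rabs_def2 in Hx. lra.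
- exists (mkposreal d' Hd'). intros x Hx Hx0. apply ball_Rabs in Hx; simpl in Hx.
  apply Rabs_def2 in Hx. lra.
- intros x y Hx Hy. exists (RInt f x y). split.
  + apply (RInt_correct (V := R_CompleteNormedModule)). apply Hex; simpl; lra.
  + apply HP. specialize (H' x y ltac:(lra) ltac:(lra) ltac:(lra)).
    apply Rabs_ball.
    eapply Rle_lt_trans; [exact H'|]. destruct eps; simpl; lra.
Qed.

Lemma int01_elim f l : int01 f l -> forall eps, 0 < eps ->
  exists d, 0 < d <= 1 / 2 /\ forall x y, 0 < x < d -> 1 - d < y < 1 -> ex_RInt f x y /\ Rabs (RInt f x y - l) <= eps.
Proof.
intros H eps Heps.
destruct (H (ball l (mkposreal eps Heps))) as [Q1 Q2 HQ1 HQ2 HQ]; [exists (mkposreal eps Heps); auto|].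
destruct HQ1 as [d1 HQ1]. destruct HQ2 as [d2 HQ2].
exists (Rmin (Rmin d1 d2) (1 / 2)). split.
{ split; [|apply Rmin_r]. repeat apply Rmin_glb_lt; try apply cond_pos. lra. }
intros x y Hx Hy.
assert (Rmin (Rmin d1 d2) (1 / 2) <= d1) by (eapply Rle_trans; [apply Rmin_l|apply Rmin_l]).
assert (Rmin (Rmin d1 d2) (1 / 2) <= d2) by (eapply Rle_trans; [apply Rmin_l|apply Rmin_r]).
destruct (HQ x y) as (z & Hz & Hb).
- apply HQ1; [|lra]. apply Rabs_ball. apply Rabs_def1; lra.
- apply HQ2; [|lra]. apply Rabs_ball. apply Rabs_def1; lra.
- simpl in Hz. split; [exists z; auto|].
  rewrite (is_RInt_unique _ _ _ _ Hz). left. exact Hb.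
Qed.

Lemma int01_plus f g l m : int01 f l -> int01 g m -> int01 (fun t => f t + g t) (l + m).
Proof. intros H H'. apply (is_RInt_gen_plus (V := R_NormedModule) f g l m); auto. Qed.

Lemma int01_scal f k l : int01 f l -> int01 (fun t => k * f t) (k * l).
Proof. intros H. apply (is_RInt_gen_scal (V := R_NormedModule) f k l); auto. Qed.

Lemma at01_prod (P : R * R -> Prop) : (forall x y, 0 < x < 1 / 2 -> 1 / 2 < y < 1 -> P (x, y)) ->
  filter_prod (at_right 0) (at_left 1) P.
Proof.
intros H. assert (Hh : 0 < 1 / 2) by lra.
apply Filter_prod with (fun x => 0 < x < 1 / 2) (fun y => 1 / 2 < y < 1); auto.
- exists (mkposreal _ Hh). intros x Hx Hx0. apply ball_Rabs in Hx; simpl in Hx.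
  apply Rabs_def2 in Hx. lra.
- exists (mkposreal _ Hh). intros x Hx Hx0. apply ball_Rabs in Hx; simpl in Hx.
  apply Rabs_def2 in Hx. lra.
Qed.

Lemma int01_ext f g l : (forall t, 0 < t < 1 -> f t = g t) -> int01 f l -> int01 g l.
Proof.
intros H Hf. eapply is_RInt_gen_ext; [|exact Hf].
apply at01_prod. intros x y Hx Hy t Ht. cbn [fst snd] in Ht.
rewrite Rmin_left, Rmax_right in Ht by lra. apply H; lra.
Qed.

Lemma int01_le f g l m : (forall t, 0 < t < 1 -> f t <= g t) -> int01 f l -> int01 g m -> l <= m.
Proof.
intros H Hf Hg. apply le_epsilon. intros eps Heps.
destruct (int01_elim f l Hf (eps / 2) ltac:(lra)) as (d1 & Hd1 & A).
destruct (int01_elim g m Hg (eps / 2) ltac:(lra)) as (d2 & Hd2 & B).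
set (d := Rmin d1 d2). assert (0 < d) by (apply Rmin_glb_lt; lra).
assert (d <= d1) by apply Rmin_l. assert (d <= d2) by apply Rmin_r.
destruct (A (d / 2) (1 - d / 2) ltac:(lra) ltac:(lra)) as [A1 A2].
destruct (B (d / 2) (1 - d / 2) ltac:(lra) ltac:(lra)) as [B1 B2].
assert (RInt f (d / 2) (1 - d / 2) <= RInt g (d / 2) (1 - d / 2)).
{ apply RInt_le; auto; [lra|]. intros t Ht. apply H; lra. }
apply Rabs_le_between in A2. apply Rabs_le_between in B2. lra.
Qed.

Lemma int01_unique f l : int01 f l -> RInt_gen f (at_right 0) (at_left 1) = l.
Proof. intros H. apply (is_RInt_gen_unique (V := R_CompleteNormedModule)); auto. Qed.

Lemma int01_FTC f F l0 l1 : (forall t, 0 < t < 1 -> is_derive F t (f t)) ->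
  (forall t, 0 < t < 1 -> continuous f t) ->
  filterlim F (at_right 0) (locally l0) -> filterlim F (at_left 1) (locally l1) -> int01 f (l1 - l0).
Proof.
intros HD Hc H0 H1.
assert (Hint : forall x y, 0 < x -> x <= y -> y < 1 -> is_RInt f x y (F y - F x)).
{ intros x y Hx Hxy Hy. apply (is_RInt_derive (V := R_CompleteNormedModule) F f).
  - intros t Ht. rewrite Rmin_left, Rmax_right in Ht by lra. apply HD; lra.
  - intros t Ht. rewrite Rmin_left, Rmax_right in Ht by lra. apply Hc; lra. }
apply int01_intro.
- intros x y Hx Hxy Hy. eexists. apply Hint; auto.
- intros eps Heps. assert (He : 0 < eps / 2) by lra.
  apply filterlim_locally with (eps := mkposreal _ He) in H0.
  apply filterlim_locally with (eps := mkposreal _ He) in H1.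
  destruct H0 as [d0 H0]. destruct H1 as [d1 H1].
  exists (Rmin d0 d1). split; [apply Rmin_glb_lt; apply cond_pos|].
  assert (Rmin d0 d1 <= d0) by apply Rmin_l. assert (Rmin d0 d1 <= d1) by apply Rmin_r.
  intros x y Hx Hy Hxy. rewrite (is_RInt_unique _ _ _ _ (Hint x y ltac:(lra) Hxy ltac:(lra))).
  assert (A : Rabs (F x - l0) < eps / 2).
  { apply (H0 x); [|lra]. apply Rabs_ball. apply Rabs_def1; lra. }
  assert (B : Rabs (F y - l1) < eps / 2).
  { apply (H1 y); [|lra]. apply Rabs_ball. apply Rabs_def1; lra. }
  apply Rabs_def2 in A. apply Rabs_def2 in B. apply Rabs_le. lra.
Qed.

Lemma int01_partial_le v J x y : (forall t, 0 < t < 1 -> continuous v t) -> (forall t, 0 < t < 1 -> 0 <= v t) ->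
  int01 v J -> 0 < x -> x <= y -> y < 1 -> RInt v x y <= J.
Proof.
intros Hc Hv HJ Hx Hxy Hy. apply le_epsilon. intros eps Heps.
destruct (int01_elim v J HJ eps Heps) as (d & Hd & A).
set (x' := Rmin (x / 2) (d / 2)). set (y' := Rmax ((1 + y) / 2) (1 - d / 2)).
assert (0 < x') by (apply Rmin_glb_lt; lra).
assert (x' <= x / 2) by apply Rmin_l. assert (x' <= d / 2) by apply Rmin_r.
assert (y' < 1) by (apply Rmax_lub_lt; lra).
assert ((1 + y) / 2 <= y') by apply Rmax_l. assert (1 - d / 2 <= y') by apply Rmax_r.
destruct (A x' y' ltac:(lra) ltac:(lra)) as [A1 A2].
assert (Hex : forall p q, 0 < p -> p <= q -> q < 1 -> ex_RInt v p q).
{ intros p q Hp Hpq Hq. eexists. apply is_RInt_cont; auto. intros t Ht; apply Hc; lra. }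
assert (E : RInt v x' y' = RInt v x' x + RInt v x y + RInt v y y').
{ rewrite <- (RInt_Chasles v x' x y') by (apply Hex; lra).
  rewrite <- (RInt_Chasles v x y y') by (apply Hex; lra). unfold plus; simpl. ring. }
assert (0 <= RInt v x' x) by (apply RInt_ge_0; [lra|apply Hex; lra|intros; apply Hv; lra]).
assert (0 <= RInt v y y') by (apply RInt_ge_0; [lra|apply Hex; lra|intros; apply Hv; lra]).
apply Rabs_le_between in A2. lra.
Qed.

(** Dominated convergence: the tail of the sum, integrated over any [x, y], is at most the tail of
the series of J, uniformly in x and y, while each of the remaining finitely many terms
converges. *)
Lemma int01_series (u v : nat -> R -> R) (I J : nat -> R) :
  (forall n t, 0 < t < 1 -> continuous (u n) t) ->
  (forall n t, 0 < t < 1 -> continuous (v n) t) ->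
  (forall n t, 0 < t < 1 -> Rabs (u n t) <= v n t) ->
  (forall x y, 0 < x -> x <= y -> y < 1 -> exists M, ex_series M /\ forall n t, x <= t <= y -> v n t <= M n) ->
  (forall n, int01 (u n) (I n)) -> (forall n, int01 (v n) (J n)) -> ex_series J ->
  int01 (fun t => Series (fun n => u n t)) (Series I) /\ ex_series I.
Proof.
intros Hu Hv Huv HM HI HJ [SJ HSJ].
assert (HIJ : forall n, Rabs (I n) <= J n).
{ intros n. apply Rabs_le. split.
  - replace (- J n) with ((-1) * J n) by ring. apply (int01_le (fun t => (-1) * v n t) (u n)); auto.
    + intros t Ht. specialize (Huv n t Ht). apply Rabs_le_between in Huv. lra.
    + apply int01_scal; auto.
  - apply (int01_le (u n) (v n)); auto. intros t Ht. eapply Rle_trans; [apply Rle_abs|]; auto. }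
assert (HexI : ex_series I) by (apply ex_series_Rabs_le with J; auto; exists SJ; auto).
split; auto.
assert (Hser : forall x y, 0 < x -> x <= y -> y < 1 ->
  is_RInt (fun t => Series (fun n => u n t)) x y (Series (fun n => RInt (u n) x y)) /\
  is_series (fun n => RInt (u n) x y) (Series (fun n => RInt (u n) x y))).
{ intros x y Hx Hxy Hy. destruct (HM x y Hx Hxy Hy) as (M & HexM & HMn).
  apply is_RInt_series with M; auto.
  - intros n t Ht. apply Hu; lra.
  - intros n t Ht. eapply Rle_trans; [apply Huv; lra|]. auto. }
apply int01_intro.
- intros x y Hx Hxy Hy. eexists. apply Hser; auto.
- intros eps Heps.
  destruct (series_uniform_tail J SJ HSJ (eps / 3) ltac:(lra)) as [N HN]. specialize (HN N (Nat.le_refl N)).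
  assert (Hfin : forall K e, 0 < e -> exists d, 0 < d /\ forall x y, 0 < x < d -> 1 - d < y < 1 ->
     Rabs (sum_n (fun n => RInt (u n) x y) K - sum_n I K) <= e).
  { induction K as [|K IH]; intros e He.
    - destruct (int01_elim _ _ (HI O) e He) as (d & Hd & A). exists d; split; [lra|].
      intros x y Hx Hy. rewrite !sum_O. apply (A x y); auto.
    - destruct (IH (e / 2) ltac:(lra)) as (d1 & Hd1 & A1).
      destruct (int01_elim _ _ (HI (S K)) (e / 2) ltac:(lra)) as (d2 & Hd2 & A2).
      exists (Rmin d1 d2). split; [apply Rmin_glb_lt; lra|].
      assert (Rmin d1 d2 <= d1) by apply Rmin_l. assert (Rmin d1 d2 <= d2) by apply Rmin_r.
      intros x y Hx Hy. rewrite !sum_Sn. unfold plus; simpl.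
      specialize (A1 x y ltac:(lra) ltac:(lra)). destruct (A2 x y ltac:(lra) ltac:(lra)) as [_ A3].
      apply Rabs_le_between in A1. apply Rabs_le_between in A3. apply Rabs_le. lra. }
  destruct (Hfin N (eps / 3) ltac:(lra)) as (d & Hd & A).
  exists d; split; auto. intros x y Hx Hy Hxy. specialize (A x y Hx Hy).
  destruct (Hser x y ltac:(lra) Hxy ltac:(lra)) as [S1 S2].
  rewrite (is_RInt_unique _ _ _ _ S1).
  assert (T1 : Rabs (Series (fun n => RInt (u n) x y) - sum_n (fun n => RInt (u n) x y) N) <= SJ - sum_n J N).
  { apply series_tail_bound; auto. intros n.
    eapply Rle_trans; [|apply (int01_partial_le (v n) (J n) x y); auto; try lra].
    - apply (norm_RInt_le (V := R_NormedModule) (u n) (v n) x y); auto.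
      + intros t Ht. apply (Huv n t); lra.
      + apply is_RInt_cont; auto. intros t Ht; apply Hu; lra.
      + apply is_RInt_cont; auto. intros t Ht; apply Hv; lra.
    - intros t Ht. eapply Rle_trans; [apply Rabs_pos|]; apply Huv; auto. }
  assert (T2 : Rabs (Series I - sum_n I N) <= SJ - sum_n J N).
  { apply series_tail_bound; auto. apply Series_correct; auto. }
  apply Rabs_le_between in A. apply Rabs_le_between in T1. apply Rabs_le_between in T2. apply Rabs_le. lra.
Qed.

(** Absolute convergence is required for t < 1 and against the moments only: at t = 1 the power
series may diverge, as that of q does. *)
Lemma int01_weighted_series (lam : R -> R) (mom c : nat -> R) :
  (forall t, 0 < t < 1 -> continuous lam t) -> (forall t, 0 < t < 1 -> 0 <= lam t) ->
  (forall n, int01 (fun t => lam t * t ^ n) (mom n)) ->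
  (forall y, 0 < y < 1 -> ex_series (fun n => Rabs (c n) * y ^ n)) ->
  ex_series (fun n => Rabs (c n) * mom n) ->
  int01 (fun t => lam t * Series (fun n => c n * t ^ n)) (Series (fun n => c n * mom n)).
Proof.
intros Hc Hp Hmom Hy Hs.
assert (Hcn : forall k n t, 0 < t < 1 -> continuous (fun t => k * (lam t * t ^ n)) t).
{ intros k n t Ht. apply (continuous_mult (K := R_AbsRing) (fun _ => k)); [apply continuous_const|].
  apply (continuous_mult (K := R_AbsRing) lam (fun t => t ^ n)); auto.
  apply (ex_derive_continuous (fun t => t ^ n)). auto_derive; auto. }
assert (Hpn : forall n t, 0 < t < 1 -> 0 <= lam t * t ^ n).
{ intros n t Ht. apply Rmult_le_pos; auto. apply pow_le; lra. }
destruct (int01_series (fun n t => c n * (lam t * t ^ n)) (fun n t => Rabs (c n) * (lam t * t ^ n))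
  (fun n => c n * mom n) (fun n => Rabs (c n) * mom n)) as [H _]; auto.
- intros n t Ht. rewrite Rabs_mult, (Rabs_pos_eq (lam t * t ^ n)) by auto. lra.
- intros x y Hx Hxy Hy1.
  destruct (continuity_ab_maj lam x y Hxy) as (m & Hm & Hmx).
  { intros t Ht. apply continuity_pt_filterlim. apply Hc; lra. }
  exists (fun n => lam m * (Rabs (c n) * y ^ n)). split.
  + exact (ex_series_mult_l (lam m) _ (Hy y ltac:(lra))).
  + intros n t Ht. replace (lam m * (Rabs (c n) * y ^ n)) with (Rabs (c n) * (lam m * y ^ n)) by ring.
    apply Rmult_le_compat_l; [apply Rabs_pos|].
    apply Rmult_le_compat; [apply Hp; lra|apply pow_le; lra|auto|apply pow_incr; lra].
- intros n. apply int01_scal; auto.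
- intros n. apply int01_scal; auto.
- eapply int01_ext; [|exact H]. intros t Ht. rewrite <- Series_scal_l. apply Series_ext. intros n. ring.
Qed.

Lemma int01_weighted_series_abs (lam : R -> R) (mom c : nat -> R) K :
  (forall t, 0 < t < 1 -> continuous lam t) -> (forall t, 0 < t < 1 -> 0 <= lam t) ->
  (forall n, int01 (fun t => lam t * t ^ n) (mom n)) -> (forall n, 0 <= mom n <= K) ->
  ex_series (fun n => Rabs (c n)) ->
  int01 (fun t => lam t * Series (fun n => c n * t ^ n)) (Series (fun n => c n * mom n)) /\
  ex_series (fun n => c n * mom n).
Proof.
intros Hc Hp Hmom HK Hs.
pose proof (ex_series_damp c mom K HK Hs) as Hd. split.
- apply int01_weighted_series; auto. intros y Hy. apply ex_series_damp with 1; auto. intros n; apply pow_unit; lra.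
- apply ex_series_Rabs_le with (fun n => Rabs (c n) * mom n); auto.
  intros n. specialize (HK n). rewrite Rabs_mult, (Rabs_pos_eq (mom n)); lra.
Qed.

(** * Moments of lambda *)

Lemma at_right_0_eps (F : R -> R) l : (forall eps, 0 < eps -> exists d, 0 < d /\ forall t, 0 < t < d -> Rabs (F t - l) < eps) ->
  filterlim F (at_right 0) (locally l).
Proof.
intros H. apply filterlim_locally. intros eps. destruct (H eps (cond_pos eps)) as (d & Hd & A).
exists (mkposreal d Hd). intros t Ht Ht0. apply A.
apply ball_Rabs in Ht; simpl in Ht.
apply Rabs_def2 in Ht. lra.
Qed.

Lemma at_left_1_cont (F : R -> R) : continuous F 1 -> filterlim F (at_left 1) (locally (F 1)).
Proof. intros H. eapply filterlim_filter_le_1; [|exact H]. apply filter_le_within. Qed.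

Lemma Rpower_small k eps : 0 < k -> 0 < eps -> exists d, 0 < d < 1 /\ forall t, 0 < t < d -> Rpower t k < eps.
Proof.
intros Hk He. set (d := Rmin (1 / 2) (Rpower eps (/ k))).
assert (0 < Rpower eps (/ k)) by apply exp_pos.
exists d. assert (d <= 1 / 2) by apply Rmin_l. assert (d <= Rpower eps (/ k)) by apply Rmin_r.
assert (0 < d) by (apply Rmin_glb_lt; lra). split; [lra|].
intros t Ht. replace eps with (Rpower (Rpower eps (/ k)) k).
- apply Rlt_Rpower_l; lra.
- rewrite Rpower_mult, Rinv_l by lra. apply Rpower_1; auto.
Qed.

Lemma Rpower_lim_0 k : 0 < k -> filterlim (fun t => Rpower t k) (at_right 0) (locally 0).
Proof.
intros Hk. apply at_right_0_eps. intros eps He.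
destruct (Rpower_small k eps Hk He) as (d & Hd & A). exists d; split; [lra|].
intros t Ht. rewrite Rminus_0_r, Rabs_pos_eq; [apply A; auto|]. left; apply exp_pos.
Qed.

(** The inequality 1 + y <= exp y at y = - (k/2) ln t, multiplied by t^k. *)
Lemma Rpower_ln_bound k t : 0 < k -> 0 < t < 1 -> 0 <= Rpower t k * - ln t <= 2 / k * Rpower t (k / 2).
Proof.
intros Hk Ht. assert (Hln : ln t < 0) by (rewrite <- ln_1; apply ln_increasing; lra).
assert (Hp : 0 < Rpower t k) by apply exp_pos. assert (Hp2 : 0 < Rpower t (k / 2)) by apply exp_pos.
split; [nra|].
assert (Hexp : - ln t <= 2 / k * Rpower t (- (k / 2))).
{ unfold Rpower. pose proof (exp_ineq1_le (- (k / 2) * ln t)).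
  apply Rmult_le_reg_l with (k / 2); [lra|].
  replace (k / 2 * (2 / k * exp (- (k / 2) * ln t))) with (exp (- (k / 2) * ln t)) by (field; lra). lra. }
replace (Rpower t k) with (Rpower t (k / 2) * Rpower t (k / 2)) by (rewrite <- Rpower_plus; f_equal; field).
apply Rle_trans with (Rpower t (k / 2) * Rpower t (k / 2) * (2 / k * Rpower t (- (k / 2)))).
- apply Rmult_le_compat_l; auto. apply Rmult_le_pos; lra.
- replace (Rpower t (k / 2) * Rpower t (k / 2) * (2 / k * Rpower t (- (k / 2))))
   with (2 / k * Rpower t (k / 2) * (Rpower t (k / 2) * Rpower t (- (k / 2)))) by ring.
  rewrite <- Rpower_plus. replace (k / 2 + - (k / 2)) with 0 by ring. rewrite Rpower_O by lra. lra.
Qed.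

Lemma Rpower_ln_lim_0 k : 0 < k -> filterlim (fun t => Rpower t k * ln t) (at_right 0) (locally 0).
Proof.
intros Hk. apply at_right_0_eps. intros eps He.
destruct (Rpower_small (k / 2) (eps * (k / 2)) ltac:(lra)) as (d & Hd & A).
{ apply Rmult_lt_0_compat; lra. }
exists d; split; [lra|]. intros t Ht. rewrite Rminus_0_r.
pose proof (Rpower_ln_bound k t Hk ltac:(lra)) as B. specialize (A t Ht).
rewrite <- Rabs_Ropp, <- Ropp_mult_distr_r_reverse, Rabs_pos_eq by lra.
eapply Rle_lt_trans; [apply B|].
apply Rmult_lt_reg_l with (k / 2); [lra|].
replace (k / 2 * (2 / k * Rpower t (k / 2))) with (Rpower t (k / 2)) by (field; lra). lra.
Qed.

Lemma Rpower_derive k t : 0 < t -> is_derive (fun s => Rpower s k) t (k * Rpower t (k - 1)).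
Proof.
intros Ht. unfold Rpower. auto_derive; auto.
replace ((k - 1) * ln t) with (k * ln t + - ln t) by ring.
rewrite exp_plus, exp_Ropp, exp_ln by auto. field. lra.
Qed.

Lemma Rpower_cont k t : 0 < t -> continuous (fun s => Rpower s k) t.
Proof. intros Ht. apply (ex_derive_continuous (fun s => Rpower s k)). eexists. apply Rpower_derive; auto. Qed.

Lemma Rpower_1_base k : Rpower 1 k = 1.
Proof. unfold Rpower. rewrite ln_1, Rmult_0_r, exp_0. reflexivity. Qed.

Lemma int01_Rpower k : 0 < k -> int01 (fun t => Rpower t (k - 1)) (/ k).
Proof.
intros Hk. replace (/ k) with (/ k * 1 - / k * 0) by ring.
apply (int01_FTC _ (fun t => / k * Rpower t k)).
- intros t Ht. replace (Rpower t (k - 1)) with (/ k * (k * Rpower t (k - 1))) by (field; lra).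
  apply @is_derive_scal. apply Rpower_derive; lra.
- intros t Ht. apply Rpower_cont; lra.
- apply (filterlim_comp _ _ _ (fun t => Rpower t k) (fun y => / k * y) _ (locally 0)); [apply Rpower_lim_0; auto|].
  apply (continuous_mult (K := R_AbsRing) (fun _ => / k) (fun y => y)); [apply continuous_const|apply continuous_id].
- replace (/ k * 1) with ((fun t => / k * Rpower t k) 1) by (cbv beta; rewrite Rpower_1_base; ring).
  apply at_left_1_cont.
  apply (continuous_mult (K := R_AbsRing) (fun _ => / k)); [apply continuous_const|apply Rpower_cont; lra].
Qed.

Lemma int01_Rpower_ln k : 0 < k -> int01 (fun t => Rpower t (k - 1) * ln (1 / t)) (/ k ^ 2).
Proof.
intros Hk.
set (F := fun t => / k ^ 2 * Rpower t k + (- / k) * (Rpower t k * ln t)).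
assert (Hc : forall t, 0 < t -> is_derive F t (Rpower t (k - 1) * ln (1 / t))).
{ intros t Ht. unfold F.
  replace (Rpower t (k - 1) * ln (1 / t)) with
   (/ k ^ 2 * (k * Rpower t (k - 1)) + (- / k) * (k * Rpower t (k - 1) * ln t + Rpower t k * / t)).
  - apply @is_derive_plus; apply @is_derive_scal; [apply Rpower_derive; auto|].
    apply (is_derive_mult (fun s => Rpower s k) ln); [apply Rpower_derive; auto| |intros; apply Rmult_comm].
    auto_derive; auto; field; lra.
  - unfold Rdiv. rewrite Rmult_1_l, ln_Rinv by auto.
    replace (Rpower t k) with (Rpower t (k - 1) * t).
    + field. lra.
    + rewrite <- (Rpower_1 t) at 2 by auto. rewrite <- Rpower_plus. f_equal; ring. }
replace (/ k ^ 2) with (F 1 - (/ k ^ 2 * 0 + (- / k) * 0)) by (unfold F; rewrite Rpower_1_base, ln_1; ring).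
apply (int01_FTC _ F).
- intros t Ht. apply Hc; lra.
- intros t Ht. apply (continuous_mult (K := R_AbsRing) (fun t => Rpower t (k - 1)) (fun t => ln (1 / t))).
  + apply Rpower_cont; lra.
  + apply (ex_derive_continuous (fun t => ln (1 / t))). auto_derive. split; [lra|]. split; auto. apply Rdiv_lt_0_compat; lra.
- unfold F. apply (filterlim_comp_2 (F := at_right 0) (G := locally (/ k ^ 2 * 0)) (H := locally (- / k * 0))
    (fun t => / k ^ 2 * Rpower t k) (fun t => - / k * (Rpower t k * ln t)) Rplus).
  + apply (filterlim_comp _ _ _ (fun t => Rpower t k) (fun y => / k ^ 2 * y) _ (locally 0)); [apply Rpower_lim_0; auto|].
    apply (continuous_mult (K := R_AbsRing) (fun _ => / k ^ 2) (fun y => y)); [apply continuous_const|apply continuous_id].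
  + apply (filterlim_comp _ _ _ (fun t => Rpower t k * ln t) (fun y => - / k * y) _ (locally 0)); [apply Rpower_ln_lim_0; auto|].
    apply (continuous_mult (K := R_AbsRing) (fun _ => - / k) (fun y => y)); [apply continuous_const|apply continuous_id].
  + apply (filterlim_plus (V := R_NormedModule)).
- apply at_left_1_cont. apply (ex_derive_continuous F). eexists. apply Hc. lra.
Qed.

(** Moments of lambda; the confluent case b = a obeys the same formula. *)
Definition tau (a b : R) (n : nat) : R := (a + 1) * (b + 1) / ((INR n + a + 1) * (INR n + b + 1)).

Lemma lambda_moment a b n : -1 < a -> -1 < b -> int01 (fun t => lambda a b t * t ^ n) (tau a b n).
Proof.
intros Ha Hb. pose proof (pos_INR n) as Hn. unfold lambda, tau. destruct (Req_EM_T b a) as [E|E].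
- subst b. replace ((a + 1) * (a + 1) / ((INR n + a + 1) * (INR n + a + 1)))
    with ((a + 1) ^ 2 * / (INR n + a + 1) ^ 2) by (field; lra).
  eapply int01_ext; [|apply int01_scal, (int01_Rpower_ln (INR n + a + 1)); lra].
  intros t Ht. cbv beta. rewrite <- (Rpower_pow n t) by lra.
  replace (INR n + a + 1 - 1) with (a + INR n) by ring. rewrite Rpower_plus. ring.
- replace ((a + 1) * (b + 1) / ((INR n + a + 1) * (INR n + b + 1)))
    with ((a + 1) * (b + 1) / (b - a) * / (INR n + a + 1) + - ((a + 1) * (b + 1) / (b - a)) * / (INR n + b + 1))
    by (field; repeat split; lra).
  eapply int01_ext; [|apply int01_plus; apply int01_scal; apply int01_Rpower; lra].
  intros t Ht. cbv beta. rewrite <- (Rpower_pow n t) by lra.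
  replace (INR n + a + 1 - 1) with (a + INR n) by ring.
  replace (INR n + b + 1 - 1) with (a + (b - a) + INR n) by ring. rewrite !Rpower_plus. field. lra.
Qed.

Lemma lambda_pos a b t : -1 < a -> -1 < b -> 0 < t < 1 -> 0 <= lambda a b t.
Proof.
intros Ha Hb Ht. assert (Hln : ln t < 0) by (rewrite <- ln_1; apply ln_increasing; lra).
unfold lambda. destruct (Req_EM_T b a) as [E|E].
- unfold Rdiv. rewrite Rmult_1_l, ln_Rinv by lra.
  apply Rmult_le_pos; [|lra]. apply Rmult_le_pos; [apply pow2_ge_0|left; apply exp_pos].
- apply Rmult_le_pos; [nra|]. unfold Rdiv. rewrite Rmult_assoc.
  apply Rmult_le_pos; [left; apply exp_pos|].
  destruct (Rlt_or_le a b) as [H|H].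
  + apply Rmult_le_pos; [|left; apply Rinv_0_lt_compat; lra].
    assert (Rpower t (b - a) < 1); [|lra]. unfold Rpower. rewrite <- exp_0. apply exp_increasing. nra.
  + assert (1 < Rpower t (b - a)) by (unfold Rpower; rewrite <- exp_0 at 1; apply exp_increasing; nra).
    assert (/ (b - a) < 0) by (apply Rinv_lt_0_compat; lra). nra.
Qed.

Lemma lambda_cont a b t : 0 < t < 1 -> continuous (lambda a b) t.
Proof.
intros Ht.
assert (H : forall d, continuous (fun s => Rpower s d) t) by (intros; apply Rpower_cont; lra).
unfold lambda. destruct (Req_EM_T b a) as [E|E].
- apply (ex_derive_continuous (fun t => (a + 1) ^ 2 * Rpower t a * ln (1 / t))). unfold Rpower. auto_derive.
  repeat split; try lra. apply Rdiv_lt_0_compat; lra.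
- apply (ex_derive_continuous (fun t => (a + 1) * (b + 1) * (Rpower t a * (1 - Rpower t (b - a)) / (b - a)))).
  unfold Rpower. auto_derive. repeat split; try lra.
Qed.

Lemma tau_sym a b n : tau a b n = tau b a n.
Proof. unfold tau. rewrite (Rmult_comm (a + 1)), (Rmult_comm (INR n + a + 1)). reflexivity. Qed.

Lemma tau_pos a b n : -1 < a -> -1 < b -> 0 < tau a b n <= 1.
Proof.
intros Ha Hb. pose proof (pos_INR n) as Hn. unfold tau.
assert (Hd : 0 < (INR n + a + 1) * (INR n + b + 1)) by (apply Rmult_lt_0_compat; lra).
split; [apply Rdiv_lt_0_compat; nra|].
apply Rmult_le_reg_r with ((INR n + a + 1) * (INR n + b + 1)); auto.
unfold Rdiv. rewrite Rmult_assoc, Rinv_l by lra. nra.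
Qed.

(** * The pointwise kernel inequality *)

(** With rho = |w| and c = Re w, the quotient is the real part in [kernel_ineq] after the term in
x has been replaced by minus its modulus. It is least at c = - rho, where it takes the value
(1+t^2)/(1+t rho) - t(1-t^2) rho/(1+t rho)^2, and this value decreases in rho with slope at
most - t/4. The slack (s - rho) t / 4 is what makes the final inequality strict. *)
Lemma kernel_real t rho s c : 0 <= t <= 1 -> 0 <= rho <= s -> s < 1 -> - rho <= c -> c ^ 2 <= rho ^ 2 ->
  (1 + t ^ 2) / (1 + t * s) - t * (1 - t ^ 2) * s / (1 + t * s) ^ 2 + (s - rho) * t / 4
  <= ((1 + t ^ 2) * (1 - t * c) - t * (1 - t ^ 2) * rho) / (1 - 2 * t * c + t ^ 2 * rho ^ 2).
Proof.
intros Ht Hrho Hs Hc Hc2.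
assert (Hcr : c <= rho) by nra.
assert (Htr : 0 <= t * rho <= rho) by nra. assert (Hts : 0 <= t * s <= s) by nra.
assert (Htc : t * c <= t * rho) by nra. assert (Htc' : - (t * rho) <= t * c) by nra.
set (D := 1 - 2 * t * c + t ^ 2 * rho ^ 2).
assert (HD : 0 < D) by (unfold D; nra).
assert (HD2 : D <= (1 + t * rho) ^ 2) by (unfold D; nra).
(* As 1 - t c = (D + 1 - t^2 rho^2) / 2, the quotient is (1 + t^2) / 2 + N / D, least for D largest. *)
set (N := (1 + t ^ 2) * (1 - t ^ 2 * rho ^ 2) / 2 - t * (1 - t ^ 2) * rho).
assert (HN : 0 <= N).
{ unfold N. assert (0 <= 1 - t ^ 2) by nra.
  assert (1 - t ^ 2 <= 1 - t ^ 2 * rho ^ 2) by (assert (rho ^ 2 <= 1) by nra; assert (0 <= t ^ 2) by nra; nra).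
  assert (t * rho <= (1 + t ^ 2) / 2) by (pose proof (pow2_ge_0 (1 - t)); nra).
  assert ((1 + t ^ 2) / 2 * (1 - t ^ 2) <= (1 + t ^ 2) / 2 * (1 - t ^ 2 * rho ^ 2)) by (apply Rmult_le_compat_l; nra).
  assert (t * rho * (1 - t ^ 2) <= (1 + t ^ 2) / 2 * (1 - t ^ 2)) by (apply Rmult_le_compat_r; nra). lra. }
replace (((1 + t ^ 2) * (1 - t * c) - t * (1 - t ^ 2) * rho) / D) with ((1 + t ^ 2) / 2 + N / D)
  by (unfold N; field_simplify_eq; [unfold D; ring|lra]).
assert (H1 : N / (1 + t * rho) ^ 2 <= N / D).
{ apply Rmult_le_compat_l; auto. apply Rinv_le_contravar; auto. }
eapply Rle_trans; [|apply Rplus_le_compat_l, H1].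
replace ((1 + t ^ 2) / 2 + N / (1 + t * rho) ^ 2) with ((1 + t ^ 2) / (1 + t * rho) - t * (1 - t ^ 2) * rho / (1 + t * rho) ^ 2)
  by (unfold N; field; lra).
assert (E1 : (1 + t ^ 2) / (1 + t * rho) - (1 + t ^ 2) / (1 + t * s) = (1 + t ^ 2) * (t * (s - rho)) / ((1 + t * rho) * (1 + t * s)))
  by (field; lra).
assert (E2 : t * (1 - t ^ 2) * s / (1 + t * s) ^ 2 - t * (1 - t ^ 2) * rho / (1 + t * rho) ^ 2
   = t * (1 - t ^ 2) * ((s - rho) * (1 - t * rho * (t * s))) / ((1 + t * rho) ^ 2 * (1 + t * s) ^ 2)) by (field; lra).
assert (H2 : (s - rho) * t / 4 <= (1 + t ^ 2) * (t * (s - rho)) / ((1 + t * rho) * (1 + t * s))).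
{ assert (0 < (1 + t * rho) * (1 + t * s) <= 4) by nra.
  assert (0 <= t * (s - rho)) by nra.
  apply Rmult_le_reg_r with ((1 + t * rho) * (1 + t * s)); [lra|].
  unfold Rdiv at 2. rewrite Rmult_assoc, Rinv_l, Rmult_1_r by lra.
  apply Rle_trans with (t * (s - rho)); [nra|]. assert (0 <= t ^ 2) by nra. nra. }
assert (H3 : 0 <= t * (1 - t ^ 2) * ((s - rho) * (1 - t * rho * (t * s))) / ((1 + t * rho) ^ 2 * (1 + t * s) ^ 2)).
{ apply Rdiv_le_0_compat.
  - apply Rmult_le_pos; [apply Rmult_le_pos; nra|]. apply Rmult_le_pos; [lra|]. nra.
  - apply Rmult_lt_0_compat; apply pow_lt; lra. }
lra.
Qed.

Lemma Re_ge_opp_Cmod z : - Cmod z <= Re z.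
Proof. pose proof (re_le_Cmod z). apply Rabs_le_between in H. lra. Qed.

Lemma one_minus_neq_0 v : Cmod v < 1 -> (1 - v)%C <> RtoC 0.
Proof.
intros H E. assert (v = RtoC 1) as Ev.
{ replace v with (1 - (1 - v))%C by ring. rewrite E. ring. }
rewrite Ev, Cmod_1 in H. lra.
Qed.

(** On the right is, for fixed t, the real part of the power series in w with coefficients
((1 + t^2) + x n (1 - t^2)) t^n; the left side is its value at x = 1, w = - s, plus a slack.
Its integral over t produces the coefficients 4 (1 + n (1+x)/2) / ((n+1)(n+3)). *)
Lemma kernel_ineq t x w s : 0 <= t <= 1 -> Cmod x <= 1 -> Cmod w <= s -> s < 1 ->
  (1 + t ^ 2) / (1 + t * s) - t * (1 - t ^ 2) * s / (1 + t * s) ^ 2 + (s - Cmod w) * t / 4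
  <= (1 + t ^ 2) * Re (/ (1 - RtoC t * w)) + (1 - t ^ 2) * Re (x * (RtoC t * w / ((1 - RtoC t * w) * (1 - RtoC t * w)))).
Proof.
intros Ht Hx Hw Hs. pose proof (Cmod_ge_0 w) as Hw0.
assert (Htw : Cmod (RtoC t * w) < 1).
{ rewrite Cmod_mult, Cmod_R, Rabs_pos_eq by lra. nra. }
pose proof (one_minus_neq_0 _ Htw) as Hne.
pose proof (Cmod2_alt w) as Hw2.
assert (HD : Cmod (1 - RtoC t * w) ^ 2 = 1 - 2 * t * Re w + t ^ 2 * Cmod w ^ 2).
{ rewrite Hw2, Cmod2_alt. unfold Re, Im; simpl; ring. }
assert (HDpos : 0 < Cmod (1 - RtoC t * w)) by (apply Cmod_gt_0; auto).
assert (HRe : Re (/ (1 - RtoC t * w)) = (1 - t * Re w) / (1 - 2 * t * Re w + t ^ 2 * Cmod w ^ 2)).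
{ rewrite <- HD, Cmod2_alt. unfold Re, Im; simpl; f_equal; ring. }
assert (HX : - (t * Cmod w / (1 - 2 * t * Re w + t ^ 2 * Cmod w ^ 2)) <=
   Re (x * (RtoC t * w / ((1 - RtoC t * w) * (1 - RtoC t * w))))).
{ eapply Rle_trans; [|apply Re_ge_opp_Cmod]. apply Ropp_le_contravar.
  rewrite Cmod_mult, Cmod_div by (apply Cmult_neq_0; auto).
  rewrite !Cmod_mult, Cmod_R, Rabs_pos_eq by lra. rewrite <- HD.
  replace (Cmod (1 - RtoC t * w) ^ 2) with (Cmod (1 - RtoC t * w) * Cmod (1 - RtoC t * w)) by ring.
  rewrite <- (Rmult_1_l (t * Cmod w / _)) at 2. apply Rmult_le_compat_r; auto.
  apply Rdiv_le_0_compat; [nra|]. nra. }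
rewrite HRe.
eapply Rle_trans; [apply (kernel_real t (Cmod w) s (Re w)); try lra|].
- apply Re_ge_opp_Cmod.
- rewrite Hw2. pose proof (pow2_ge_0 (Im w)). lra.
- assert (0 <= 1 - t ^ 2) by nra.
  apply Rmult_le_compat_l with (r := 1 - t ^ 2) in HX; auto.
  assert (Hpos : 0 < Cmod (1 - RtoC t * w) ^ 2) by (apply pow_lt; auto). rewrite HD in Hpos.
  set (D := 1 - 2 * t * Re w + t ^ 2 * Cmod w ^ 2) in *.
  replace (((1 + t ^ 2) * (1 - t * Re w) - t * (1 - t ^ 2) * Cmod w) / D) with
    ((1 + t ^ 2) * ((1 - t * Re w) / D) + (1 - t ^ 2) * - (t * Cmod w / D)) by (field; lra).
  lra.
Qed.

Lemma Cgeom v : Cmod v < 1 -> is_Cseries (fun n => v ^ n)%C (/ (1 - v))%C.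
Proof.
intros Hv. pose proof (one_minus_neq_0 v Hv) as Hne.
assert (Hs : forall N, (/ (1 - v) - sum_n (fun n => v ^ n) N = v ^ S N / (1 - v))%C).
{ induction N as [|N IH].
  - rewrite sum_O. simpl. field; auto.
  - rewrite sum_Sn. unfold plus; simpl.
    replace (/ (1 - v) - (sum_n (fun n => v ^ n) N + v * v ^ N))%C
      with ((/ (1 - v) - sum_n (fun n => v ^ n) N) - v * v ^ N)%C by ring.
    rewrite IH. simpl. field; auto. }
apply is_Cseries_bound with (fun N => Cmod v / Cmod (1 - v) * Cmod v ^ N).
- intros N. rewrite Hs, Cmod_div, Cmod_pow by auto. simpl. right. unfold Rdiv. ring.
- replace (Finite 0) with (Rbar_mult (Cmod v / Cmod (1 - v)) 0) by (simpl; f_equal; ring).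
  apply is_lim_seq_scal_l, is_lim_seq_geom. rewrite Rabs_pos_eq; auto. apply Cmod_ge_0.
Qed.

Lemma radius_ge_bounded a K : (forall n, Cmod (a n) <= K) -> radius_ge a 1.
Proof.
intros H s Hs. exists K. intros n.
assert (0 < s ^ n <= 1) by (split; [apply pow_lt; lra|rewrite <- (pow1 n); apply pow_incr; lra]).
pose proof (Cmod_ge_0 (a n)). specialize (H n). nra.
Qed.

Lemma radius_ge_linear (a : nat -> C) K : (forall n, Cmod (a n) <= K * (INR n + 1)) -> radius_ge a 1.
Proof.
intros H. apply radius_ge_poly with (fun _ => RtoC 1) (Rabs K).
- apply radius_ge_bounded with 1. intros _. rewrite Cmod_1; lra.
- intros n. rewrite Cmod_1, Rmult_1_r. eapply Rle_trans; [apply H|]. pose proof (pos_INR n).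
  pose proof (Rle_abs K). pose proof (Rabs_pos K).
  apply Rle_trans with (Rabs K * (INR n + 1)); [apply Rmult_le_compat_r; lra|].
  apply Rmult_le_compat_l; auto. nra.
Qed.

(** The shift of index gives a linear equation for the sum, and similarly in [Cgeom_squares]. *)
Lemma Cgeom_deriv v : Cmod v < 1 -> is_Cseries (fun n => RtoC (INR n) * v ^ n)%C (v / ((1 - v) * (1 - v)))%C.
Proof.
intros Hv. pose proof (one_minus_neq_0 v Hv) as Hne.
assert (HS : is_Cseries (fun n => RtoC (INR n) * v ^ n)%C (CPSeries (fun n => RtoC (INR n)) v)).
{ apply is_Cseries_CPSeries with 1; auto. apply radius_ge_linear with 1.
  intros n. pose proof (pos_INR n). rewrite Cmod_R, Rabs_pos_eq; lra. }
set (S := CPSeries (fun n => RtoC (INR n)) v) in *.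
assert (HS' : is_Cseries (fun n => RtoC (INR n) * v ^ n)%C (RtoC (INR 0) * v ^ 0 + v * (S + / (1 - v)))%C).
{ apply (is_Cseries_incr (fun n => RtoC (INR n) * v ^ n)%C).
  apply is_Cseries_ext with (fun n => v * (RtoC (INR n) * v ^ n + v ^ n))%C.
  - intros n. rewrite S_INR, RtoC_plus. simpl. ring.
  - apply is_Cseries_scal, is_Cseries_plus; auto. apply Cgeom; auto. }
assert (E : S = (v * (S + / (1 - v)))%C).
{ rewrite (is_Cseries_unique _ _ _ HS HS') at 1. simpl. ring. }
replace (v / ((1 - v) * (1 - v)))%C with S; auto.
assert (E' : (S * (1 - v))%C = (v / (1 - v))%C).
{ replace (S * (1 - v))%C with (S - v * S)%C by ring. rewrite E at 1. field; auto. }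
replace S with (S * (1 - v) / (1 - v))%C by (field; auto). rewrite E'. field; auto.
Qed.

(** * Admissible coefficient sequences *)

(** Taylor coefficients of (1 + (x-1) w/2) / (1-w)^2, the function whose Hadamard products test
starlikeness. *)
Definition test_coef (x : C) (n : nat) : C := (1 + RtoC (INR n) * ((1 + x) / 2))%C.

(** Coefficientwise difference between the test function at (x, w) and at its presumed minimum
(1, - s). *)
Definition gap (x w : C) (s : R) (n : nat) : R := Re (test_coef x n * w ^ n)%C - (INR n + 1) * (- s) ^ n.

Lemma Cmod_test_coef x n : Cmod x <= 1 -> Cmod (test_coef x n) <= INR n + 1.
Proof.
intros Hx. pose proof (pos_INR n). unfold test_coef.
eapply Rle_trans; [apply Cmod_triangle|].
rewrite Cmod_1, Cmod_mult, Cmod_R, Rabs_pos_eq by auto.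
assert (Cmod ((1 + x) / 2) <= 1).
{ rewrite Cmod_div by (apply RtoC_neq_0; lra). rewrite Cmod_R, Rabs_pos_eq by lra.
  pose proof (Cmod_triangle 1 x). rewrite Cmod_1 in H0. lra. }
nra.
Qed.

Lemma gap_bound x w s n : Cmod x <= 1 -> Cmod w <= s -> s <= 1 -> Rabs (gap x w s n) <= 2 * (INR n + 1) * s ^ n.
Proof.
intros Hx Hw Hs. pose proof (Cmod_ge_0 w) as Hw0. pose proof (pos_INR n) as Hn.
unfold gap. eapply Rle_trans; [apply Rabs_triang|]. rewrite Rabs_Ropp, Rabs_mult, <- RPow_abs, Rabs_Ropp.
rewrite (Rabs_pos_eq s), (Rabs_pos_eq (INR n + 1)) by lra.
assert (Rabs (Re (test_coef x n * w ^ n)) <= (INR n + 1) * s ^ n); [|lra].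
eapply Rle_trans; [apply re_le_Cmod|]. rewrite Cmod_mult, Cmod_pow.
apply Rmult_le_compat; [apply Cmod_ge_0|apply pow_le; auto|apply Cmod_test_coef; auto|apply pow_incr; lra].
Qed.

(** Scaling both radii multiplies the n-th term by u^n; this is why division of the coefficients
by n + k, an average of u^n, preserves admissibility. *)
Lemma gap_scale x w s u n : gap x (RtoC u * w) (u * s) n = gap x w s n * u ^ n.
Proof.
unfold gap. rewrite Cpow_mult_l, <- RtoC_pow.
replace (test_coef x n * (RtoC (u ^ n) * w ^ n))%C with (RtoC (u ^ n) * (test_coef x n * w ^ n))%C by ring.
rewrite re_scal_l. replace (- (u * s)) with (u * - s) by ring. rewrite Rpow_mult_distr. ring.
Qed.

Lemma ex_series_linear_geom s : 0 <= s < 1 -> ex_series (fun n => (INR n + 1) * s ^ n).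
Proof.
intros Hs. apply ex_series_ext with (fun n => Cmod (RtoC (INR n + 1)) * s ^ n).
- intros n. pose proof (pos_INR n). rewrite Cmod_R, Rabs_pos_eq; lra.
- apply radius_ge_ex_series with 1; auto. apply radius_ge_linear with 1. intros n. pose proof (pos_INR n).
  rewrite Cmod_R, Rabs_pos_eq; lra.
Qed.

Lemma ex_series_gap c K x w s : (forall n, Rabs (c n) <= K) -> Cmod x <= 1 -> Cmod w <= s -> s < 1 ->
  ex_series (fun n => Rabs (c n * gap x w s n)).
Proof.
intros Hc Hx Hw Hs. pose proof (Cmod_ge_0 w) as Hw0.
apply ex_series_Rabs_le with (fun n => (2 * K) * ((INR n + 1) * s ^ n)).
- intros n. rewrite Rabs_Rabsolu, Rabs_mult.
  replace (2 * K * ((INR n + 1) * s ^ n)) with (K * (2 * (INR n + 1) * s ^ n)) by ring.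
  apply Rmult_le_compat; try apply Rabs_pos; auto. apply gap_bound; auto; lra.
- exact (ex_series_mult_l (2 * K) _ (ex_series_linear_geom s ltac:(lra))).
Qed.

(** The test function attains its least real part at x = 1, w = - s after Hadamard product with c,
up to a slack which is linear in s - |w|. The slack gives a strict inequality in the end. Only
s < 1 is considered because the series may diverge on the unit circle. *)
Definition admissible (c : nat -> R) : Prop :=
  (exists K, forall n, Rabs (c n) <= K) /\
  exists kappa, 0 < kappa /\ forall x w s, Cmod x <= 1 -> Cmod w <= s -> s < 1 ->
    kappa * (s - Cmod w) <= Series (fun n => c n * gap x w s n).

Lemma admissible_plus_scal c c' al : 0 <= al -> admissible c -> admissible c' -> admissible (fun n => c n + al * c' n).
Proof.
intros Hal [[K HK] (k & Hk & H)] [[K' HK'] (k' & Hk' & H')]. split.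
- exists (K + al * K'). intros n. eapply Rle_trans; [apply Rabs_triang|].
  rewrite Rabs_mult, (Rabs_pos_eq al) by auto. apply Rplus_le_compat; auto. apply Rmult_le_compat_l; auto.
- exists k. split; auto. intros x w s Hx Hw Hs.
  rewrite (Series_ext _ (fun n => c n * gap x w s n + al * (c' n * gap x w s n))) by (intros; ring).
  rewrite Series_plus, Series_scal_l.
  + specialize (H x w s Hx Hw Hs). specialize (H' x w s Hx Hw Hs).
    assert (0 <= k' * (s - Cmod w)) by nra. assert (0 <= al * Series (fun n => c' n * gap x w s n)) by (apply Rmult_le_pos; lra). lra.
  + apply ex_series_Rabs. apply ex_series_gap with K; auto.
  + exact (ex_series_mult_l (al) _ (ex_series_Rabs _ (ex_series_gap c' K' x w s HK' Hx Hw Hs))).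
Qed.

(** 1 / (n + k) is the n-th moment of u^(k-1), so a bound for the power series in u can be integrated. *)
Lemma moment_step (e : nat -> R) k B : 0 < k ->
  (forall u, 0 < u < 1 -> B * u <= Series (fun n => e n * u ^ n)) ->
  (forall y, 0 < y < 1 -> ex_series (fun n => Rabs (e n) * y ^ n)) ->
  ex_series (fun n => Rabs (e n) * / (INR n + k)) ->
  B * / (k + 1) <= Series (fun n => e n * / (INR n + k)).
Proof.
intros Hk HB Hy Hs.
apply (int01_le (fun u => B * Rpower u (k + 1 - 1)) (fun u => Rpower u (k - 1) * Series (fun n => e n * u ^ n))).
- intros u Hu. replace (k + 1 - 1) with (k - 1 + 1) by ring.
  rewrite Rpower_plus, Rpower_1 by lra.
  replace (B * (Rpower u (k - 1) * u)) with (Rpower u (k - 1) * (B * u)) by ring.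
  apply Rmult_le_compat_l; auto. left; apply exp_pos.
- apply int01_scal, int01_Rpower. lra.
- apply (int01_weighted_series (fun u => Rpower u (k - 1)) (fun n => / (INR n + k))); auto.
  + intros t Ht. apply Rpower_cont; lra.
  + intros t Ht. left; apply exp_pos.
  + intros n. eapply int01_ext; [|apply (int01_Rpower (INR n + k)); pose proof (pos_INR n); lra].
    intros t Ht. cbv beta. rewrite <- (Rpower_pow n t) by lra. rewrite <- Rpower_plus. f_equal. ring.
Qed.

Lemma admissible_div c k : 0 < k -> admissible c -> admissible (fun n => c n * / (INR n + k)).
Proof.
intros Hk [[K HK] (kap & Hkap & H)].
assert (Hinv : forall n, 0 < / (INR n + k) <= / k).
{ intros n. pose proof (pos_INR n). split; [apply Rinv_0_lt_compat; lra|apply Rinv_le_contravar; lra]. }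
split.
- exists (K * / k). intros n. destruct (Hinv n). rewrite Rabs_mult, (Rabs_pos_eq (/ _)) by lra.
  apply Rmult_le_compat; try lra; auto. apply Rabs_pos.
- exists (kap / (k + 1)). split; [apply Rdiv_lt_0_compat; lra|].
  intros x w s Hx Hw Hs. pose proof (Cmod_ge_0 w) as Hw0.
  rewrite (Series_ext _ (fun n => (c n * gap x w s n) * / (INR n + k))) by (intros; ring).
  replace (kap / (k + 1) * (s - Cmod w)) with (kap * (s - Cmod w) * / (k + 1)) by (unfold Rdiv; ring).
  pose proof (ex_series_gap c K x w s HK Hx Hw Hs) as Hex.
  apply moment_step; auto.
  + intros u Hu. rewrite (Series_ext _ (fun n => c n * gap x (RtoC u * w) (u * s) n)) by (intros; rewrite gap_scale; ring).
    eapply Rle_trans; [|apply H; auto].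
    * rewrite Cmod_mult, Cmod_R, Rabs_pos_eq by lra. right; ring.
    * rewrite Cmod_mult, Cmod_R, Rabs_pos_eq by lra. apply Rmult_le_compat_l; lra.
    * nra.
  + intros y Hy. apply ex_series_damp with 1; auto. intros n; apply pow_unit; lra.
  + apply ex_series_damp with (/ k); auto. intros n; destruct (Hinv n); lra.
Qed.

Lemma int01_monomial k : int01 (fun t => t ^ k) (/ (INR k + 1)).
Proof.
pose proof (pos_INR k). eapply int01_ext; [|apply (int01_Rpower (INR k + 1)); lra].
intros t Ht. cbv beta. replace (INR k + 1 - 1) with (INR k) by ring. apply Rpower_pow; lra.
Qed.

Lemma is_series_Re u l : is_Cseries u l -> is_series (fun n => Re (u n)) (Re l).
Proof. intros [A _]. exact A. Qed.

Lemma Series_Re u l : is_Cseries u l -> Series (fun n => Re (u n)) = Re l.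
Proof. intros H. apply is_series_unique, is_series_Re, H. Qed.

Lemma kernel_series t x w s : 0 < t < 1 -> Cmod x <= 1 -> Cmod w <= s -> s < 1 ->
  (s - Cmod w) * t / 4 <=
    (1 + t ^ 2) * Series (fun n => (Re (w ^ n) - (- s) ^ n) * t ^ n) +
    (1 - t ^ 2) * Series (fun n => (Re (x * (RtoC (INR n) * w ^ n)) - INR n * (- s) ^ n) * t ^ n).
Proof.
intros Ht Hx Hw Hs. pose proof (Cmod_ge_0 w) as Hw0.
assert (Hb : forall v, Cmod v <= s -> Cmod (RtoC t * v) < 1).
{ intros v Hv. rewrite Cmod_mult, Cmod_R, Rabs_pos_eq by lra. pose proof (Cmod_ge_0 v). nra. }
assert (Hms : Cmod (RtoC (- s)) <= s) by (rewrite Cmod_R, Rabs_Ropp, Rabs_pos_eq; lra).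
assert (H1 : Series (fun n => (Re (w ^ n) - (- s) ^ n) * t ^ n) = Re (/ (1 - RtoC t * w)) - Re (/ (1 - RtoC t * RtoC (- s)))).
{ change (Re (/ (1 - RtoC t * w)) - Re (/ (1 - RtoC t * RtoC (- s)))) with (Re (/ (1 - RtoC t * w) - / (1 - RtoC t * RtoC (- s)))).
  rewrite <- (Series_Re (fun n => (RtoC t * w) ^ n - (RtoC t * RtoC (- s)) ^ n)%C).
  - apply Series_ext. intros n. rewrite !Cpow_mult_l, <- !RtoC_pow. unfold Re; simpl; ring.
  - apply is_Cseries_minus; apply Cgeom; apply Hb; auto. }
assert (H2 : Series (fun n => (Re (x * (RtoC (INR n) * w ^ n)) - INR n * (- s) ^ n) * t ^ n) =
   Re (x * (RtoC t * w / ((1 - RtoC t * w) * (1 - RtoC t * w)))) -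
   Re (RtoC t * RtoC (- s) / ((1 - RtoC t * RtoC (- s)) * (1 - RtoC t * RtoC (- s))))).
{ change (Re ?A - Re ?B) with (Re (A - B)).
  erewrite <- (Series_Re (fun n => x * (RtoC (INR n) * (RtoC t * w) ^ n) - RtoC (INR n) * (RtoC t * RtoC (- s)) ^ n)%C).
  - apply Series_ext. intros n. rewrite !Cpow_mult_l, <- !RtoC_pow. unfold Re; simpl; ring.
  - apply is_Cseries_minus; [apply is_Cseries_scal|]; apply Cgeom_deriv; apply Hb; auto. }
rewrite H1, H2.
assert (E1 : Re (/ (1 - RtoC t * RtoC (- s))) = / (1 + t * s)).
{ rewrite <- RtoC_mult, <- RtoC_minus, <- RtoC_inv by nra. simpl. f_equal; ring. }
assert (E2 : Re (RtoC t * RtoC (- s) / ((1 - RtoC t * RtoC (- s)) * (1 - RtoC t * RtoC (- s)))) = - (t * s / (1 + t * s) ^ 2)).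
{ rewrite <- RtoC_mult, <- RtoC_minus, <- RtoC_mult, <- RtoC_div by nra. simpl. field. nra. }
rewrite E1, E2.
pose proof (kernel_ineq t x w s ltac:(lra) Hx Hw Hs) as K.
assert (0 < 1 + t * s) by nra.
replace ((1 + t ^ 2) / (1 + t * s)) with ((1 + t ^ 2) * / (1 + t * s)) in K by reflexivity.
replace (t * (1 - t ^ 2) * s / (1 + t * s) ^ 2) with ((1 - t ^ 2) * (t * s / (1 + t * s) ^ 2)) in K by (field; lra).
lra.
Qed.

(** 1 / ((n+1)(n+3)) is half the n-th moment of 1 - t^2. Integration by parts in t moves the factor
n of the test coefficients onto the weights 1 + t^2 and 1 - t^2 of [kernel_series]. *)
Lemma admissible_base : admissible (fun n => / ((INR n + 1) * (INR n + 3))).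
Proof.
assert (Hn1 : forall n, 1 <= (INR n + 1) * (INR n + 3)) by (intros n; pose proof (pos_INR n); nra).
split.
{ exists 1. intros n. specialize (Hn1 n). rewrite Rabs_pos_eq by (left; apply Rinv_0_lt_compat; lra).
  rewrite <- Rinv_1. apply Rinv_le_contravar; lra. }
(* The slack t / 4 has integral 1 / 8, and the combination of moments below is 4 times the series. *)
exists (1 / 32). split; [lra|]. intros x w s Hx Hw Hs. pose proof (Cmod_ge_0 w) as Hw0.
(* 4 gap n / ((n+1)(n+3)) is p n times the n-th moment of 1 + t^2 plus q n times that of 1 - t^2. *)
set (p := fun n => Re (w ^ n) - (- s) ^ n).
set (q := fun n => Re (x * (RtoC (INR n) * w ^ n)) - INR n * (- s) ^ n).
assert (Hsn : forall n, Rabs ((- s) ^ n) <= s ^ n) by (intros n; rewrite <- RPow_abs, Rabs_Ropp, Rabs_pos_eq; lra).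
assert (Hp : forall n, Rabs (p n) <= 2 * (INR n + 1) * s ^ n).
{ intros n. unfold p. eapply Rle_trans; [apply Rabs_triang|]. rewrite Rabs_Ropp.
  pose proof (re_le_Cmod (w ^ n)) as H. rewrite Cmod_pow in H. specialize (Hsn n).
  assert (Cmod w ^ n <= s ^ n) by (apply pow_incr; lra). pose proof (pos_INR n).
  assert (0 <= s ^ n) by (apply pow_le; lra). nra. }
assert (Hq : forall n, Rabs (q n) <= 2 * (INR n + 1) * s ^ n).
{ intros n. unfold q. pose proof (pos_INR n) as Hn. eapply Rle_trans; [apply Rabs_triang|].
  rewrite Rabs_Ropp, Rabs_mult, (Rabs_pos_eq (INR n)) by auto.
  pose proof (re_le_Cmod (x * (RtoC (INR n) * w ^ n))) as H.
  rewrite !Cmod_mult, Cmod_pow, Cmod_R, (Rabs_pos_eq (INR n)) in H by auto. specialize (Hsn n).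
  assert (Cmod w ^ n <= s ^ n) by (apply pow_incr; lra).
  assert (0 <= s ^ n) by (apply pow_le; lra).
  assert (INR n * Cmod w ^ n <= INR n * s ^ n) by (apply Rmult_le_compat_l; auto).
  assert (0 <= INR n * Cmod w ^ n) by (apply Rmult_le_pos; auto; apply pow_le; auto).
  assert (Cmod x * (INR n * Cmod w ^ n) <= 1 * (INR n * Cmod w ^ n)) by (apply Rmult_le_compat_r; auto).
  assert (INR n * Rabs ((- s) ^ n) <= INR n * s ^ n) by (apply Rmult_le_compat_l; auto). lra. }
assert (HexL : ex_series (fun n => 2 * ((INR n + 1) * s ^ n))).
{ exact (ex_series_mult_l (2) _ (ex_series_linear_geom s ltac:(lra))). }
assert (Habs : forall e : nat -> R, (forall n, Rabs (e n) <= 2 * (INR n + 1) * s ^ n) -> ex_series (fun n => Rabs (e n))).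
{ intros e He. apply ex_series_Rabs_le with (fun n => 2 * ((INR n + 1) * s ^ n)); auto.
  intros n. rewrite Rabs_Rabsolu. specialize (He n). lra. }
assert (Hmon : forall (sg : R) n, int01 (fun t => (1 + sg * t ^ 2) * t ^ n) (/ (INR n + 1) + sg * / (INR n + 3))).
{ intros sg n. pose proof (pos_INR n).
  replace (/ (INR n + 3)) with (/ (INR (n + 2) + 1)) by (f_equal; rewrite plus_INR; simpl; ring).
  eapply int01_ext; [|apply int01_plus; [apply (int01_monomial n)|apply int01_scal, (int01_monomial (n + 2))]].
  intros t Ht. cbv beta. rewrite pow_add. ring. }
assert (Hcont : forall sg t, continuous (fun t => 1 + sg * t ^ 2) t).
{ intros sg t. apply (ex_derive_continuous (fun t => 1 + sg * t ^ 2)). auto_derive; auto. }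
assert (Hinv : forall n, 0 < / (INR n + 3) <= / (INR n + 1) /\ / (INR n + 1) <= 1).
{ intros n. pose proof (pos_INR n). split; [split|].
  - apply Rinv_0_lt_compat; lra.
  - apply Rinv_le_contravar; lra.
  - rewrite <- Rinv_1. apply Rinv_le_contravar; lra. }
destruct (int01_weighted_series_abs (fun t => 1 + 1 * t ^ 2) (fun n => / (INR n + 1) + 1 * / (INR n + 3)) p 2) as [P1 P2]; auto.
{ intros t Ht; nra. }
{ intros n; specialize (Hinv n); lra. }
destruct (int01_weighted_series_abs (fun t => 1 + (-1) * t ^ 2) (fun n => / (INR n + 1) + (-1) * / (INR n + 3)) q 2) as [Q1 Q2]; auto.
{ intros t Ht; nra. }
{ intros n; specialize (Hinv n); lra. }
pose proof (int01_plus _ _ _ _ P1 Q1) as PQ.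
pose proof (int01_scal _ ((s - Cmod w) / 4) _ (int01_monomial 1)) as L.
assert (Hle := fun H => int01_le _ _ _ _ H L PQ).
lapply Hle; clear Hle; [intros Hle|].
2:{ intros t Ht. cbv beta. pose proof (kernel_series t x w s Ht Hx Hw Hs) as K. fold (p) in K.
  change (fun n => (Re (w ^ n) - (- s) ^ n) * t ^ n) with (fun n => p n * t ^ n) in K.
  change (fun n => (Re (x * (RtoC (INR n) * w ^ n)) - INR n * (- s) ^ n) * t ^ n) with (fun n => q n * t ^ n) in K.
  simpl pow in *. lra. }
rewrite <- Series_plus in Hle by auto.
rewrite (Series_ext _ (fun n => 4 * (/ ((INR n + 1) * (INR n + 3)) * gap x w s n))) in Hle.
- rewrite Series_scal_l in Hle. simpl in Hle. lra.
- intros n. pose proof (pos_INR n). unfold p, q, gap, test_coef.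
  replace (((1 + RtoC (INR n) * ((1 + x) / 2)) * w ^ n)%C) with
    (RtoC (1 + INR n / 2) * w ^ n + RtoC (/ 2) * (x * (RtoC (INR n) * w ^ n)))%C.
  + rewrite re_plus, !re_scal_l. field. lra.
  + rewrite RtoC_plus, RtoC_div, RtoC_inv by lra. field.
Qed.

Lemma admissible_ext c c' : (forall n, c n = c' n) -> admissible c -> admissible c'.
Proof.
intros E [[K HK] (k & Hk & H)]. split.
- exists K. intros n; rewrite <- E; auto.
- exists k; split; auto. intros x w s Hx Hw Hs.
  rewrite (Series_ext _ (fun n => c n * gap x w s n)); auto. intros n; rewrite E; auto.
Qed.

(** With X = n+a+1 and Y = n+b+1, the factor (n+1)(n+3) / (X Y) equals
1 + (2-b)/Y - a/X - a(2-b)/(X Y) and also 1 + (2-a-b)/X + b(b-2)/(X Y); the coefficients are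
nonnegative in the first form when b <= 2 and in the second when b > 2. *)
Lemma admissible_two_poles a b : -1 < a -> -1 < b -> a <= 0 -> a + b <= 2 ->
  admissible (fun n => / ((INR n + a + 1) * (INR n + b + 1))).
Proof.
intros Ha Hb Ha0 Hab. pose proof admissible_base as H0.
pose proof (admissible_div _ (a + 1) ltac:(lra) H0) as HX.
pose proof (admissible_div _ (b + 1) ltac:(lra) H0) as HY.
pose proof (admissible_div _ (b + 1) ltac:(lra) HX) as HXY.
destruct (Rle_or_lt b 2) as [Hb2|Hb2].
- pose proof (admissible_plus_scal _ _ (2 - b) ltac:(lra) H0 HY) as S1.
  pose proof (admissible_plus_scal _ _ (- a) ltac:(lra) S1 HX) as S2.
  pose proof (admissible_plus_scal _ _ (- a * (2 - b)) ltac:(nra) S2 HXY) as S3.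
  eapply admissible_ext; [|exact S3].
  intros n. cbv beta. pose proof (pos_INR n). field. repeat split; lra.
- pose proof (admissible_plus_scal _ _ (2 - a - b) ltac:(lra) H0 HX) as S1.
  pose proof (admissible_plus_scal _ _ (b * (b - 2)) ltac:(nra) S1 HXY) as S2.
  eapply admissible_ext; [|exact S2].
  intros n. cbv beta. pose proof (pos_INR n). field. repeat split; lra.
Qed.

(** (n+1) / (n+p) = 1 + (1-p) / (n+p). *)
Lemma admissible_three_poles a b p : -1 < a -> -1 < b -> a <= 0 -> a + b <= 2 -> 0 < p <= 1 ->
  admissible (fun n => (INR n + 1) / ((INR n + a + 1) * (INR n + b + 1) * (INR n + p))).
Proof.
intros Ha Hb Ha0 Hab Hp. pose proof (admissible_two_poles a b Ha Hb Ha0 Hab) as H.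
eapply admissible_ext; [|exact (admissible_plus_scal _ _ (1 - p) ltac:(lra) H (admissible_div _ p ltac:(lra) H))].
intros n. cbv beta. pose proof (pos_INR n). field. repeat split; lra.
Qed.

(** * The coefficient inequality *)

Lemma ex_series_inv_square : ex_series (fun n => / ((INR n + 1) * (INR n + 1))).
Proof.
apply ex_series_Rabs_le with (fun n => 2 * (/ ((INR n + 1) * (INR n + 2)))).
- intros n. pose proof (pos_INR n). rewrite Rabs_pos_eq by (left; apply Rinv_0_lt_compat; nra).
  apply Rmult_le_reg_l with ((INR n + 1) * (INR n + 1) * (INR n + 2)); [apply Rmult_lt_0_compat; nra|].
  replace ((INR n + 1) * (INR n + 1) * (INR n + 2) * / ((INR n + 1) * (INR n + 1))) with (INR n + 2) by (field; lra).
  replace ((INR n + 1) * (INR n + 1) * (INR n + 2) * (2 * / ((INR n + 1) * (INR n + 2)))) with (2 * (INR n + 1)) by (field; lra).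
  lra.
- exists (2 * 1). apply @is_series_scal_l.
  assert (HS : forall N, sum_n (fun n => / ((INR n + 1) * (INR n + 2))) N = 1 - / (INR N + 2)).
  { induction N as [|N IH].
    - rewrite sum_O. simpl. field.
    - rewrite sum_Sn, IH. unfold plus; simpl plus. rewrite S_INR. simpl. pose proof (pos_INR N). field. lra. }
  change (is_lim_seq (sum_n (fun n => / ((INR n + 1) * (INR n + 2)))) 1).
  apply (is_lim_seq_ext (fun N => 1 - / (INR N + 2))); [intros; symmetry; apply HS|].
  replace (Finite 1) with (Finite (1 - 0)) by (f_equal; ring).
  apply is_lim_seq_minus'; [apply is_lim_seq_const|].
  replace (Finite 0) with (Rbar_inv p_infty) by reflexivity.
  apply is_lim_seq_inv; [|discriminate].
  eapply is_lim_seq_plus; [apply is_lim_seq_INR|apply is_lim_seq_const|reflexivity].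
Qed.

Lemma pole_ratio n k : 0 < k -> 0 < (INR n + 1) / (INR n + k) <= 1 + / k.
Proof.
intros Hk. pose proof (pos_INR n). assert (0 < / k) by (apply Rinv_0_lt_compat; auto). split; [apply Rdiv_lt_0_compat; lra|].
apply Rmult_le_reg_r with (INR n + k); [lra|].
replace ((INR n + 1) / (INR n + k) * (INR n + k)) with (INR n + 1) by (field; lra).
replace ((1 + / k) * (INR n + k)) with (INR n + k + INR n * / k + 1) by (field; lra).
assert (0 <= INR n * / k) by (apply Rmult_le_pos; lra). lra.
Qed.

(** Up to a constant factor, tau a b n (n+1) / ((1 + mu n)(1 + nu n)) for p = 1/mu and r = 1/nu.
The pole at - r stays outside the fraction to match the last division by n + r. *)
Definition four_pole (a b p r : R) (n : nat) : R :=
  (INR n + 1) / ((INR n + a + 1) * (INR n + b + 1) * (INR n + p)) * / (INR n + r).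

Lemma four_pole_bound a b p r : -1 < a -> -1 < b -> 0 < p -> 0 < r ->
  exists K, forall n, 0 < four_pole a b p r n <= K * / (INR n + 1) * / ((INR n + 1) * (INR n + 1)).
Proof.
intros Ha Hb Hp Hr.
exists ((1 + / (a + 1)) * (1 + / (b + 1)) * ((1 + / p) * (1 + / r))). intros n. pose proof (pos_INR n) as Hn.
pose proof (pole_ratio n (a + 1) ltac:(lra)) as A. pose proof (pole_ratio n (b + 1) ltac:(lra)) as B.
pose proof (pole_ratio n p Hp) as P. pose proof (pole_ratio n r Hr) as Q.
set (A' := (INR n + 1) / (INR n + (a + 1))) in *. set (B' := (INR n + 1) / (INR n + (b + 1))) in *.
set (P' := (INR n + 1) / (INR n + p)) in *. set (Q' := (INR n + 1) / (INR n + r)) in *.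
assert (E : four_pole a b p r n = (A' * B' * (P' * Q')) * / (INR n + 1) * / ((INR n + 1) * (INR n + 1))).
{ unfold four_pole, A', B', P', Q'. field. repeat split; lra. }
assert (H1 : 0 < / (INR n + 1)) by (apply Rinv_0_lt_compat; lra).
assert (H2 : 0 < / ((INR n + 1) * (INR n + 1))) by (apply Rinv_0_lt_compat; nra).
assert (HAB : 0 < A' * B' <= (1 + / (a + 1)) * (1 + / (b + 1))).
{ split; [apply Rmult_lt_0_compat; lra|apply Rmult_le_compat; lra]. }
assert (HPQ : 0 < P' * Q' <= (1 + / p) * (1 + / r)).
{ split; [apply Rmult_lt_0_compat; lra|apply Rmult_le_compat; lra]. }
rewrite E. split.
- apply Rmult_lt_0_compat; auto. apply Rmult_lt_0_compat; auto. apply Rmult_lt_0_compat; lra.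
- apply Rmult_le_compat_r; [lra|]. apply Rmult_le_compat_r; [lra|]. apply Rmult_le_compat; lra.
Qed.

Lemma ex_series_four_pole_linear a b p r (e : nat -> R) : -1 < a -> -1 < b -> 0 < p -> 0 < r ->
  (forall n, Rabs (e n) <= 2 * (INR n + 1)) -> ex_series (fun n => Rabs (four_pole a b p r n * e n)).
Proof.
intros Ha Hb Hp Hr He. destruct (four_pole_bound a b p r Ha Hb Hp Hr) as [K HK].
apply ex_series_Rabs_le with (fun n => 2 * K * / ((INR n + 1) * (INR n + 1))).
- intros n. pose proof (pos_INR n) as Hn. rewrite Rabs_Rabsolu, Rabs_mult.
  destruct (HK n) as [H1 H2]. rewrite (Rabs_pos_eq (four_pole a b p r n)) by lra.
  replace (2 * K * / ((INR n + 1) * (INR n + 1))) with (K * / (INR n + 1) * / ((INR n + 1) * (INR n + 1)) * (2 * (INR n + 1))) by (field; lra).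
  apply Rmult_le_compat; auto; [lra|apply Rabs_pos].
- destruct ex_series_inv_square as [l Hl]. exists (2 * K * l). apply @is_series_scal_l; auto.
Qed.

Lemma Rabs_Re_test_coef x w n : Cmod x <= 1 -> Cmod w <= 1 -> Rabs (Re (test_coef x n * w ^ n)) <= (INR n + 1).
Proof.
intros Hx Hw. pose proof (pos_INR n). eapply Rle_trans; [apply re_le_Cmod|].
rewrite Cmod_mult, Cmod_pow. pose proof (Cmod_test_coef x n Hx). pose proof (Cmod_ge_0 (test_coef x n)).
assert (0 <= Cmod w ^ n <= 1).
{ pose proof (Cmod_ge_0 w). split; [apply pow_le; auto|rewrite <- (pow1 n); apply pow_incr; lra]. }
nra.
Qed.

(** The division by n + r makes the series converge up to s = 1, and only radii below 1 are averaged
in it. *)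
Lemma four_pole_gap a b p r : -1 < a -> -1 < b -> a <= 0 -> a + b <= 2 -> 0 < p <= 1 -> 0 < r ->
  exists kappa, 0 < kappa /\ forall x w, Cmod x <= 1 -> Cmod w < 1 ->
    kappa * (1 - Cmod w) <= Series (fun n => four_pole a b p r n * gap x w 1 n).
Proof.
intros Ha Hb Ha0 Hab Hp Hr.
destruct (admissible_three_poles a b p Ha Hb Ha0 Hab Hp) as [[K HK] (k & Hk & H)].
set (c3 := fun n => (INR n + 1) / ((INR n + a + 1) * (INR n + b + 1) * (INR n + p))) in *.
exists (k / (r + 1)). split; [apply Rdiv_lt_0_compat; lra|].
intros x w Hx Hw. pose proof (Cmod_ge_0 w) as Hw0.
assert (Hg : forall n, Rabs (gap x w 1 n) <= 2 * (INR n + 1)).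
{ intros n. pose proof (gap_bound x w 1 n Hx ltac:(lra) ltac:(lra)) as G. rewrite pow1 in G. lra. }
rewrite (Series_ext _ (fun n => (c3 n * gap x w 1 n) * / (INR n + r))) by (intros; unfold four_pole, c3; ring).
replace (k / (r + 1) * (1 - Cmod w)) with (k * (1 - Cmod w) * / (r + 1)) by (unfold Rdiv; ring).
apply moment_step; auto.
- intros u Hu. rewrite (Series_ext _ (fun n => c3 n * gap x (RtoC u * w) u n)).
  + eapply Rle_trans; [|apply H; auto; try lra].
    * rewrite Cmod_mult, Cmod_R, Rabs_pos_eq by lra. right; ring.
    * rewrite Cmod_mult, Cmod_R, Rabs_pos_eq by lra. nra.
  + intros n. replace (gap x (RtoC u * w) u n) with (gap x (RtoC u * w) (u * 1) n) by (rewrite Rmult_1_r; auto).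
    rewrite gap_scale. ring.
- intros y Hy. apply ex_series_Rabs_le with (fun n => 2 * K * ((INR n + 1) * y ^ n)).
  + intros n. rewrite !Rabs_mult, !Rabs_Rabsolu, (Rabs_pos_eq (y ^ n)) by (apply pow_le; lra).
    specialize (HK n). specialize (Hg n).
    replace (2 * K * ((INR n + 1) * y ^ n)) with (K * (2 * (INR n + 1)) * y ^ n) by ring.
    apply Rmult_le_compat_r; [apply pow_le; lra|]. apply Rmult_le_compat; auto; apply Rabs_pos.
  + exact (ex_series_mult_l (2 * K) _ (ex_series_linear_geom y ltac:(lra))).
- apply ex_series_ext with (fun n => Rabs (four_pole a b p r n * gap x w 1 n)).
  + intros n. pose proof (pos_INR n). unfold four_pole, c3. rewrite !Rabs_mult.
    rewrite (Rabs_pos_eq (/ (INR n + r))) by (left; apply Rinv_0_lt_compat; lra). real_goal. ring.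
  + apply ex_series_four_pole_linear; auto; lra.
Qed.

(** The factor (1 + xi n) / (n+1) is xi + (1 - xi) / (n+1), and the second part is an average over
smaller discs, on which the lower bound is the same. *)
Theorem coefficient_inequality a b p r xi : -1 < a -> -1 < b -> a <= 0 -> a + b <= 2 -> 0 < p <= 1 -> 0 < r -> 0 <= xi <= 1 ->
  exists kappa, 0 < kappa /\ forall x w, Cmod x <= 1 -> Cmod w < 1 ->
    Series (fun n => four_pole a b p r n * ((INR n + 1) * (- 1) ^ n)) + kappa * (1 - Cmod w) <=
    Series (fun n => four_pole a b p r n * ((1 + xi * INR n) / (INR n + 1) * Re (test_coef x n * w ^ n))).
Proof.
intros Ha Hb Ha0 Hab Hp Hr Hxi.
destruct (four_pole_gap a b p r Ha Hb Ha0 Hab Hp Hr) as (k & Hk & H).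
exists k; split; auto. intros x w Hx Hw. pose proof (Cmod_ge_0 w) as Hw0.
set (c := four_pole a b p r) in *. set (m := Series (fun n => c n * ((INR n + 1) * (- 1) ^ n))).
assert (Hm : ex_series (fun n => c n * ((INR n + 1) * (- 1) ^ n))).
{ apply ex_series_Rabs, ex_series_four_pole_linear; auto; try lra. intros n. pose proof (pos_INR n).
  rewrite Rabs_mult, pow_1_abs, Rabs_pos_eq; lra. }
assert (Hex : forall v, Cmod v <= 1 -> ex_series (fun n => Rabs (c n * Re (test_coef x n * v ^ n)))).
{ intros v Hv. apply ex_series_four_pole_linear; auto; try lra. intros n. pose proof (pos_INR n).
  pose proof (Rabs_Re_test_coef x v n Hx Hv). lra. }
assert (Hv : forall v, Cmod v < 1 -> m + k * (1 - Cmod v) <= Series (fun n => c n * Re (test_coef x n * v ^ n))).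
{ intros v Hv. specialize (H x v Hx Hv).
  rewrite (Series_ext _ (fun n => c n * Re (test_coef x n * v ^ n) - c n * ((INR n + 1) * (- 1) ^ n))) in H
    by (intros; unfold gap; replace (Ropp 1) with (-1) by ring; ring).
  rewrite Series_minus in H; auto; [fold m in H; lra|]. apply ex_series_Rabs, Hex; lra. }
set (g := fun n => c n * Re (test_coef x n * w ^ n)).
assert (Hexg : ex_series (fun n => Rabs (g n))) by (apply Hex; lra).
assert (Hinv : forall n, 0 < / (INR n + 1) <= 1).
{ intros n. pose proof (pos_INR n). split; [apply Rinv_0_lt_compat; lra|]. rewrite <- Rinv_1. apply Rinv_le_contravar; lra. }
destruct (int01_weighted_series_abs (fun _ => 1) (fun n => / (INR n + 1)) g 1) as [HI1 Hex1]; auto.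
{ intros t _. apply continuous_const. }
{ intros; lra. }
{ intros n. eapply int01_ext; [|apply (int01_monomial n)]. intros t _. cbv beta; ring. }
{ intros n. specialize (Hinv n). lra. }
assert (H1 : m + k * (1 - Cmod w) <= Series (fun n => g n * / (INR n + 1))).
{ replace (m + k * (1 - Cmod w)) with ((m + k * (1 - Cmod w)) * / (INR 0 + 1)) by (simpl INR; rewrite Rplus_0_l, Rinv_1; apply Rmult_1_r).
  apply (int01_le (fun v => (m + k * (1 - Cmod w)) * v ^ 0) (fun v => 1 * Series (fun n => g n * v ^ n))).
  - intros v Hv'. rewrite Rmult_1_l, pow_O, Rmult_1_r.
    rewrite (Series_ext _ (fun n => c n * Re (test_coef x n * (RtoC v * w) ^ n))).
    + eapply Rle_trans; [|apply Hv].
      * rewrite Cmod_mult, Cmod_R, Rabs_pos_eq by lra. apply Rplus_le_compat_l, Rmult_le_compat_l; nra.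
      * rewrite Cmod_mult, Cmod_R, Rabs_pos_eq by lra. nra.
    + intros n. unfold g. rewrite Cpow_mult_l, <- RtoC_pow.
      replace (test_coef x n * (RtoC (v ^ n) * w ^ n))%C with (RtoC (v ^ n) * (test_coef x n * w ^ n))%C by ring.
      rewrite re_scal_l. ring.
  - apply int01_scal, int01_monomial.
  - exact HI1. }
assert (H2 : m + k * (1 - Cmod w) <= Series g) by (apply Hv; auto).
rewrite (Series_ext _ (fun n => xi * g n + (1 - xi) * (g n * / (INR n + 1)))).
- rewrite Series_plus, !Series_scal_l.
  + nra.
  + exact (ex_series_mult_l (xi) _ (ex_series_Rabs _ Hexg)).
  + apply ex_series_mult_l; auto.
- intros n. pose proof (pos_INR n). unfold g. field. lra.
Qed.

(** * The power series of q *)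

Lemma Cgeom_squares v : Cmod v < 1 ->
  is_Cseries (fun n => RtoC ((INR n + 1) ^ 2) * v ^ n)%C ((1 + v) / ((1 - v) * (1 - v) * (1 - v)))%C.
Proof.
intros Hv. pose proof (one_minus_neq_0 v Hv) as Hne.
assert (HS : is_Cseries (fun n => RtoC ((INR n + 1) ^ 2) * v ^ n)%C (CPSeries (fun n => RtoC ((INR n + 1) ^ 2)) v)).
{ apply is_Cseries_CPSeries with 1; auto. apply radius_ge_poly with (fun _ => RtoC 1) 1.
  - apply radius_ge_bounded with 1. intros _. rewrite Cmod_1; lra.
  - intros n. rewrite Cmod_1, Cmod_R, Rabs_pos_eq by apply pow2_ge_0. lra. }
set (S := CPSeries _ v) in *.
assert (HS0 : is_Cseries (fun n => RtoC (INR n ^ 2) * v ^ n)%C (v * S)%C).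
{ replace (v * S)%C with (RtoC (INR 0 ^ 2) * v ^ 0 + v * S)%C by (simpl; rewrite Rmult_0_l; ring).
  apply (is_Cseries_incr (fun n => RtoC (INR n ^ 2) * v ^ n)%C).
  apply is_Cseries_ext with (fun n => v * (RtoC ((INR n + 1) ^ 2) * v ^ n))%C.
  - intros n. rewrite S_INR, Cpow_S. ring.
  - apply is_Cseries_scal; auto. }
assert (HS1 : is_Cseries (fun n => RtoC ((INR n + 1) ^ 2) * v ^ n)%C (v * S + (2 * (v / ((1 - v) * (1 - v))) + / (1 - v)))%C).
{ apply is_Cseries_ext with (fun n => RtoC (INR n ^ 2) * v ^ n + (2 * (RtoC (INR n) * v ^ n) + v ^ n))%C.
  - intros n. replace ((INR n + 1) ^ 2) with (INR n ^ 2 + 2 * INR n + 1) by ring.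
    rewrite !RtoC_plus, RtoC_mult. ring.
  - apply is_Cseries_plus; auto. apply is_Cseries_plus; [apply is_Cseries_scal, Cgeom_deriv; auto|apply Cgeom; auto]. }
pose proof (is_Cseries_unique _ _ _ HS HS1) as E.
replace ((1 + v) / ((1 - v) * (1 - v) * (1 - v)))%C with S; auto.
replace S with ((S - v * S) / (1 - v))%C by (field; auto). rewrite E at 1. field; auto.
Qed.

Lemma kernel_q_series u : Rabs u < 1 ->
  Series (fun n => (INR n + 1) ^ 2 * (- u) ^ n) = (1 - u) / (1 + u) ^ 3.
Proof.
intros Hu. assert (H : Cmod (RtoC (- u)) < 1) by (rewrite Cmod_R, Rabs_Ropp; auto).
apply Rabs_def2 in Hu.
pose proof (Series_Re _ _ (Cgeom_squares _ H)) as E.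
rewrite (Series_ext _ (fun n => (INR n + 1) ^ 2 * (- u) ^ n)) in E.
- rewrite E. rewrite <- RtoC_plus, <- RtoC_minus, <- !RtoC_mult, <- RtoC_div.
  + simpl. field. lra.
  + replace (1 - - u) with (1 + u) by ring. repeat apply Rmult_integral_contrapositive_currified; lra.
- intros n. rewrite <- RtoC_pow, <- RtoC_mult. reflexivity.
Qed.

Lemma ex_series_squares_geom y : 0 <= y < 1 -> ex_series (fun n => (INR n + 1) ^ 2 * y ^ n).
Proof.
intros Hy. apply ex_series_ext with (fun n => Cmod (RtoC ((INR n + 1) ^ 2)) * y ^ n).
- intros n. rewrite Cmod_R, Rabs_pos_eq by apply pow2_ge_0. reflexivity.
- apply radius_ge_ex_series with 1; auto. apply radius_ge_poly with (fun _ => RtoC 1) 1.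
  + apply radius_ge_bounded with 1. intros _. rewrite Cmod_1; lra.
  + intros n. rewrite Cmod_1, Cmod_R, Rabs_pos_eq by apply pow2_ge_0. lra.
Qed.

(** Termwise integration of (1 - u) / (1 + u)^3 = sum (n+1)^2 (-u)^n. *)
Lemma inner_integral p t : 0 < p -> 0 < t < 1 ->
  int01 (fun s => Rpower s (p - 1) * ((1 - s * t) / (1 + s * t) ^ 3))
    (Series (fun n => (INR n + 1) ^ 2 * (- t) ^ n * / (INR n + p))).
Proof.
intros Hp Ht.
assert (Habs : forall n, Rabs ((INR n + 1) ^ 2 * (- t) ^ n) = (INR n + 1) ^ 2 * t ^ n).
{ intros n. rewrite Rabs_mult, <- (RPow_abs (- t)), Rabs_Ropp, (Rabs_pos_eq t), Rabs_pos_eq by (try apply pow2_ge_0; lra). reflexivity. }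
destruct (int01_weighted_series_abs (fun s => Rpower s (p - 1)) (fun n => / (INR n + p)) (fun n => (INR n + 1) ^ 2 * (- t) ^ n) (/ p)) as [H _].
- intros s Hs. apply Rpower_cont; lra.
- intros s Hs. left; apply exp_pos.
- intros n. eapply int01_ext; [|apply (int01_Rpower (INR n + p)); pose proof (pos_INR n); lra].
  intros s Hs. cbv beta. rewrite <- (Rpower_pow n s) by lra. rewrite <- Rpower_plus. f_equal. ring.
- intros n. pose proof (pos_INR n). split; [left; apply Rinv_0_lt_compat; lra|apply Rinv_le_contravar; lra].
- apply ex_series_ext with (fun n => (INR n + 1) ^ 2 * t ^ n); [intros; symmetry; auto|apply ex_series_squares_geom; lra].
- eapply int01_ext; [|exact H]. intros s Hs. cbv beta. rewrite <- kernel_q_series by (rewrite Rabs_pos_eq; nra).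
  f_equal. apply Series_ext. intros n. replace (- (s * t)) with (- t * s) by ring. rewrite Rpow_mult_distr. ring.
Qed.

Definition q_coef (mu nu : R) (n : nat) : R := (INR n + 1) ^ 2 * (- 1) ^ n / ((1 + mu * INR n) * (1 + nu * INR n)).

Lemma q_coef_bound mu nu n : 0 < mu -> 0 < nu -> Rabs (q_coef mu nu n) <= (INR n + 1) ^ 2.
Proof.
intros Hm Hn. pose proof (pos_INR n). unfold q_coef, Rdiv. rewrite !Rabs_mult, pow_1_abs, Rabs_pos_eq by apply pow2_ge_0.
assert (1 <= (1 + mu * INR n) * (1 + nu * INR n)).
{ assert (0 <= mu * INR n) by nra. assert (0 <= nu * INR n) by nra. nra. }
rewrite Rabs_pos_eq by (left; apply Rinv_0_lt_compat; lra).
assert (/ ((1 + mu * INR n) * (1 + nu * INR n)) <= 1) by (rewrite <- Rinv_1; apply Rinv_le_contravar; lra).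
pose proof (pow2_ge_0 (INR n + 1)). nra.
Qed.

Lemma ex_series_q_coef mu nu y : 0 < mu -> 0 < nu -> 0 <= y < 1 -> ex_series (fun n => Rabs (q_coef mu nu n) * y ^ n).
Proof.
intros Hm Hn Hy. apply ex_series_Rabs_le with (fun n => (INR n + 1) ^ 2 * y ^ n); [|apply ex_series_squares_geom; auto].
intros n. rewrite Rabs_mult, Rabs_Rabsolu, (Rabs_pos_eq (y ^ n)) by (apply pow_le; lra).
apply Rmult_le_compat_r; [apply pow_le; lra|apply q_coef_bound; auto].
Qed.

Lemma q_coef_radius mu nu t : 0 < mu -> 0 < nu -> Rabs t < 1 -> Rbar_lt (Rabs t) (CV_radius (q_coef mu nu)).
Proof.
intros Hm Hn Ht. set (y := (Rabs t + 1) / 2). pose proof (Rabs_pos t).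
eapply Rbar_lt_le_trans with (Rabs y).
- simpl. rewrite (Rabs_pos_eq y); unfold y; lra.
- rewrite (Rabs_pos_eq y) by (unfold y; lra). apply (proj1 (Lub_Rbar_correct (CV_disk (q_coef mu nu))) y). unfold CV_disk.
  apply ex_series_ext with (fun n => Rabs (q_coef mu nu n) * y ^ n).
  + intros n. rewrite Rabs_mult, (Rabs_pos_eq (y ^ n)) by (apply pow_le; unfold y; lra). reflexivity.
  + apply ex_series_q_coef; auto. unfold y; lra.
Qed.

(** Both sides are t^(1/nu - 1) times a power series in t; multiplication by t^(1/nu) followed by
derivation multiplies the n-th coefficient by n + 1/nu and so cancels one of its two
denominators. *)
Lemma q_candidate_derive mu nu t : 0 < mu -> 0 < nu -> 0 < t < 1 ->
  is_derive (fun u => Rpower u (1 / nu) * PSeries (q_coef mu nu) u) t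
    (1 / (mu * nu) * Rpower t (1 / nu - 1) * Series (fun n => (INR n + 1) ^ 2 * (- t) ^ n * / (INR n + 1 / mu))).
Proof.
intros Hm Hn Ht. assert (Hrad : Rbar_lt (Rabs t) (CV_radius (q_coef mu nu))) by (apply q_coef_radius; auto; rewrite Rabs_pos_eq; lra).
assert (Hinv : 0 < 1 / nu) by (apply Rdiv_lt_0_compat; lra).
assert (Hex : ex_series (fun n => q_coef mu nu n * t ^ n)).
{ apply ex_series_Rabs_le with (fun n => Rabs (q_coef mu nu n) * t ^ n); [|apply ex_series_q_coef; auto; lra].
  intros n. rewrite Rabs_mult, (Rabs_pos_eq (t ^ n)) by (apply pow_le; lra). lra. }
assert (Hexd : ex_series (fun n => INR n * (q_coef mu nu n * t ^ n))).
{ apply ex_series_ext with (fun n => fst (RtoC (INR n * q_coef mu nu n) * RtoC t ^ n)%C).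
  - intros n. rewrite <- RtoC_pow, <- RtoC_mult. simpl. ring.
  - destruct (is_Cseries_CPSeries (fun n => RtoC (INR n * q_coef mu nu n)) 1 (RtoC t)) as [A _].
    + apply radius_ge_poly with (fun n => RtoC ((INR n + 1) ^ 2)) 1.
      * apply radius_ge_poly with (fun _ => RtoC 1) 1.
        -- apply radius_ge_bounded with 1. intros _. rewrite Cmod_1; lra.
        -- intros n. rewrite Cmod_1, Cmod_R, Rabs_pos_eq by apply pow2_ge_0. lra.
      * intros n. pose proof (pos_INR n). rewrite !Cmod_R, Rabs_mult, (Rabs_pos_eq (INR n)), (Rabs_pos_eq (_ ^ 2)) by (try apply pow2_ge_0; auto).
        pose proof (q_coef_bound mu nu n Hm Hn). pose proof (pow2_ge_0 (INR n + 1)).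
        apply Rmult_le_compat; auto; [apply Rabs_pos|]. nra.
    + rewrite Cmod_R, Rabs_pos_eq; lra.
    + eexists; exact A. }
assert (HPD : t * PSeries (PS_derive (q_coef mu nu)) t = Series (fun n => INR n * (q_coef mu nu n * t ^ n))).
{ rewrite (Series_incr_1_aux (fun n => INR n * (q_coef mu nu n * t ^ n))) by (simpl; ring).
  unfold PSeries. rewrite <- Series_scal_l. apply Series_ext. intros n. unfold PS_derive. simpl pow. ring. }
evar_last.
- apply (is_derive_mult (fun u => Rpower u (1 / nu)) (PSeries (q_coef mu nu))).
  + apply Rpower_derive; lra.
  + apply is_derive_PSeries; auto.
  + intros; apply Rmult_comm.
- match goal with |- plus (mult ?A ?B) (mult ?C ?D) = ?E => change (A * B + C * D = E) end.
  replace (Rpower t (1 / nu)) with (Rpower t (1 / nu - 1) * t).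
  2:{ rewrite <- (Rpower_1 t) at 2 by lra. rewrite <- Rpower_plus. f_equal; ring. }
  transitivity (Rpower t (1 / nu - 1) * (1 / nu * PSeries (q_coef mu nu) t + t * PSeries (PS_derive (q_coef mu nu)) t)); [ring|].
  rewrite HPD. unfold PSeries. rewrite <- Series_scal_l.
  rewrite <- Series_plus; auto.
  2:{ exact (ex_series_mult_l (1 / nu) _ Hex). }
  transitivity (Rpower t (1 / nu - 1) * (1 / (mu * nu) * Series (fun n => (INR n + 1) ^ 2 * (- t) ^ n * / (INR n + 1 / mu)))); [|ring].
  f_equal. rewrite <- Series_scal_l. apply Series_ext. intros n. pose proof (pos_INR n).
  assert (0 < 1 + mu * INR n) by nra. assert (0 < 1 + nu * INR n) by nra.
  assert (0 < INR n + 1 / mu) by (assert (0 < 1 / mu) by (apply Rdiv_lt_0_compat; lra); lra).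
  unfold q_coef. replace (- t) with ((-1) * t) by ring. rewrite Rpow_mult_distr. field. repeat split; nra.
Qed.

Lemma lim_plus (f g : R -> R) lf lg (F : (R -> Prop) -> Prop) :
  Filter F ->
  filterlim f F (locally lf) -> filterlim g F (locally lg) -> filterlim (fun u => f u + g u) F (locally (lf + lg)).
Proof.
intros FF Hf Hg. eapply filterlim_comp_2; [exact Hf|exact Hg|apply (filterlim_plus (V := R_NormedModule))].
Qed.

Lemma lim_mult (f g : R -> R) lf lg (F : (R -> Prop) -> Prop) :
  Filter F ->
  filterlim f F (locally lf) -> filterlim g F (locally lg) -> filterlim (fun u => f u * g u) F (locally (lf * lg)).
Proof.
intros FF Hf Hg. eapply filterlim_comp_2; [exact Hf|exact Hg|apply (filterlim_mult (K := R_AbsRing))].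
Qed.

(** The difference of two solutions, multiplied by t^(1/nu), is constant on (0,1), and right-continuity
of q at 0 forces this constant to be 0. *)
Theorem q_series mu nu q t : 0 < mu -> 0 < nu -> is_q mu nu q -> 0 < t < 1 -> q t = PSeries (q_coef mu nu) t.
Proof.
intros Hm Hn (Hq0 & Hqc & Hqd) Ht.
(* D has derivative 0 on (0,1) and limit 0 at 0. *)
set (D := fun u => Rpower u (1 / nu) * q u - Rpower u (1 / nu) * PSeries (q_coef mu nu) u).
assert (Hinv : 0 < 1 / nu) by (apply Rdiv_lt_0_compat; lra).
assert (Hinvm : 0 < 1 / mu) by (apply Rdiv_lt_0_compat; lra).
assert (HD : forall u, 0 < u < 1 -> is_derive D u 0).
{ intros u Hu. specialize (Hqd u Hu). rewrite (int01_unique _ _ (inner_integral (1 / mu) u Hinvm Hu)) in Hqd.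
  evar_last; [apply (is_derive_minus _ _ _ _ _ Hqd (q_candidate_derive mu nu u Hm Hn Hu))|].
  unfold minus, plus, opp; simpl; ring. }
assert (Hconst : forall x, 0 < x < t -> D x = D t).
{ intros x Hx. apply (eq_is_derive (V := R_NormedModule) D x t); [|lra]. intros u Hu. apply HD; lra. }
assert (HDt : D t = 0).
{ assert (L1 : filterlim D (at_right 0) (locally (D t))).
  { apply at_right_0_eps. intros eps Heps. exists t. split; [lra|]. intros x Hx. rewrite Hconst by auto.
    rewrite Rminus_diag, Rabs_R0; auto. }
  assert (L2 : filterlim D (at_right 0) (locally 0)).
  { assert (HP : filterlim (PSeries (q_coef mu nu)) (at_right 0) (locally (PSeries (q_coef mu nu) 0))).
    { eapply filterlim_filter_le_1; [apply filter_le_within|].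
      apply (ex_derive_continuous (PSeries (q_coef mu nu)) 0). eexists. apply is_derive_PSeries, q_coef_radius; auto. rewrite Rabs_R0; lra. }
    pose proof (Rpower_lim_0 (1 / nu) Hinv) as HR.
    rewrite Hq0 in Hqc.
    replace (locally 0) with (locally (0 * 1 + (-1) * (0 * PSeries (q_coef mu nu) 0))) by (f_equal; ring).
    apply (filterlim_ext (fun u => Rpower u (1 / nu) * q u + (-1) * (Rpower u (1 / nu) * PSeries (q_coef mu nu) u))).
    { intros u. unfold D. ring. }
    assert (FF : Filter (at_right 0)) by (apply within_filter, locally_filter).
    pose proof (lim_mult _ _ _ _ _ FF HR Hqc) as H1.
    pose proof (lim_mult _ _ _ _ _ FF HR HP) as H2.
    pose proof (lim_mult (fun _ => -1) _ (-1) _ _ FF (filterlim_const _) H2) as H3.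
    exact (lim_plus _ _ _ _ _ FF H1 H3). }
  exact (filterlim_locally_unique (V := R_NormedModule) D _ _ L1 L2). }
unfold D in HDt. assert (HR : 0 < Rpower t (1 / nu)) by apply exp_pos.
apply Rmult_eq_reg_l with (Rpower t (1 / nu)); lra.
Qed.

(** The coefficients of q do not tend to 0, but against the moments of lambda, of order n^(-2), they
are summable. *)
Theorem lambda_q_integral a b mu nu q : -1 < a -> -1 < b -> 0 < mu -> 0 < nu -> is_q mu nu q ->
  RInt_gen (fun t => lambda a b t * q t) (at_right 0) (at_left 1) =
  Series (fun n => tau a b n * q_coef mu nu n).
Proof.
intros Ha Hb Hm Hn Hq. apply int01_unique.
eapply int01_ext with (fun t => lambda a b t * Series (fun n => q_coef mu nu n * t ^ n)).
- intros t Ht. rewrite (q_series mu nu q t Hm Hn Hq Ht). reflexivity.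
- rewrite (Series_ext _ (fun n => q_coef mu nu n * tau a b n)) by (intros; ring).
  apply int01_weighted_series.
  + intros t Ht. apply lambda_cont; auto.
  + intros t Ht. apply lambda_pos; auto.
  + intros n. apply lambda_moment; auto.
  + intros y Hy. apply ex_series_q_coef; auto; lra.
  + assert (Hpm : 0 < / mu) by (apply Rinv_0_lt_compat; auto). assert (Hpn : 0 < / nu) by (apply Rinv_0_lt_compat; auto).
    pose proof (ex_series_four_pole_linear a b (/ mu) (/ nu) (fun n => INR n + 1) Ha Hb Hpm Hpn) as H.
    destruct H as [l Hl].
    { intros n. pose proof (pos_INR n). rewrite Rabs_pos_eq; lra. }
    exists ((a + 1) * (b + 1) / (mu * nu) * l).
    apply is_series_ext with (fun n => (a + 1) * (b + 1) / (mu * nu) * Rabs (four_pole a b (/ mu) (/ nu) n * (INR n + 1))); [|apply @is_series_scal_l; auto].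
    intros n. pose proof (pos_INR n). real_goal.
    assert (0 < 1 + mu * INR n) by nra. assert (0 < 1 + nu * INR n) by nra.
    assert (0 < INR n + / mu) by lra. assert (0 < INR n + / nu) by lra.
    destruct (four_pole_bound a b (/ mu) (/ nu) Ha Hb Hpm Hpn) as [K HK]. destruct (HK n) as [HK1 _].
    rewrite Rabs_pos_eq by (apply Rmult_le_pos; lra).
    unfold q_coef, Rdiv. rewrite !Rabs_mult, pow_1_abs, (Rabs_pos_eq (_ ^ 2)) by apply pow2_ge_0.
    rewrite (Rabs_pos_eq (/ _)) by (left; apply Rinv_0_lt_compat; nra).
    unfold four_pole, tau. field. repeat split; try lra; nra.
Qed.

(** * Taylor coefficients of the transform *)

Lemma Cdiff_ext_disc f g r z l : (forall w, Cmod w < r -> f w = g w) -> Cmod z < r -> Cdiff f z l -> Cdiff g z l.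
Proof.
intros H Hz. apply (Cdiff_ext_loc f g z l (r - Cmod z)); [lra|].
intros w Hw. apply H. pose proof (Cmod_triangle (w - z) z). replace (w - z + z)%C with w in H0 by ring. lra.
Qed.

Lemma CPSeries_on_disc_Cdiff g c r : radius_ge c r -> (forall w, Cmod w < r -> g w = CPSeries c w) ->
  forall w, Cmod w < r -> Cdiff g w (CPSeries (deriv_coef c) w).
Proof.
intros Hc Hg w Hw. apply (Cdiff_ext_disc (CPSeries c) g r); auto; [intros; symmetry; auto|].
apply CPSeries_Cdiff with r; auto.
Qed.

Lemma CPSeries_on_disc_derive g c r : radius_ge c r -> (forall w, Cmod w < r -> g w = CPSeries c w) ->
  forall w, Cmod w < r -> C_derive g w = CPSeries (deriv_coef c) w.
Proof. intros Hc Hg w Hw. apply Cdiff_C_derive, (CPSeries_on_disc_Cdiff g c r); auto. Qed.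

Lemma CPSeries_unique c w l : is_Cseries (fun n => c n * w ^ n)%C l -> CPSeries c w = l.
Proof. apply is_Cseries_CSeries. Qed.

Lemma CPSeries_0 c : CPSeries c 0 = c O.
Proof.
apply CPSeries_unique. replace (c O) with (c O * 0 ^ 0 + 0)%C by (simpl; ring).
apply (is_Cseries_incr (fun n => c n * 0 ^ n)%C).
apply is_Cseries_ext with (fun n => 0 * c (S n))%C; [intros n; simpl; ring|].
apply is_Cseries_bound with (fun _ => 0); [|apply is_lim_seq_const].
intros N. right. replace (sum_n _ N) with (RtoC 0).
- replace (RtoC 0 - RtoC 0)%C with (RtoC 0) by ring. apply Cmod_0.
- induction N as [|N IH]; [rewrite sum_O; ring|]. rewrite sum_Sn, <- IH. unfold plus; simpl. ring.
Qed.

(** Coefficients of z g(z) for g the derivative of the series. *)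
Definition times_n (c : nat -> C) (n : nat) : C := (RtoC (INR n) * c n)%C.

Lemma radius_ge_times_n c r : radius_ge c r -> radius_ge (times_n c) r.
Proof.
intros H. apply radius_ge_poly with c 1; auto. intros n. pose proof (pos_INR n).
unfold times_n. rewrite Cmod_mult, Cmod_R, Rabs_pos_eq by auto.
apply Rmult_le_compat_r; [apply Cmod_ge_0|]. nra.
Qed.

Lemma CPSeries_shift c r w : radius_ge c r -> Cmod w < r -> CPSeries c w = (c O + w * CPSeries (fun n => c (S n)) w)%C.
Proof.
intros Hc Hw. apply CPSeries_unique.
replace (c O) with (c O * w ^ 0)%C at 1 by (simpl; ring).
apply (is_Cseries_incr (fun n => c n * w ^ n)%C).
apply is_Cseries_ext with (fun n => w * (c (S n) * w ^ n))%C; [intros n; simpl; ring|].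
apply is_Cseries_scal. apply is_Cseries_CPSeries with r; auto. apply radius_ge_shift; auto.
Qed.

Lemma CPSeries_times_n c r w : radius_ge c r -> Cmod w < r -> (w * CPSeries (deriv_coef c) w)%C = CPSeries (times_n c) w.
Proof.
intros Hc Hw. rewrite (CPSeries_shift (times_n c) r) by (auto; apply radius_ge_times_n; auto).
unfold times_n at 1. simpl INR. rewrite Cmult_0_l, Cplus_0_l. f_equal. unfold CPSeries, CSeries.
f_equal; apply Series_ext; intros n; unfold times_n, deriv_coef; rewrite S_INR; reflexivity.
Qed.

Lemma analytic_CPSeries f r : analytic_in_disc f -> 0 < r < 1 ->
  exists a, radius_ge a r /\ forall w, Cmod w < r -> f w = CPSeries a w.
Proof.
intros Hf Hr. destruct (taylor_expansion f r) as (a & M & HM & Ha); [lra| |].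
- intros w Hw. exists (C_derive f w). apply ex_derive_Cdiff, Hf. unfold unit_disc; lra.
- exists a. split.
  + intros s Hs. exists M. intros n. eapply Rle_trans; [|apply (HM n)].
    apply Rmult_le_compat_l; [apply Cmod_ge_0|apply pow_incr; lra].
  + intros w Hw. symmetry. apply CPSeries_unique, Ha; auto.
Qed.

Lemma is_RInt_gen_C g l1 l2 : int01 (fun t => fst (g t)) l1 -> int01 (fun t => snd (g t)) l2 ->
  is_RInt_gen (V := C_R_NormedModule) g (at_right 0) (at_left 1) (l1, l2).
Proof.
intros H1 H2 P [eps HP].
specialize (H1 (ball l1 eps) (locally_ball l1 eps)). specialize (H2 (ball l2 eps) (locally_ball l2 eps)).
unfold filtermapi in *.
generalize (filter_and (F := filter_prod (at_right 0) (at_left 1)) _ _ H1 H2).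
apply filter_imp. intros ab [(y1 & A1 & B1) (y2 & A2 & B2)].
exists (y1, y2). split.
- apply (is_RInt_fct_extend_pair (U := R_NormedModule) (V := R_NormedModule)); auto.
- apply HP. split; auto.
Qed.

(** Index n carries the moment n - 1, because f(t z) / t and not f(t z) is integrated. *)
Definition V_coef (al bl : R) (a : nat -> C) (n : nat) : C :=
  match n with O => RtoC 0 | S m => (RtoC (tau al bl m) * a (S m))%C end.

Lemma radius_ge_V_coef al bl a r : -1 < al -> -1 < bl -> radius_ge a r -> radius_ge (V_coef al bl a) r.
Proof.
intros Ha Hb H. apply radius_ge_poly with a 1; auto. intros [|n]; unfold V_coef.
- rewrite Cmod_0. simpl. pose proof (Cmod_ge_0 (a O)). lra.
- pose proof (tau_pos al bl n Ha Hb). rewrite Cmod_mult, Cmod_R, Rabs_pos_eq by lra.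
  pose proof (Cmod_ge_0 (a (S n))). pose proof (pos_INR (S n)).
  apply Rmult_le_compat_r; auto. nra.
Qed.

(** Termwise integration of f(t z) / t = sum a_(n+1) z^(n+1) t^n, whose coefficients are absolutely
summable for fixed z. *)
Lemma V_op_series al bl f a r z : -1 < al -> -1 < bl -> radius_ge a r ->
  (forall w, Cmod w < r -> f w = CPSeries a w) -> a O = RtoC 0 -> Cmod z < r ->
  V_op (lambda al bl) f z = CPSeries (V_coef al bl a) z.
Proof.
intros Ha Hb Hg Hf Ha0 Hz. pose proof (Cmod_ge_0 z) as Hz0.
set (e := fun n => (a (S n) * z ^ S n)%C).
assert (Hser : is_series (fun n => Cmod (e n)) (Series (fun n => Cmod (e n)))).
{ apply Series_correct.
  destruct (radius_ge_ex_series _ r (Cmod z) (radius_ge_shift _ _ Hg) ltac:(lra)) as [l Hl].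
  exists (Cmod z * l). apply is_series_ext with (fun n => Cmod z * (Cmod (a (S n)) * Cmod z ^ n)); [|apply @is_series_scal_l; auto].
  intros n. real_goal. unfold e. rewrite Cmod_mult, Cmod_pow. simpl. ring. }
assert (Hft : forall t, 0 < t < 1 -> is_Cseries (fun n => e n * RtoC (t ^ n))%C (f (RtoC t * z) / RtoC t)%C).
{ intros t Ht. assert (Htz : Cmod (RtoC t * z) < r) by (rewrite Cmod_mult, Cmod_R, Rabs_pos_eq by lra; nra).
  assert (HL : is_Cseries (fun n => e n * RtoC (t ^ n))%C (CSeries (fun n => e n * RtoC (t ^ n))%C)).
  { apply is_Cseries_abs with (fun n => Cmod (e n)); [|eexists; exact Hser].
    intros n. rewrite Cmod_mult, Cmod_R, Rabs_pos_eq by (apply pow_le; lra).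
    pose proof (pow_unit t n ltac:(lra)). pose proof (Cmod_ge_0 (e n)). nra. }
  set (L := CSeries _) in HL.
  assert (E : CPSeries a (RtoC t * z) = (RtoC t * L)%C).
  { apply CPSeries_unique. replace (RtoC t * L)%C with (a O * (RtoC t * z) ^ 0 + RtoC t * L)%C by (rewrite Ha0; ring).
    apply (is_Cseries_incr (fun n => a n * (RtoC t * z) ^ n)%C).
    apply is_Cseries_ext with (fun n => RtoC t * (e n * RtoC (t ^ n)))%C; [|apply is_Cseries_scal; auto].
    intros n. unfold e. rewrite Cpow_mult_l, RtoC_pow, !Cpow_S. ring. }
  rewrite Hf, E by auto. replace (RtoC t * L / RtoC t)%C with L; auto. field. apply RtoC_neq_0; lra. }
assert (Htau : forall n, 0 < tau al bl n <= 1) by (intros; apply tau_pos; auto).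
assert (Hcomp : forall (pr : C -> R), (forall n, Rabs (pr (e n)) <= Cmod (e n)) ->
  int01 (fun t => lambda al bl t * Series (fun n => pr (e n) * t ^ n)) (Series (fun n => pr (e n) * tau al bl n)) /\
  ex_series (fun n => pr (e n) * tau al bl n)).
{ intros pr Hpr. apply (int01_weighted_series_abs (lambda al bl) (tau al bl) (fun n => pr (e n)) 1).
  - intros t Ht. apply lambda_cont; auto.
  - intros t Ht. apply lambda_pos; auto.
  - intros n. apply lambda_moment; auto.
  - intros n. specialize (Htau n). lra.
  - apply ex_series_Rabs_le with (fun n => Cmod (e n)); [|eexists; exact Hser].
    intros n. rewrite Rabs_Rabsolu. apply Hpr. }
assert (HV : is_RInt_gen (V := C_R_NormedModule) (fun t : R => (lambda al bl t * (f (t * z) / t))%C) (at_right 0) (at_left 1)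
   (Series (fun n => fst (e n) * tau al bl n), Series (fun n => snd (e n) * tau al bl n))).
{ apply is_RInt_gen_C.
  - eapply int01_ext; [|apply (Hcomp fst); intros; apply Rabs_fst_Cmod].
    intros t Ht. cbv beta. destruct (Hft t Ht) as [A B]. apply is_series_unique in A.
    rewrite (Series_ext _ (fun n => fst (e n * RtoC (t ^ n))%C)) by (intros; simpl; ring).
    rewrite A. simpl. ring.
  - eapply int01_ext; [|apply (Hcomp snd); intros; apply Rabs_snd_Cmod].
    intros t Ht. cbv beta. destruct (Hft t Ht) as [A B]. apply is_series_unique in B.
    rewrite (Series_ext _ (fun n => snd (e n * RtoC (t ^ n))%C)) by (intros; simpl; ring).
    rewrite B. simpl. ring. }
unfold V_op. rewrite (is_RInt_gen_unique (V := C_R_CompleteNormedModule) _ _ HV).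
symmetry. apply CPSeries_unique.
match goal with |- is_Cseries _ ?l => replace l with (V_coef al bl a O * z ^ 0 + l)%C by (simpl; ring) end.
apply (is_Cseries_incr (fun n => V_coef al bl a n * z ^ n)%C).
apply is_Cseries_ext with (fun n => RtoC (tau al bl n) * e n)%C; [intros n; unfold V_coef, e; ring|].
split; cbn [fst snd].
- apply is_series_ext with (fun n => fst (e n) * tau al bl n); [intros n; real_goal; simpl; ring|].
  apply Series_correct, (Hcomp fst). intros; apply Rabs_fst_Cmod.
- apply is_series_ext with (fun n => snd (e n) * tau al bl n); [intros n; real_goal; simpl; ring|].
  apply Series_correct, (Hcomp snd). intros; apply Rabs_snd_Cmod.
Qed.

(** * Fourier pairing on a circle *)

Lemma is_RInt_Re_cis c j : cis (j * (2 * PI)) = RtoC 1 -> j <> 0 ->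
  is_RInt (fun t => Re (c * cis (j * t))) 0 (2 * PI) 0.
Proof.
intros Hj Hj0. pose proof (f_equal fst Hj) as E1. pose proof (f_equal snd Hj) as E2. simpl in E1, E2.
apply is_RInt_ext with (fun t => fst c * cos (j * t) - snd c * sin (j * t)); [intros t _; reflexivity|].
replace 0 with (minus ((fst c * sin (j * (2 * PI)) + snd c * cos (j * (2 * PI))) / j) ((fst c * sin (j * 0) + snd c * cos (j * 0)) / j)) at 2.
2:{ rewrite E1, E2, !Rmult_0_r, sin_0, cos_0. unfold minus, plus, opp; simpl. field; auto. }
apply (is_RInt_derive (V := R_CompleteNormedModule) (fun t => (fst c * sin (j * t) + snd c * cos (j * t)) / j)).
- intros t _. auto_derive; auto. field; auto.
- intros t _. apply (ex_derive_continuous (fun t => fst c * cos (j * t) - snd c * sin (j * t))). auto_derive; auto.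
Qed.

Lemma cis_0 : cis 0 = RtoC 1.
Proof. unfold cis. rewrite cos_0, sin_0. reflexivity. Qed.

Lemma cis_INR_2PI n : cis (INR n * (2 * PI)) = RtoC 1.
Proof. rewrite <- cis_pow. replace (cis (2 * PI)) with (RtoC 1); [apply Cpow_1_l|]. unfold cis. rewrite cos_2PI, sin_2PI. reflexivity. Qed.

Definition pairing_term (P Q : C) (k : nat) : R := PI * Re (P * Q) + (if Nat.eq_dec k 0 then PI * Re (P * Cconj Q) else 0).

(** A product of two real parts is half the sum of the real parts of P Q cis((n-k) t) and
P conj(Q) cis((n+k) t); frequency zero is the only one that survives. *)
Lemma orthogonality P Q n k : is_RInt (fun t => Re (P * cis (INR n * t)) * Re (Q * cis (- INR k * t))) 0 (2 * PI)
  (if Nat.eq_dec n k then pairing_term P Q k else 0).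
Proof.
apply is_RInt_ext with (fun t => / 2 * Re (P * Q * cis ((INR n - INR k) * t)) + / 2 * Re (P * Cconj Q * cis ((INR n + INR k) * t))).
{ intros t _. replace ((INR n - INR k) * t) with (INR n * t + - INR k * t) by ring.
  replace ((INR n + INR k) * t) with (INR n * t + - (- INR k * t)) by ring.
  unfold cis. rewrite !cos_plus, !sin_plus, !cos_neg, !sin_neg. simpl. field. }
assert (Hconst : forall c, is_RInt (fun t => / 2 * Re (c * cis (0 * t))) 0 (2 * PI) (PI * Re c)).
{ intros c. apply is_RInt_ext with (fun _ => / 2 * Re c).
  - intros t _. rewrite Rmult_0_l, cis_0, Cmult_1_r. reflexivity.
  - replace (PI * Re c) with (scal (2 * PI - 0) (/ 2 * Re c)) by (unfold scal; simpl; unfold mult; simpl; field).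
    apply @is_RInt_const. }
assert (Hzero : forall c j, cis (j * (2 * PI)) = RtoC 1 -> j <> 0 -> is_RInt (fun t => / 2 * Re (c * cis (j * t))) 0 (2 * PI) 0).
{ intros c j H1 H2. replace 0 with (scal (/ 2) 0) at 2 by (unfold scal; simpl; unfold mult; simpl; ring).
  apply @is_RInt_scal. apply is_RInt_Re_cis; auto. }
pose proof (pos_INR n) as Hn. pose proof (pos_INR k) as Hk.
assert (Hplus : (n + k <> 0)%nat -> is_RInt (fun t => / 2 * Re (P * Cconj Q * cis ((INR n + INR k) * t))) 0 (2 * PI) 0).
{ intros H. apply Hzero; rewrite <- plus_INR; [apply cis_INR_2PI|apply not_0_INR; auto]. }
destruct (Nat.eq_dec n k) as [E|E].
- subst k. unfold pairing_term. apply @is_RInt_plus.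
  + rewrite Rminus_diag. apply Hconst.
  + destruct (Nat.eq_dec n 0) as [E0|E0].
    * subst n. simpl INR. rewrite Rplus_0_r. apply Hconst.
    * apply Hplus; lia.
- replace 0 with (plus 0 0) at 2 by (unfold plus; simpl; ring). apply @is_RInt_plus.
  + apply Hzero.
    * replace ((INR n - INR k) * (2 * PI)) with (INR n * (2 * PI) + - (INR k * (2 * PI))) by ring.
      rewrite cis_add, cis_opp, !cis_INR_2PI. field.
    * intros H. apply E, INR_eq. lra.
  + apply Hplus; lia.
Qed.

Lemma is_series_single k x : is_series (fun n => if Nat.eq_dec n k then x else 0) x.
Proof.
assert (H : forall N, sum_n (fun n => if Nat.eq_dec n k then x else 0) N = if Compare_dec.le_dec k N then x else 0).
{ induction N as [|N IH].
  - rewrite sum_O. destruct (Nat.eq_dec 0 k), (Compare_dec.le_dec k 0); try lia; auto.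
  - rewrite sum_Sn, IH. match goal with |- plus ?A ?B = ?C => change (A + B = C) end.
    destruct (Nat.eq_dec (S N) k), (Compare_dec.le_dec k N), (Compare_dec.le_dec k (S N)); try lia; ring. }
change (is_lim_seq (sum_n (fun n => if Nat.eq_dec n k then x else 0)) x).
apply is_lim_seq_ext_loc with (fun _ => x); [|apply is_lim_seq_const].
exists k. intros N HN. rewrite H. destruct (Compare_dec.le_dec k N); [auto|lia].
Qed.

Lemma continuous_Re_cis c j t : continuous (fun t => Re (c * cis (j * t))) t.
Proof.
apply (continuous_ext (fun t => fst c * cos (j * t) - snd c * sin (j * t))); [intros; reflexivity|].
apply (ex_derive_continuous (fun t => fst c * cos (j * t) - snd c * sin (j * t))). auto_derive; auto.
Qed.

Lemma Rabs_Re_cis c t : Rabs (Re (c * cis t)) <= Cmod c.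
Proof. eapply Rle_trans; [apply re_le_Cmod|]. rewrite Cmod_mult, Cmod_cis. lra. Qed.

(** Two successive termwise integrations reduce to [orthogonality]. *)
Theorem fourier_pairing (P Q : nat -> C) :
  ex_series (fun n => Cmod (P n)) -> ex_series (fun n => Cmod (Q n)) ->
  let u := fun t => Series (fun n => Re (P n * cis (INR n * t))) in
  let v := fun t => Series (fun n => Re (Q n * cis (- INR n * t))) in
  (forall t, continuous u t) ->
  is_RInt (fun t => u t * v t) 0 (2 * PI) (Series (fun k => pairing_term (P k) (Q k) k)).
Proof.
intros HP HQ u v Hu. pose proof PI_RGT_0 as HPI.
assert (Hinner : forall k, is_RInt (fun t => u t * Re (Q k * cis (- INR k * t))) 0 (2 * PI) (pairing_term (P k) (Q k) k)).
{ intros k.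
  destruct (is_RInt_series (fun n t => Re (P n * cis (INR n * t)) * Re (Q k * cis (- INR k * t)))
     (fun n => Cmod (Q k) * Cmod (P n)) 0 (2 * PI)) as [A _].
  - lra.
  - intros n t _. apply (continuous_mult (K := R_AbsRing) (fun t => Re (P n * cis (INR n * t)))); apply continuous_Re_cis.
  - intros n t _. rewrite Rabs_mult, Rmult_comm. apply Rmult_le_compat; try apply Rabs_pos; apply Rabs_Re_cis.
  - exact (ex_series_mult_l (Cmod (Q k)) _ HP).
  - rewrite (Series_ext _ (fun n => if Nat.eq_dec n k then pairing_term (P k) (Q k) k else 0)) in A.
    + rewrite (is_series_unique _ _ (is_series_single k _)) in A.
      eapply is_RInt_ext; [|exact A]. intros t _. unfold u. rewrite <- Series_scal_r. reflexivity.
    + intros n. rewrite (is_RInt_unique _ _ _ _ (orthogonality (P n) (Q k) n k)).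
      destruct (Nat.eq_dec n k) as [E|E]; [subst n|]; reflexivity. }
destruct (is_RInt_series (fun k t => u t * Re (Q k * cis (- INR k * t)))
     (fun k => Series (fun n => Cmod (P n)) * Cmod (Q k)) 0 (2 * PI)) as [A _].
- lra.
- intros k t _. apply (continuous_mult (K := R_AbsRing) u); auto. apply continuous_Re_cis.
- intros k t _. rewrite Rabs_mult. apply Rmult_le_compat; try apply Rabs_pos; [|apply Rabs_Re_cis].
  unfold u. eapply Rle_trans; [apply Series_Rabs|].
  + apply ex_series_Rabs_le with (fun n => Cmod (P n)); auto. intros n. rewrite Rabs_Rabsolu. apply Rabs_Re_cis.
  + apply Series_le; auto. intros n; split; [apply Rabs_pos|apply Rabs_Re_cis].
- exact (ex_series_mult_l (Series (fun n => Cmod (P n))) _ HQ).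
- rewrite (Series_ext _ (fun k => pairing_term (P k) (Q k) k)) in A by (intros k; apply is_RInt_unique; auto).
  eapply is_RInt_ext; [|exact A]. intros t _. unfold v. rewrite <- Series_scal_l. reflexivity.
Qed.

(** * Duality *)

(** Coefficients A_n of the Hadamard multiplier, without the test coefficient. *)
Definition dual_coef (a b mu nu xi : R) (n : nat) : R :=
  tau a b n * (1 + xi * INR n) / ((1 + mu * INR n) * (1 + nu * INR n)).

Lemma dual_inequality_ordered a b mu nu xi : -1 < a -> -1 < b -> a <= 0 -> a + b <= 2 -> 1 <= mu -> 0 < nu -> 0 <= xi <= 1 ->
  exists kappa, 0 < kappa /\ forall x w, Cmod x <= 1 -> Cmod w < 1 ->
    Series (fun n => tau a b n * q_coef mu nu n) + kappa * (1 - Cmod w) <=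
    Series (fun n => dual_coef a b mu nu xi n * Re (test_coef x n * w ^ n)).
Proof.
intros Ha Hb Ha0 Hab Hm Hn Hxi.
assert (Hpm : 0 < / mu <= 1) by (split; [apply Rinv_0_lt_compat; lra|rewrite <- Rinv_1; apply Rinv_le_contravar; lra]).
assert (Hpn : 0 < / nu) by (apply Rinv_0_lt_compat; lra).
destruct (coefficient_inequality a b (/ mu) (/ nu) xi Ha Hb Ha0 Hab Hpm Hpn Hxi) as (k & Hk & H).
set (C0 := (a + 1) * (b + 1) / (mu * nu)).
assert (HC0 : 0 < C0) by (apply Rdiv_lt_0_compat; apply Rmult_lt_0_compat; lra).
exists (C0 * k). split; [apply Rmult_lt_0_compat; auto|]. intros x w Hx Hw. specialize (H x w Hx Hw).
assert (Hpos : forall n, 0 < 1 + mu * INR n /\ 0 < 1 + nu * INR n /\ 0 < INR n + / mu /\ 0 < INR n + / nu /\ 0 <= INR n).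
{ intros n. pose proof (pos_INR n). assert (0 <= mu * INR n) by nra. assert (0 <= nu * INR n) by nra. lra. }
rewrite (Series_ext (fun n => tau a b n * q_coef mu nu n) (fun n => C0 * (four_pole a b (/ mu) (/ nu) n * ((INR n + 1) * (-1) ^ n)))).
2:{ intros n. destruct (Hpos n) as (P1 & P2 & P3 & P4 & P5). unfold tau, q_coef, four_pole, C0. field. repeat split; try lra; nra. }
rewrite (Series_ext (fun n => dual_coef a b mu nu xi n * Re (test_coef x n * w ^ n))
   (fun n => C0 * (four_pole a b (/ mu) (/ nu) n * ((1 + xi * INR n) / (INR n + 1) * Re (test_coef x n * w ^ n))))).
2:{ intros n. destruct (Hpos n) as (P1 & P2 & P3 & P4 & P5). unfold tau, dual_coef, four_pole, C0. unfold tau. field. repeat split; try lra; nra. }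
rewrite !Series_scal_l. apply Rmult_le_compat_l with (r := C0) in H; lra.
Qed.

Lemma dual_inequality a b mu nu xi : -1 < a -> -1 < b -> a <= 0 \/ b <= 0 -> a + b <= 2 -> 1 <= mu -> 0 < nu -> 0 <= xi <= 1 ->
  exists kappa, 0 < kappa /\ forall x w, Cmod x <= 1 -> Cmod w < 1 ->
    Series (fun n => tau a b n * q_coef mu nu n) + kappa * (1 - Cmod w) <=
    Series (fun n => dual_coef a b mu nu xi n * Re (test_coef x n * w ^ n)).
Proof.
intros Ha Hb [Ha0|Hb0] Hab Hm Hn Hxi.
- apply dual_inequality_ordered; auto.
- destruct (dual_inequality_ordered b a mu nu xi Hb Ha Hb0 ltac:(lra) Hm Hn Hxi) as (k & Hk & H).
  exists k; split; auto. intros x w Hx Hw.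
  rewrite (Series_ext (fun n => tau a b n * q_coef mu nu n) (fun n => tau b a n * q_coef mu nu n)) by (intros; rewrite tau_sym; auto).
  rewrite (Series_ext (fun n => dual_coef a b mu nu xi n * Re (test_coef x n * w ^ n)) (fun n => dual_coef b a mu nu xi n * Re (test_coef x n * w ^ n)))
    by (intros; unfold dual_coef; rewrite tau_sym; auto).
  auto.
Qed.

Lemma ex_series_Cmod_radius a r s : radius_ge a r -> 0 <= s < r -> ex_series (fun n => Cmod (a n * RtoC s ^ n)).
Proof.
intros Ha Hs. apply ex_series_ext with (fun n => Cmod (a n) * s ^ n); [|apply radius_ge_ex_series with r; auto].
intros n. rewrite Cmod_mult, Cmod_pow, Cmod_R, Rabs_pos_eq by lra. reflexivity.
Qed.

(** On the circle of radius s, |z| < s < r, the positive function u = Re e^(i phi) (g - beta) is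
integrated against the nonnegative function Re A(z/s cis(-t)) - m - eta. Since 1 - m is
1 / (2 (1-beta)), the constant terms contribute exactly what completes the series of A_n g_n z^n,
up to the term in eta, which is strictly positive. *)
Theorem duality (g A : nat -> C) (r beta phi kappa K : R) (z : C) :
  radius_ge g r -> g O = RtoC 1 -> A O = RtoC 1 -> (forall n, Cmod (A n) <= K) -> beta < 1 -> 0 < kappa ->
  (forall w, Cmod w < r -> 0 < Re (cis phi * (CPSeries g w - RtoC beta))) ->
  (forall w, Cmod w < 1 -> 1 - / (2 * (1 - beta)) + kappa * (1 - Cmod w) <= Re (CPSeries A w)) ->
  Cmod z < r ->
  0 < Re (cis phi * CPSeries (fun n => A n * g n)%C z).
Proof.
intros Hg Hg0 HA0 HK Hbeta Hkap Hu Hv Hz. pose proof (Cmod_ge_0 z) as Hz0. pose proof PI_RGT_0 as HPI.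
set (s := (Cmod z + r) / 2). assert (Hs : 0 < s) by (unfold s; lra).
assert (Hzs : Cmod z < s) by (unfold s; lra). assert (Hsr : s < r) by (unfold s; lra).
assert (HgeoA : radius_ge A 1) by (apply radius_ge_bounded with K; auto).
assert (HRs : RtoC s <> RtoC 0) by (apply RtoC_neq_0; lra).
set (y := (z / RtoC s)%C).
assert (Hy : Cmod y = Cmod z / s) by (unfold y; rewrite Cmod_div, Cmod_R, Rabs_pos_eq by (auto; lra); reflexivity).
assert (Hy1 : Cmod z / s < 1).
{ apply Rmult_lt_reg_r with s; auto. unfold Rdiv. rewrite Rmult_assoc, Rinv_l, Rmult_1_r by lra. lra. }
set (m := 1 - / (2 * (1 - beta))) in *.
(* On |w| = |z| / s, Re A exceeds m by at least eta; moving eta into Q O keeps v nonnegative. *)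
set (eta := kappa * (1 - Cmod z / s)).
assert (Heta : 0 < eta) by (apply Rmult_lt_0_compat; lra).
assert (Hcos : 0 < cos phi).
{ specialize (Hu (RtoC 0)). rewrite Cmod_0 in Hu. rewrite CPSeries_0, Hg0 in Hu. specialize (Hu ltac:(lra)).
  simpl in Hu. nra. }
set (P := fun n => match n with O => (cis phi * (1 - RtoC beta))%C | S _ => (cis phi * (g n * RtoC s ^ n))%C end).
set (Q := fun n => match n with O => RtoC (1 - m - eta) | S _ => (A n * y ^ n)%C end).
set (u := fun t => Series (fun n => Re (P n * cis (INR n * t)))).
set (v := fun t => Series (fun n => Re (Q n * cis (- INR n * t)))).
assert (Hut : forall t, u t = Re (cis phi * (CPSeries g (circ s t) - RtoC beta))).
{ intros t. apply Series_Re.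
  assert (Hc : Cmod (circ s t) < r) by (rewrite Cmod_circ; lra).
  rewrite (CPSeries_shift g r) by auto. rewrite Hg0.
  replace (cis phi * (1 + circ s t * CPSeries (fun n => g (S n)) (circ s t) - RtoC beta))%C
    with (P O * cis (INR 0 * t) + cis phi * circ s t * CPSeries (fun n => g (S n)) (circ s t))%C
    by (simpl INR; rewrite Rmult_0_l, cis_0; unfold P; ring).
  apply (is_Cseries_incr (fun n => P n * cis (INR n * t))%C).
  apply is_Cseries_ext with (fun n => cis phi * circ s t * (g (S n) * circ s t ^ n))%C.
  - intros n. rewrite <- cis_pow. unfold P, circ. rewrite Cpow_mult_l, !Cpow_S. ring.
  - apply is_Cseries_scal, is_Cseries_CPSeries with r; auto. apply radius_ge_shift; auto. }
assert (Hvt : forall t, v t = Re (CPSeries A (y * cis (- t))) - m - eta).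
{ intros t. assert (Hc : Cmod (y * cis (- t)) < 1) by (rewrite Cmod_mult, Cmod_cis, Hy; lra).
  replace (Re (CPSeries A (y * cis (- t))) - m - eta) with (Re (CPSeries A (y * cis (- t)) - RtoC (m + eta))) by (simpl; ring).
  apply Series_Re. rewrite (CPSeries_shift A 1) by auto. rewrite HA0.
  set (w := (y * cis (- t))%C).
  replace (1 + w * CPSeries (fun n => A (S n)) w - RtoC (m + eta))%C
    with (Q O * cis (- INR 0 * t) + w * CPSeries (fun n => A (S n)) w)%C.
  2:{ simpl INR. replace (- 0 * t) with 0 by ring. rewrite cis_0. unfold Q. rewrite RtoC_plus, !RtoC_minus. ring. }
  apply (is_Cseries_incr (fun n => Q n * cis (- INR n * t))%C).
  apply is_Cseries_ext with (fun n => w * (A (S n) * w ^ n))%C.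
  - intros n. replace (- INR (S n) * t) with (INR (S n) * - t) by ring. rewrite <- cis_pow.
    unfold Q, w. rewrite Cpow_mult_l, !Cpow_S. ring.
  - apply is_Cseries_scal, is_Cseries_CPSeries with 1; auto. apply radius_ge_shift; auto. }
assert (Hupos : forall t, 0 < u t) by (intros t; rewrite Hut; apply Hu; rewrite Cmod_circ; lra).
assert (Hvpos : forall t, 0 <= v t).
{ intros t. rewrite Hvt. specialize (Hv (y * cis (- t))%C). rewrite Cmod_mult, Cmod_cis, Hy, Rmult_1_r in Hv.
  specialize (Hv Hy1). fold eta in Hv. lra. }
assert (HexP : ex_series (fun n => Cmod (P n))).
{ apply (ex_series_incr_1 (fun n => Cmod (P n))).
  apply ex_series_ext with (fun n => s * Cmod (g (S n) * RtoC s ^ n)).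
  - intros n. real_goal. unfold P. rewrite Cpow_S, !Cmod_mult, Cmod_cis, Cmod_R, Rabs_pos_eq by lra. ring.
  - exact (ex_series_mult_l (s) _ (ex_series_Cmod_radius _ r s (radius_ge_shift _ _ Hg) ltac:(lra))). }
assert (HexQ : ex_series (fun n => Cmod (Q n))).
{ apply (ex_series_incr_1 (fun n => Cmod (Q n))).
  apply ex_series_ext with (fun n => Cmod y * (Cmod (A (S n)) * Cmod y ^ n)).
  - intros n. real_goal. unfold Q. rewrite Cpow_S, !Cmod_mult, Cmod_pow. ring.
  - destruct (radius_ge_ex_series _ 1 (Cmod y) (radius_ge_shift _ _ HgeoA)) as [l Hl]; [split; [apply Cmod_ge_0|lra]|].
    exists (Cmod y * l). apply @is_series_scal_l; auto. }
assert (Hucont : forall t, continuous u t).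
{ intros t. apply (continuous_ext (fun t => fst (cis phi * (CPSeries g (circ s t) - RtoC beta))%C)); [intros x; rewrite Hut; reflexivity|].
  assert (HC : Ccont (fun t => cis phi * (CPSeries g (circ s t) - RtoC beta))%C t); [|apply HC].
  apply Ccont_mult; [apply Ccont_const|].
  apply (Ccont_plus (fun t => CPSeries g (circ s t)) (fun _ => - RtoC beta)%C); [|apply Ccont_const].
  apply (Ccont_comp (CPSeries g) (CPSeries (deriv_coef g) (circ s t))); [apply Ccont_circ|].
  apply CPSeries_Cdiff with r; auto. rewrite Cmod_circ; lra. }
pose proof (fourier_pairing P Q HexP HexQ Hucont) as HI. cbv zeta in HI. fold u v in HI.
apply is_RInt_ge_0 in HI; [|lra|].
2:{ intros t _. apply Rmult_le_pos; [left; apply Hupos|apply Hvpos]. }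
assert (Hgeo : radius_ge (fun n => A n * g n)%C r).
{ apply radius_ge_poly with g K; auto. intros n. rewrite Cmod_mult. apply Rmult_le_compat_r; [apply Cmod_ge_0|].
  specialize (HK n). pose proof (Cmod_ge_0 (A n)). pose proof (pos_INR n). nra. }
set (T := CPSeries (fun n => A (S n) * g (S n))%C z).
assert (HT : is_Cseries (fun n => A (S n) * g (S n) * z ^ n)%C T).
{ apply is_Cseries_CPSeries with r; auto. apply (radius_ge_shift (fun n => A n * g n)%C); auto. }
assert (HS : is_series (fun n => pairing_term (P (S n)) (Q (S n)) (S n)) (PI * Re (cis phi * (z * T)))).
{ apply is_series_ext with (fun n => PI * Re (cis phi * z * (A (S n) * g (S n) * z ^ n))%C).
  - intros n. real_goal.
    unfold pairing_term. destruct (Nat.eq_dec (S n) 0); [lia|]. rewrite Rplus_0_r. f_equal. f_equal. unfold P, Q.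
    replace z with (y * RtoC s)%C at 1 2 by (unfold y; field; auto). rewrite Cpow_mult_l, !Cpow_S. ring.
  - apply @is_series_scal_l. replace (cis phi * (z * T))%C with (cis phi * z * T)%C by ring.
    apply is_series_Re, is_Cseries_scal; auto. }
assert (HStot : Series (fun k => pairing_term (P k) (Q k) k) = pairing_term (P O) (Q O) O + PI * Re (cis phi * (z * T))).
{ rewrite Series_incr_1; [|apply (ex_series_incr_1 (fun k => pairing_term (P k) (Q k) k)); eexists; exact HS].
  rewrite (is_series_unique _ _ HS). reflexivity. }
rewrite HStot in HI.
assert (HP0 : pairing_term (P O) (Q O) O = PI * (cos phi * (1 - 2 * (1 - beta) * eta))).
{ unfold pairing_term. destruct (Nat.eq_dec 0 0) as [_|N]; [|lia]. unfold P, Q, m. simpl. field. lra. }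
rewrite HP0 in HI. rewrite <- Rmult_plus_distr_l in HI.
assert (HI' : 0 <= cos phi * (1 - 2 * (1 - beta) * eta) + Re (cis phi * (z * T))).
{ apply Rmult_le_reg_l with PI; lra. }
rewrite (CPSeries_shift (fun n => A n * g n)%C r) by auto. fold T. rewrite HA0, Hg0.
replace (Re (cis phi * (1 * 1 + z * T))) with (cos phi + Re (cis phi * (z * T))) by (simpl; ring).
assert (0 < cos phi * (2 * (1 - beta) * eta)) by (repeat apply Rmult_lt_0_compat; lra). lra.
Qed.

(** * The Pascu class *)

(** Comparison of coefficients: 1 - alpha + 2 gamma + (alpha - 2 gamma)(n+1) + gamma n (n+1) = (1 + mu n)(1 + nu n). *)
Lemma W_expression_series alpha gamma mu nu f a r w : mu + nu = alpha - gamma -> mu * nu = gamma ->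
  radius_ge a r -> (forall w, Cmod w < r -> f w = CPSeries a w) -> a O = RtoC 0 -> Cmod w < r ->
  ((1 - alpha + 2 * gamma) * div_id f w + (alpha - 2 * gamma) * C_derive f w
     + gamma * (w * C_derive (C_derive f) w))%C
  = CPSeries (fun n => RtoC ((1 + mu * INR n) * (1 + nu * INR n)) * a (S n))%C w.
Proof.
intros H1 H2 Hg Hf Ha0 Hw.
pose proof (CPSeries_on_disc_derive f a r Hg Hf) as Hd.
pose proof (radius_ge_deriv a r Hg) as Hg1.
pose proof (CPSeries_on_disc_derive (C_derive f) (deriv_coef a) r Hg1 Hd) as Hdd.
assert (Hdiv : div_id f w = CPSeries (fun n => a (S n)) w).
{ unfold div_id. destruct (Ceq_dec w 0) as [E|E].
  - subst w. rewrite Hd, !CPSeries_0 by auto. unfold deriv_coef. simpl. rewrite Rplus_0_l. ring.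
  - rewrite Hf, (CPSeries_shift a r), Ha0 by auto. field. auto. }
rewrite Hdiv, Hd, Hdd, (CPSeries_times_n _ r) by auto.
symmetry. apply CPSeries_unique.
apply is_Cseries_ext with (fun n => (1 - RtoC alpha + 2 * RtoC gamma) * (a (S n) * w ^ n)
   + (RtoC alpha - 2 * RtoC gamma) * (deriv_coef a n * w ^ n) + RtoC gamma * (times_n (deriv_coef a) n * w ^ n))%C.
- intros n. unfold times_n, deriv_coef.
  replace ((1 + mu * INR n) * (1 + nu * INR n)) with (1 + (mu + nu) * INR n + mu * nu * (INR n * INR n)) by ring.
  rewrite H1, H2. rewrite !RtoC_plus, !RtoC_mult, !RtoC_minus. ring.
- apply is_Cseries_plus; [apply is_Cseries_plus|]; apply is_Cseries_scal; apply is_Cseries_CPSeries with r; auto.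
  + apply radius_ge_shift; auto.
  + apply radius_ge_times_n; auto.
Qed.

Lemma dual_coef_bound a b mu nu xi x n : -1 < a -> -1 < b -> 1 <= mu -> 0 < nu -> 0 <= xi <= 1 -> Cmod x <= 1 ->
  Cmod (RtoC (dual_coef a b mu nu xi n) * test_coef x n) <= (a + 1) * (b + 1) * ((1 + / (a + 1)) * (1 + / (b + 1))).
Proof.
intros Ha Hb Hm Hn Hxi Hx. pose proof (pos_INR n) as HN.
assert (0 <= nu * INR n) by nra. assert (0 <= xi * INR n <= INR n) by nra. assert (INR n <= mu * INR n) by nra.
pose proof (pole_ratio n (a + 1) ltac:(lra)) as PA. pose proof (pole_ratio n (b + 1) ltac:(lra)) as PB.
set (A' := (INR n + 1) / (INR n + (a + 1))) in *. set (B' := (INR n + 1) / (INR n + (b + 1))) in *.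
rewrite Cmod_mult, Cmod_R. pose proof (Cmod_test_coef x n Hx) as Hh.
set (D := (1 + mu * INR n) * (1 + nu * INR n)).
assert (HD : INR n + 1 <= D) by (unfold D; nra).
set (q := (1 + xi * INR n) / D).
assert (Hq : 0 <= q <= 1).
{ unfold q. split; [apply Rdiv_le_0_compat; lra|].
  apply Rmult_le_reg_r with D; [lra|]. unfold Rdiv. rewrite Rmult_assoc, Rinv_l; lra. }
pose proof (tau_pos a b n Ha Hb) as Htau.
replace (dual_coef a b mu nu xi n) with (tau a b n * q) by (unfold dual_coef, q, D, Rdiv; ring).
rewrite Rabs_pos_eq by (apply Rmult_le_pos; lra).
assert (HAB : 0 < A' * B' <= (1 + / (a + 1)) * (1 + / (b + 1))).
{ split; [apply Rmult_lt_0_compat; lra|apply Rmult_le_compat; lra]. }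
assert (E : tau a b n * ((INR n + 1) * (INR n + 1)) = (a + 1) * (b + 1) * (A' * B')).
{ unfold tau, A', B'. field. split; lra. }
apply Rle_trans with (tau a b n * 1 * (INR n + 1)).
- apply Rmult_le_compat; auto; [apply Rmult_le_pos; lra|apply Cmod_ge_0|]. apply Rmult_le_compat_l; lra.
- apply Rle_trans with (tau a b n * ((INR n + 1) * (INR n + 1))).
  + rewrite Rmult_1_r. apply Rmult_le_compat_l; [lra|]. nra.
  + rewrite E. apply Rmult_le_compat_l; [|lra]. apply Rmult_le_pos; lra.
Qed.

(** With N and D the numerator and denominator of the Pascu quotient, (1+x)/2 N + (1-x)/2 D equals z
times the series that [duality] shows to be nonzero, for every |x| <= 1. *)
Theorem V_lambda_in_class_M (alpha gamma xi mu nu a b beta : R) (q : R -> R) :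
  0 <= xi <= 1 -> 1 <= mu -> 0 < nu -> mu + nu = alpha - gamma -> mu * nu = gamma ->
  -1 < a -> -1 < b -> is_q mu nu q -> beta < 1 ->
  (beta - 1 / 2) / (1 - beta)
    = - RInt_gen (fun t => lambda a b t * q t) (at_right 0) (at_left 1) ->
  a <= 0 \/ b <= 0 -> a + b <= 2 ->
  forall f : C -> C, class_W beta alpha gamma f ->
  class_M xi (V_op (lambda a b) f).
Proof.
intros Hxi Hmu Hnu Hsum Hprod Ha Hb Hq Hbeta Hint Hab0 Hab f [[Hf [Hf0 Hf1]] [phi HW]].
rewrite (lambda_q_integral a b mu nu q Ha Hb ltac:(lra) Hnu Hq) in Hint.
assert (Hm : Series (fun n => tau a b n * q_coef mu nu n) = 1 - / (2 * (1 - beta))).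
{ replace (1 - / (2 * (1 - beta))) with (- ((beta - 1 / 2) / (1 - beta))) by (field; lra). lra. }
destruct (dual_inequality a b mu nu xi Ha Hb Hab0 Hab Hmu Hnu Hxi) as (kap & Hkap & Hineq).
rewrite Hm in Hineq.
set (F := V_op (lambda a b) f).

(* Expansions of f and F on a disc of radius r; the coefficients may depend on r. *)
assert (Hloc : forall r, 0 < r < 1 -> exists c, radius_ge c r /\ c O = RtoC 0 /\ c 1%nat = RtoC 1 /\
  (forall w, Cmod w < r -> f w = CPSeries c w) /\ (forall w, Cmod w < r -> F w = CPSeries (V_coef a b c) w)).
{ intros r Hr. destruct (analytic_CPSeries f r Hf Hr) as (c & Hc & Hfc). exists c.
  assert (Hz : Cmod (RtoC 0) < r) by (rewrite Cmod_0; lra).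
  assert (Hc0 : c O = RtoC 0) by (rewrite <- CPSeries_0, <- Hfc; auto).
  assert (Hc1 : c 1%nat = RtoC 1).
  { rewrite (CPSeries_on_disc_derive f c r Hc Hfc _ Hz), CPSeries_0 in Hf1. unfold deriv_coef in Hf1. simpl in Hf1.
    rewrite Rplus_0_l, Cmult_1_l in Hf1. exact Hf1. }
  repeat split; auto. intros w Hw. apply V_op_series with r; auto. }
split.
- split; [|split].
  + intros z Hz. unfold unit_disc in Hz. pose proof (Cmod_ge_0 z).
    destruct (Hloc ((1 + Cmod z) / 2) ltac:(lra)) as (c & Hc & _ & _ & _ & HF).
    eapply Cdiff_ex_derive. apply (CPSeries_on_disc_Cdiff F (V_coef a b c) ((1 + Cmod z) / 2)); auto; [apply radius_ge_V_coef; auto|lra].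
  + destruct (Hloc (1 / 2) ltac:(lra)) as (c & _ & _ & _ & _ & HF).
    rewrite HF, CPSeries_0 by (rewrite Cmod_0; lra). reflexivity.
  + destruct (Hloc (1 / 2) ltac:(lra)) as (c & Hc & _ & Hc1 & _ & HF).
    rewrite (CPSeries_on_disc_derive F (V_coef a b c) (1 / 2)), CPSeries_0 by (auto; try apply radius_ge_V_coef; auto; rewrite Cmod_0; lra).
    unfold deriv_coef, V_coef. rewrite Hc1. unfold tau. simpl INR.
    replace ((a + 1) * (b + 1) / ((0 + a + 1) * (0 + b + 1))) with 1 by (field; lra). rewrite Rplus_0_l. ring.
- intros z Hz Hz0. unfold unit_disc in Hz. pose proof (Cmod_ge_0 z) as HzC.
  set (r := (1 + Cmod z) / 2). assert (Hr : 0 < r < 1) by (unfold r; lra). assert (Hzr : Cmod z < r) by (unfold r; lra).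
  destruct (Hloc r Hr) as (c & Hc & Hc0 & Hc1 & Hfc & HF).
  set (B := V_coef a b c) in *. assert (HB : radius_ge B r) by (apply radius_ge_V_coef; auto).
  set (N := pascu_num xi F z). set (D := pascu_den xi F z).
  assert (HFd : forall w, Cmod w < r -> (w * C_derive F w)%C = CPSeries (times_n B) w).
  { intros w Hw. rewrite (CPSeries_on_disc_derive F B r HB HF w Hw). apply CPSeries_times_n with r; auto. }
  assert (HFdd : (z * C_derive (fun w => w * C_derive F w)%C z)%C = CPSeries (times_n (times_n B)) z).
  { rewrite (CPSeries_on_disc_derive (fun w => w * C_derive F w)%C (times_n B) r (radius_ge_times_n _ _ HB) HFd z Hzr).
    apply CPSeries_times_n with r; auto. apply radius_ge_times_n; auto. }
  assert (HZ : forall x, Cmod x <= 1 -> ((1 + x) / 2 * N + (1 - x) / 2 * D)%C <> RtoC 0).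
  { intros x Hx.
    set (g := fun n => (RtoC ((1 + mu * INR n) * (1 + nu * INR n)) * c (S n))%C).
    set (A := fun n => (RtoC (dual_coef a b mu nu xi n) * test_coef x n)%C).
    assert (HAg : forall n, (A n * g n)%C = (RtoC (1 + xi * INR n) * test_coef x n * B (S n))%C).
    { intros n. pose proof (pos_INR n). unfold A, g, B, V_coef.
      assert (E : dual_coef a b mu nu xi n * ((1 + mu * INR n) * (1 + nu * INR n)) = (1 + xi * INR n) * tau a b n).
      { unfold dual_coef. field. split; nra. }
      transitivity (RtoC (dual_coef a b mu nu xi n * ((1 + mu * INR n) * (1 + nu * INR n))) * test_coef x n * c (S n))%C.
      - rewrite !RtoC_mult. ring.
      - rewrite E, !RtoC_mult. ring. }
    assert (Hgg : radius_ge g r).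
    { apply radius_ge_poly with (fun n => c (S n)) (mu * (1 + nu)); [apply radius_ge_shift; auto|].
      intros n. pose proof (pos_INR n). unfold g. rewrite Cmod_mult, Cmod_R.
      assert (0 <= nu * INR n) by nra. assert (0 <= mu * INR n) by nra.
      rewrite Rabs_pos_eq by nra. apply Rmult_le_compat_r; [apply Cmod_ge_0|].
      apply Rle_trans with ((mu * (INR n + 1)) * ((1 + nu) * (INR n + 1))); [apply Rmult_le_compat; nra|right; ring]. }
    assert (HA0 : A O = RtoC 1).
    { unfold A, test_coef, dual_coef, tau. simpl INR.
      replace ((a + 1) * (b + 1) / ((0 + a + 1) * (0 + b + 1)) * (1 + xi * 0) / ((1 + mu * 0) * (1 + nu * 0))) with 1 by (field; lra). ring. }
    assert (Hg0 : g O = RtoC 1).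
    { unfold g. rewrite Hc1. simpl INR. replace ((1 + mu * 0) * (1 + nu * 0)) with 1 by ring. ring. }
    assert (Hpos : 0 < Re (cis phi * CPSeries (fun n => A n * g n)%C z)).
    { apply (duality g A r beta phi kap ((a + 1) * (b + 1) * ((1 + / (a + 1)) * (1 + / (b + 1))))); auto.
      - intros n. apply dual_coef_bound; auto.
      - intros w Hw. specialize (HW w ltac:(unfold unit_disc; lra)).
        rewrite (W_expression_series alpha gamma mu nu f c r w) in HW; auto.
      - intros w Hw. eapply Rle_trans; [apply (Hineq x w Hx Hw)|].
        right. rewrite <- (Series_Re (fun n => A n * w ^ n)%C).
        + apply Series_ext. intros n. unfold A. rewrite <- Cmult_assoc, re_scal_l. reflexivity.
        + apply is_Cseries_CPSeries with 1; auto. apply radius_ge_bounded with ((a + 1) * (b + 1) * ((1 + / (a + 1)) * (1 + / (b + 1)))).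
          intros n. apply dual_coef_bound; auto. }
    set (Zx := CPSeries (fun n => A n * g n)%C z) in *.
    assert (EZ : ((1 + x) / 2 * N + (1 - x) / 2 * D)%C = (z * Zx)%C).
    { assert (HN : is_Cseries (fun n => RtoC xi * (times_n (times_n B) n * z ^ n) + (1 - RtoC xi) * (times_n B n * z ^ n))%C N).
      { unfold N, pascu_num. rewrite HFdd, HFd by auto.
        apply is_Cseries_plus; apply is_Cseries_scal; apply is_Cseries_CPSeries with r; auto; repeat apply radius_ge_times_n; auto. }
      assert (HD : is_Cseries (fun n => RtoC xi * (times_n B n * z ^ n) + (1 - RtoC xi) * (B n * z ^ n))%C D).
      { unfold D, pascu_den. rewrite HFd, HF by auto.
        apply is_Cseries_plus; apply is_Cseries_scal; apply is_Cseries_CPSeries with r; auto; apply radius_ge_times_n; auto. }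
      pose proof (is_Cseries_plus _ _ _ _ (is_Cseries_scal ((1 + x) / 2) _ _ HN) (is_Cseries_scal ((1 - x) / 2) _ _ HD)) as HND.
      assert (HZx : is_Cseries (fun n => A n * g n * z ^ n)%C Zx).
      { apply is_Cseries_CPSeries with r; auto. apply radius_ge_poly with g ((a + 1) * (b + 1) * ((1 + / (a + 1)) * (1 + / (b + 1)))); auto.
        intros n. rewrite Cmod_mult. apply Rmult_le_compat_r; [apply Cmod_ge_0|].
        pose proof (dual_coef_bound a b mu nu xi x n Ha Hb Hmu Hnu Hxi Hx) as Hbd. fold (A n) in Hbd.
        pose proof (Cmod_ge_0 (A n)). pose proof (pos_INR n). nra. }
      pose proof (is_Cseries_scal z _ _ HZx) as HzZ.
      match type of HND with is_Cseries ?s _ => pose proof (is_Cseries_incr s (z * Zx)%C) as Hinc end.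
      cbv beta in Hinc.
      assert (HzZ' : is_Cseries (fun n => (1 + x) / 2 * (RtoC xi * (times_n (times_n B) (S n) * z ^ S n) + (1 - RtoC xi) * (times_n B (S n) * z ^ S n))
         + (1 - x) / 2 * (RtoC xi * (times_n B (S n) * z ^ S n) + (1 - RtoC xi) * (B (S n) * z ^ S n)))%C (z * Zx)%C).
      { eapply is_Cseries_ext; [|exact HzZ]. intros n. cbv beta. rewrite HAg. unfold times_n, test_coef.
        rewrite S_INR, !RtoC_plus, RtoC_mult, Cpow_S. field. }
      specialize (Hinc HzZ').
      rewrite (is_Cseries_unique _ _ _ HND Hinc).
      unfold times_n, B, V_coef. ring. }
    rewrite EZ. apply Cmult_neq_0; auto. intros E. rewrite E in Hpos. simpl in Hpos. lra. }
  assert (HD0 : D <> RtoC 0).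
  (* At x = -1 the combination is D. *)
  { intros E. apply (HZ (RtoC (-1))).
    - rewrite Cmod_R, Rabs_left by lra. lra.
    - rewrite E. replace (1 + RtoC (-1))%C with (RtoC 0) by (rewrite <- RtoC_plus; f_equal; ring). field. }
  split; auto. fold N D.
  apply Rnot_le_lt. intros Hle.
  assert (HNp : N = (N / D * D)%C) by (field; auto).
  set (p := (N / D)%C) in *. clearbody p.
  assert (Hp1 : (1 - p)%C <> RtoC 0).
  { intros E. assert (Ep : p = RtoC 1) by (replace p with (1 - (1 - p))%C by ring; rewrite E; ring).
    rewrite Ep in Hle. simpl in Hle. lra. }
  (* This x has modulus at most 1 when Re p <= 0, and the combination vanishes at it. *)
  apply (HZ ((1 + p) / (1 - p))%C).
  - rewrite Cmod_div by auto. assert (Hpos : 0 < Cmod (1 - p)) by (apply Cmod_gt_0; auto).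
    apply Rmult_le_reg_r with (Cmod (1 - p)); auto. unfold Rdiv. rewrite Rmult_assoc, Rinv_l, Rmult_1_r, Rmult_1_l by lra.
    assert (Hsq : Cmod (1 + p) ^ 2 <= Cmod (1 - p) ^ 2).
    { rewrite !Cmod2_alt. unfold Re, Im in *. simpl. lra. }
    pose proof (Cmod_ge_0 (1 + p)). nra.
  - rewrite HNp. field. auto.
Qed.

Theorem theorem3p5 :
  forall (alpha gamma xi mu nu a b beta : R) (q : R -> R),
  0 <= alpha -> 0 < gamma -> 0 <= xi <= 1 ->
  1 <= mu -> 0 < nu -> mu + nu = alpha - gamma -> mu * nu = gamma ->
  -1 < a -> -1 < b ->
  is_q mu nu q ->
  beta < 1 ->
  (beta - 1 / 2) / (1 - beta)
    = - RInt_gen (fun t => lambda a b t * q t) (at_right 0) (at_left 1) ->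
  ((a < b /\ -1 < a < 0 /\ b + a - 1 < 1 / mu < b - 1) \/
   (b < a /\ -1 < b < 0 /\ b + a - 1 < 1 / mu < a - 1) \/
   (b = a /\ a < 0 /\ b - 1 < 1 / mu)) ->
  forall f : C -> C, class_W beta alpha gamma f ->
  class_M xi (V_op (lambda a b) f).
Proof.
intros alpha gamma xi mu nu a b beta q _ _ Hxi Hmu Hnu Hsum Hprod Ha Hb Hq Hbeta Hint Hcases f Hf.
assert (Hp : 1 / mu <= 1).
{ apply Rmult_le_reg_r with mu; [lra|]. replace (1 / mu * mu) with 1 by (field; lra). lra. }
apply (V_lambda_in_class_M alpha gamma xi mu nu a b beta q); auto; lra.
Qed.
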